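(* Let $\mathfrak s$ be a symmetry jet on $M$, with associated distribution $\mathcal D^{\mathfrak s}$ on $\mathcal B^{(1)}$. Then $\xi\in\mathcal B^{(1)}$ belongs to the integrability locus $\mathrm{Int}(\mathcal D^{\mathfrak s})$ if and only if $\kappa(\mathbb S(\xi))=\mathbb S(\xi)$. In particular, $\mathrm{Int}(\mathcal D^{\mathfrak s})$ is the set of $1$-jets $\xi\in\mathcal B^{(1)}$ that preserve both the torsion and the curvature of $\nabla^{\mathfrak s}$.
   Context: All objects are smooth. $\mathcal B^{(1)}$ is the Lie groupoid over $M$ of linear isomorphisms ($1$-jets) $\xi:T_xM\to T_yM$, source $\alpha(\xi)=x$, target $\beta(\xi)=y$; $-I_x=-\mathrm{id}_{T_xM}$. A local bisection of a Lie groupoid $G\rightrightarrows M$ is a section $b:U\to G$ of $\alpha$ over an open $U$ with $b^0:=\beta\circ b$ a diffeomorphism onto an open set; the $1$-jets $j^1_xb$ of local bisections of $G$ form a Lie groupoid over $M$. $\mathcal B^{(1,1)}_{nh}$ (resp. $\mathcal B^{(1,1,1)}_{nh}$) is the groupoid of $1$-jets of local bisections of $\mathcal B^{(1)}$ (resp. of $\mathcal B^{(1,1)}_{nh}$). On $\mathcal B^{(1,1)}_{nh}$: $p(j^1_xb)=b(x)$, $p_*(j^1_xb)=(b^0)_{*_x}$; $\mathcal B^{(1,1)}_{sh}=\{p=p_*\}$. On $\mathcal B^{(1,1,1)}_{nh}$: $p(j^1_xb)=b(x)$, $p_*(j^1_xb)=j^1_x(p\circ b)$, $p_{**}(j^1_xb)=j^1_x(p_*\circ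 b)$; $\mathcal B^{(1,1,1)}=\{p=p_*=p_{**}\in\mathcal B^{(1,1)}_{sh}\}$. A symmetry jet is a smooth section $\mathfrak s:M\to\mathcal B^{(1,1)}_{sh}$, $\mathfrak s(x)$ being a jet at $x$ with $p(\mathfrak s(x))=-I_x$. With $(bY)_{b^0(x')}=b(x')Y_{x'}$, the associated connection is $(\nabla^{\mathfrak s}_XY)_x=\frac12[X,Y+s_xY]_x$ where $\mathfrak s(x)=j^1_xs_x$. Each $\xi\in\mathcal B^{(1)}$ with $\alpha(\xi)=x$ has a unique extension $S(\xi)=j^1_xa\in\mathcal B^{(1,1)}_{sh}$ with $p(S(\xi))=\xi$ that is affine: $\xi(\nabla^{\mathfrak s}_{X_x}Y)=\nabla^{\mathfrak s}_{\xi X_x}(aY)$ for all $X_x,Y$. $\mathcal D^{\mathfrak s}_\xi=a_{*_x}(T_xM)\subset T_\xi\mathcal B^{(1)}$ and $\mathbb S(\xi)=j^1_x(S\circ a)\in\mathcal B^{(1,1,1)}$, for any such $a$. The integrability locus of a distribution $\mathcal D$ on a manifold $W$ is $\mathrm{Int}(\mathcal D)=\{w\in W:\ [A,B]_w\in\mathcal D_w$ for all local vector fields $A,B$ near $w$ tangent to $\mathcal D\}$. $j^1_xb\in\mathcal B^{(1,1)}_{nh}$ acts on $T^2M$ over $x$ by $j^1_xb\cdot\frac{dX_t}{dt}|_0=\frac{d}{dt}(b(x_t)X_t)|_0$ ($X_t\in T_{x_t}M$), and $j^1_xb\in\mathcal B^{(1,1,1)}_{nh}$ acts on $T^3M=T(T^2M)$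 over $x$ by $j^1_xb\cdot\frac{d\mathcal Z_t}{dt}|_0=\frac{d}{dt}(b(x_t)\cdot\mathcal Z_t)|_0$ ($\mathcal Z_t\in T^2M$ over $x_t$); these actions are effective. The canonical involution of $T^2N$ is $(u,Q,R,W)\mapsto(u,R,Q,W)$ in coordinates induced by a chart of $N$ (vector with components $(R,W)$ at $(u,Q)\in TN$); $\kappa:T^3M\to T^3M$ is that of $T^2N$ with $N=TM$. $\kappa(\eta)$, for $\eta\in\mathcal B^{(1,1,1)}$, is determined by $\kappa(\eta)\cdot\mathfrak X=\kappa(\eta\cdot\kappa(\mathfrak X))$. Torsion $T(X,Y)=\nabla_XY-\nabla_YX-[X,Y]$; curvature $R(X,Y)Z=\nabla_X\nabla_YZ-\nabla_Y\nabla_XZ-\nabla_{[X,Y]}Z$. $\xi$ preserves a $TM$-valued covariant tensor $Q$ if $Q(\xi X_1,\dots,\xi X_k)=\xi Q(X_1,\dots,X_k)$ for all $X_i\in T_{\alpha(\xi)}M$. *)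

(* Defs.v *)
(* Manifolds are sets with an atlas.  The data of
   an atlas ([charted]) is separated from the axioms ([is_manifold]), so that
   tangent and jet manifolds are given by their induced atlases.
   A preferred chart [chart_at x] around each point x trivialises T_x N: a
   tangent vector at x is the row vector of its components in [chart_at x], and
   a linear map T_x M -> T_y N is a matrix acting on the right of row vectors. *)
From Stdlib Require Import ClassicalEpsilon.
From mathcomp Require Import all_boot all_order all_algebra.
From mathcomp Require Import all_classical all_reals.
From mathcomp Require Import topology normedtype derive.

Set Implicit Arguments.
Unset Strict Implicit.
Unset Printing Implicit Defensive.

Import GRing.Theory numFieldNormedType.Exports.
Local Open Scope classical_set_scope.
Local Open Scope ring_scope.

(* f is of class C^k on the open set O *)
Fixpoint Ck (R : realType) (m p k : nat) (O : set 'rV[R]_m)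
    (f : 'rV[R]_m -> 'rV[R]_p) : Prop :=
  (forall u, O u -> {for u, continuous f}) /\
  if k is k'.+1 then
    forall v : 'rV[R]_m, (forall u, O u -> derivable f u v) /\
      Ck k' O (fun u => 'D_v f u : 'rV[R]_p)
  else True.

Definition Cinf (R : realType) (m p : nat) (O : set 'rV[R]_m)
    (f : 'rV[R]_m -> 'rV[R]_p) : Prop := forall k, Ck k O f.

Record charted (R : realType) (m : nat) := Charted {
  carrier :> Type;
  chart : Type;
  dom : chart -> set carrier;
  phi : chart -> carrier -> 'rV[R]_m;
  inv : chart -> 'rV[R]_m -> carrier;
  chart_at : carrier -> chart }.

Arguments dom {R m N} c _ : rename.
Arguments phi {R m N} c _ : rename.
Arguments inv {R m N} c _ : rename.
Arguments chart_at {R m N} x : rename.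

Section Manifolds.
Context {R : realType}.

(* open for the topology induced by the atlas *)
Definition mopen (m : nat) (N : charted R m) (U : set N) : Prop :=
  forall c : chart N, open (phi c @` (dom c `&` U)).

Definition is_manifold (m : nat) (N : charted R m) : Prop :=
  [/\ (forall x : N, dom (chart_at x) x),
      (forall (c : chart N) x, dom c x -> inv c (phi c x) = x),
      (forall c d : chart N, open (phi c @` (dom c `&` dom d)) /\
         Cinf (phi c @` (dom c `&` dom d)) (phi d \o inv c)),
      (forall x y : N, x <> y -> exists U V : set N,
         [/\ mopen U, mopen V, U x, V y & U `&` V = set0]) &
      (exists B : nat -> set N, (forall k, mopen (B k)) /\
         forall (U : set N) x, mopen U -> U x ->
           exists k, B k x /\ B k `<=` U)].

(* f is smooth on U; the openness of each f^-1 (dom d) is continuity *)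
Definition smooth_on (m p : nat) (N : charted R m) (N' : charted R p)
    (U : set N) (f : N -> N') : Prop :=
  mopen U /\
  forall (c : chart N) (d : chart N'),
    let O := phi c @` (dom c `&` U `&` f @^-1` dom d) in
    open O /\ Cinf O (phi d \o f \o inv c).

(* the matrix of f_{*x} : T_x N -> T_{f x} N' *)
Definition tanmx (m p : nat) (N : charted R m) (N' : charted R p)
    (f : N -> N') (x : N) : 'M[R]_(m, p) :=
  'J (phi (chart_at (f x)) \o f \o inv (chart_at x)) (phi (chart_at x) x).

(* change of components of tangent vectors at x, from chart c to chart d *)
Definition trans (m : nat) (N : charted R m) (c d : chart N) (x : N) : 'M[R]_m :=
  'J (phi d \o inv c) (phi c x).

Definition Tan (m : nat) (N : charted R m) : charted R (m + m) :=
  {| carrier := (N * 'rV[R]_m)%type;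
     chart := chart N;
     dom := fun c X => dom c X.1;
     phi := fun c X =>
       row_mx (phi c X.1) (X.2 *m trans (chart_at X.1) c X.1);
     inv := fun c u =>
       let x := inv c (lsubmx u) in (x, rsubmx u *m trans c (chart_at x) x);
     chart_at := fun X => chart_at X.1 |}.

Definition tbase (m : nat) (N : charted R m) (X : Tan N) : N := X.1.

Definition tmap (m p : nat) (N : charted R m) (N' : charted R p)
    (f : N -> N') (X : Tan N) : Tan N' := (f X.1, X.2 *m tanmx f X.1).

(* The canonical involution (u, Q, R, W) |-> (u, R, Q, W).  The second component
   of Z is taken in the preferred chart of Tan N at (u, Q), which is the one
   induced by [chart_at u]: its blocks are (R, W). *)
Definition flip (m : nat) (N : charted R m) (Z : Tan (Tan N)) : Tan (Tan N) :=
  ((Z.1.1, lsubmx Z.2), row_mx Z.1.2 (rsubmx Z.2)).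

Section LinearMaps.
Variables (m p : nat) (N : charted R m) (N' : charted R p).

(* a point x of N, a point y of N' and a linear map T_x N -> T_y N' *)
Record hom := Hom { src : N; tgt : N'; lin : 'M[R]_(m, p) }.

Definition HomB : charted R (m + p + m * p) :=
  {| carrier := hom;
     chart := (chart N * chart N')%type;
     dom := fun cd j => dom cd.1 (src j) /\ dom cd.2 (tgt j);
     phi := fun cd j =>
       row_mx (row_mx (phi cd.1 (src j)) (phi cd.2 (tgt j)))
         (mxvec (trans cd.1 (chart_at (src j)) (src j) *m lin j
                 *m trans (chart_at (tgt j)) cd.2 (tgt j)));
     inv := fun cd u =>
       let x := inv cd.1 (lsubmx (lsubmx u)) in
       let y := inv cd.2 (rsubmx (lsubmx u)) in
       Hom x y (trans (chart_at x) cd.1 x *m vec_mx (rsubmx u)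
                *m trans cd.2 (chart_at y) y);
     chart_at := fun j => (chart_at (src j), chart_at (tgt j)) |}.

(* j^1_x b, which amounts to the point b x and the linear map b_{*x} *)
Definition jet (b : N -> N') (x : N) : HomB := Hom x (b x) (tanmx b x).

End LinearMaps.

(* A vector field is given by its components in the preferred charts. *)
Definition vfield_on (m : nat) (N : charted R m) (U : set N)
    (X : N -> 'rV[R]_m) : Prop :=
  smooth_on U (fun x => (x, X x) : Tan N).

Definition vf_comp (m : nat) (N : charted R m) (c : chart N)
    (X : N -> 'rV[R]_m) (u : 'rV[R]_m) : 'rV[R]_m :=
  X (inv c u) *m trans (chart_at (inv c u)) c (inv c u).

Definition lie (m : nat) (N : charted R m) (X Y : N -> 'rV[R]_m) (x : N) :
    'rV[R]_m :=
  let c := chart_at x in let u := phi c x in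
  'D_(vf_comp c X u) (vf_comp c Y) u - 'D_(vf_comp c Y u) (vf_comp c X) u.

(* the integrability locus of a distribution D on an open subset W of N *)
Definition Int (m : nat) (N : charted R m) (W : set N) (D : N -> set 'rV[R]_m) :
    set N :=
  [set w | W w /\
    forall (U : set N) (A B : N -> 'rV[R]_m), U w -> U `<=` W ->
      vfield_on U A -> vfield_on U B ->
      (forall u, U u -> D u (A u) /\ D u (B u)) -> D w (lie A B w)].

End Manifolds.

Section Jets.
Context {R : realType} {n : nat} (M : charted R n).

(* a map M -> N together with the subset on which it is considered *)
Record lsec (m : nat) (N : charted R m) := Lsec { ldom : set M; lfun :> M -> N }.

Section Bisections.
(* a groupoid G over M with source [al] and target [be], embedded in N *)
Variables (m : nat) (N : charted R m) (G : set N) (al be : N -> M).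

Definition bisection (b : lsec N) : Prop :=
  let U := ldom b in let b0 := be \o b in
  [/\ smooth_on U b,
      (forall x, U x -> G (b x) /\ al (b x) = x),
      smooth_on U b0 &
      exists g : M -> M, smooth_on (b0 @` U) g /\
        forall x, U x -> g (b0 x) = x].

Definition represents (b : lsec N) (j : HomB M N) : Prop :=
  [/\ bisection b, ldom b (src j) & j = jet b (src j)].

(* The groupoid of 1-jets of bisections of G: an embedded submanifold of
   [HomB M N], so that smoothness into it is smoothness into [HomB M N]. *)
Definition jets : set (HomB M N) := [set j | exists b, represents b j].

(* a bisection b with j = j^1_x b; the operations on jets below are computed
   on this representative and do not depend on its choice *)
Definition rep (j : HomB M N) : lsec N :=
  epsilon (inhabits (Lsec set0 (fun=> tgt j))) (fun b => represents b j).

End Bisections.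

Definition H1 := HomB M M.
Definition H2 := HomB M H1.
Definition H3 := HomB M H2.

(* the groupoids B^(1), B^(1,1)_nh and B^(1,1,1)_nh, with their targets;
   their sources are given by [src] *)
Definition B1 : set H1 := [set xi | lin xi \in unitmx].
Definition beta1 (xi : H1) : M := tgt xi.
Definition B11nh : set H2 := jets B1 (@src _ _ _ _ _) beta1.
Definition beta2 (j : H2) : M := beta1 (tgt j).
Definition B111nh : set H3 := jets B11nh (@src _ _ _ _ _) beta2.

Definition rep2 (j : H2) : lsec H1 := rep B1 (@src _ _ _ _ _) beta1 j.
Definition rep3 (eta : H3) : lsec H2 := rep B11nh (@src _ _ _ _ _) beta2 eta.

Definition p2 (j : H2) : H1 := tgt j.
Definition p2_star (j : H2) : H1 := jet (beta1 \o rep2 j) (src j).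
Definition B11sh : set H2 := [set j | B11nh j /\ p2 j = p2_star j].

(* The tangent map of X |-> b(x) X sends the velocity of a curve X_t in TM to
   the velocity of b(x_t) X_t. *)
Definition act1 (xi : H1) (X : Tan M) : Tan M := (tgt xi, X.2 *m lin xi).
Definition act2 (j : H2) (Z : Tan (Tan M)) : Tan (Tan M) :=
  tmap (fun X : Tan M => act1 (rep2 j (tbase X)) X) Z.
Definition act3 (eta : H3) (X : Tan (Tan (Tan M))) : Tan (Tan (Tan M)) :=
  tmap (fun Z : Tan (Tan M) => act2 (rep3 eta (tbase (tbase Z))) Z) X.

Definition kappa (X : Tan (Tan (Tan M))) : Tan (Tan (Tan M)) :=
  flip (N := Tan M) X.

(* Elements given by existence and uniqueness are written with [epsilon], which
   is unspecified when no element satisfies the predicate. *)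
Definition kappa_jet (eta : H3) : H3 :=
  epsilon (inhabits eta) (fun eta' =>
    [/\ B111nh eta', src eta' = src eta &
        forall X : Tan (Tan (Tan M)), tbase (tbase (tbase X)) = src eta ->
          act3 eta' X = kappa (act3 eta (kappa X))]).

Definition symmetry_jet (s : M -> H2) : Prop :=
  smooth_on setT s /\
  forall x, [/\ B11sh (s x), src (s x) = x & p2 (s x) = Hom x x (- 1%:M)].

(* the vector field bY, defined on the image under b^0 of the domains *)
Definition push (b : lsec H1) (Y : M -> 'rV[R]_n) (y : M) : 'rV[R]_n :=
  let x := epsilon (inhabits y) (fun x => ldom b x /\ beta1 (b x) = y) in
  Y x *m lin (b x).

(* Y + s_x Y vanishes at x, so the bracket only depends on the value of X at x. *)
Definition nabla (s : M -> H2) (X Y : M -> 'rV[R]_n) (x : M) : 'rV[R]_n :=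
  2^-1 *: lie X (fun z => Y z + push (rep2 (s x)) Y z) x.

Definition torsion (s : M -> H2) (X Y : M -> 'rV[R]_n) (x : M) : 'rV[R]_n :=
  nabla s X Y x - nabla s Y X x - lie X Y x.

Definition curvature (s : M -> H2) (X Y Z : M -> 'rV[R]_n) (x : M) : 'rV[R]_n :=
  nabla s X (nabla s Y Z) x - nabla s Y (nabla s X Z) x - nabla s (lie X Y) Z x.

Definition vfield_near (x : M) (X : M -> 'rV[R]_n) : Prop :=
  exists U : set M, U x /\ vfield_on U X.

(* X' is a vector field near the target of xi extending xi X_x *)
Definition extends (xi : H1) (X X' : M -> 'rV[R]_n) : Prop :=
  [/\ vfield_near (src xi) X, vfield_near (tgt xi) X' &
      X' (tgt xi) = X (src xi) *m lin xi].

(* Tensors are evaluated on arbitrary local extensions of the vectors. *)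
Definition preserves2 (xi : H1)
    (Q : (M -> 'rV[R]_n) -> (M -> 'rV[R]_n) -> M -> 'rV[R]_n) : Prop :=
  forall X X' Y Y', extends xi X X' -> extends xi Y Y' ->
    Q X' Y' (tgt xi) = Q X Y (src xi) *m lin xi.

Definition preserves3 (xi : H1)
    (Q : (M -> 'rV[R]_n) -> (M -> 'rV[R]_n) -> (M -> 'rV[R]_n) ->
         M -> 'rV[R]_n) : Prop :=
  forall X X' Y Y' Z Z', extends xi X X' -> extends xi Y Y' ->
    extends xi Z Z' -> Q X' Y' Z' (tgt xi) = Q X Y Z (src xi) *m lin xi.

Definition affine (s : M -> H2) (a : lsec H1) (x : M) : Prop :=
  forall X X' Y, extends (a x) X X' -> vfield_near x Y ->
    nabla s X Y x *m lin (a x) = nabla s X' (push a Y) (beta1 (a x)).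

Definition Sext (s : M -> H2) (xi : H1) : H2 :=
  epsilon (inhabits (Hom (src xi) xi 0 : H2)) (fun j =>
    [/\ B11sh j, p2 j = xi & exists a : lsec H1,
        represents B1 (@src _ _ _ _ _) beta1 a j /\ affine s a (src j)]).

(* S(xi) = j^1_x a has linear part a_{*x}, whose image is the fibre at xi. *)
Definition Dist (s : M -> H2) (xi : H1) : set 'rV[R]_(n + n + n * n) :=
  [set w | exists v : 'rV[R]_n, w = v *m lin (Sext s xi)].

Definition SSext (s : M -> H2) (xi : H1) : H3 :=
  jet (Sext s \o rep2 (Sext s xi)) (src xi).

End Jets.

Arguments B1 {R n} M _.

(* Main.v *)
(* Over charts c and d of M, a jet xi has coordinates w = (x, y, Xi), the connection
   reads nabla_v Y = D_v Y + Y Gamma(v), and the fibre of D^s at w is the set of all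
   v L(w) = (v, v Xi, A_v(w)), where A_v = Gamma_x(v) Xi - Xi Gamma_y(v Xi).  As the
   first block of L is the identity, the fields r L and v L have a bracket tangent to
   D^s at w if and only if r D_(v L) L = v D_(r L) L at w.  The derivative of S along
   a bisection representing S(xi) is v |-> D_(v L) L, and kappa exchanges r and v in
   r D_(v L) L, so kappa(S(xi)) = S(xi) is the same condition.  Its second block
   r A_v = v A_r says that xi preserves the torsion; granted this, its third block is
   the invariance of the curvature. *)

(* Jets, their actions and [kappa_jet] are defined on representatives picked by [epsilon], and the
   choices made at different points are unrelated. The way round is to show that the coordinates of
   each such object are forced by its specification; smoothness, derivatives and uniqueness are then
   read off explicit formulas. Each [epsilon] also needs a witness, so bisections with a prescribed
   1-jet have to be built; their base maps are affine in a pair of charts, which makes the inverses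
   explicit. For kappa(S(xi)) the matrix part must have the transpose of v |-> D_(v L) L as
   derivative, so the witness is built as a section of nonholonomic jets. [Ck] speaks of directional
   derivatives alone: differentiability and Schwarz's theorem have to come first. The bracket
   criterion holds because [r L, v L] has leading block 0 while a L has leading block a: a bracket
   tangent to D^s at w must vanish there. In the third block, differentiating A_r along v L produces
   Xi Gamma_y(r A_v), which has no counterpart in the curvature; torsion invariance makes it
   symmetric in r and v, so it drops out. *)
From Stdlib Require Import ClassicalEpsilon.
From HB Require Import structures.
From mathcomp Require Import all_boot all_order all_algebra.
From mathcomp Require Import all_classical all_reals.
From mathcomp Require Import perm topology normedtype landau derive.
From mathcomp Require Import ring.
Require Import Defs.
Set Implicit Arguments.
Unset Strict Implicit.
Unset Printing Implicit Defensive.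
Import Order.TTheory GRing.Theory Num.Theory numFieldNormedType.Exports.
Local Open Scope classical_set_scope.
Local Open Scope ring_scope.

(** * Differentials *)
Section Calculus.
Context {R : realType}.

(** The differential is a bare function, not a linear map, so that the rules below compute it by
    unification and [der_eq] tidies it afterwards; [der_linear] recovers linearity. *)
Definition der (V W : normedModType R) (f : V -> W) (u : V) (D : V -> W) :=
  differentiable f u /\ 'd f u = D :> (V -> W).

Section DerRules.
Variables V W : normedModType R.
Implicit Types (f g : V -> W) (D E : V -> W).

Lemma derD f g u D E : der f u D -> der g u E ->
  der (fun x => f x + g x) u (fun v => D v + E v).
Proof.
move=> [df <-] [dg <-]; split; first exact: differentiableD.
by rewrite -[X in 'd X _]/(f + g) diffD.
Qed.

Lemma derN f u D : der f u D -> der (fun x => - f x) u (fun v => - D v).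
Proof.
move=> [df <-]; split; first exact: differentiableN.
by rewrite -[X in 'd X _]/(- f) diffN.
Qed.

Lemma der_cst (w : W) (u : V) : der (fun=> w) u (fun=> 0).
Proof. by split; [exact: differentiable_cst | exact: diff_cst]. Qed.

Lemma der_sum (I : Type) (r : seq I) (f : I -> V -> W) (D : I -> V -> W) u :
  (forall i, der (f i) u (D i)) ->
  der (fun x => \sum_(i <- r) f i x) u (fun v => \sum_(i <- r) D i v).
Proof.
move=> h; elim: r => [|i r IH].
  have -> : (fun x => \sum_(i <- [::]) f i x) = (fun=> 0).
    by apply/funext => x; rewrite big_nil.
  have -> : (fun v => \sum_(i <- [::]) D i v) = (fun=> 0).
    by apply/funext => x; rewrite big_nil.
  exact: der_cst.
have -> : (fun x => \sum_(j <- i :: r) f j x) = (fun x => f i x + \sum_(j <- r) f j x).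
  by apply/funext => x; rewrite big_cons.
have -> : (fun x => \sum_(j <- i :: r) D j x) = (fun x => D i x + \sum_(j <- r) D j x).
  by apply/funext => x; rewrite big_cons.
exact: derD.
Qed.

(** A differential depends on the germ alone: the first-order expansion of f at u is transported to
    g, and uniqueness of the differential identifies the two. *)
Lemma der_near f g u D : der f u D -> (\near u, f u = g u) -> der g u D.
Proof.
move=> [df <-] fg.
have H : g \o shift u = cst (g u) + 'd f u +o_ 0 id.
  have := diff_locally df.
  have fg0 : \forall h \near (0:V), f (h + u) = g (h + u).
    by rewrite (near_shift u)/=; near=> z; rewrite /= sub0r addrNK; near: z.
  have fgu : f u = g u by exact: (nbhs_singleton fg).
  move=> /eqaddoP h; apply/eqaddoP => e e0; have {}h := h e e0.
  near=> z.
  have -> : (g \o shift u - (cst (g u) + 'd f u)) z = (f \o shift u - (cst (f u) + 'd f u)) z.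
    rewrite !fctE /= fgu; congr (_ - _); apply/esym.
    by near: z.
  by near: z.
have E : 'd g u = 'd f u :> (V -> W) by apply: diff_unique => //; exact: diff_continuous.
split=> //; apply/diff_locallyP; rewrite E; split=> //; exact: diff_continuous.
Unshelve. all: by end_near. Qed.

Lemma der_eq f u D E : der f u D -> (forall v, D v = E v) -> der f u E.
Proof. by move=> [df h] DE; split => //; rewrite h; apply/funext. Qed.

Lemma der_uniq f u D E : der f u D -> der f u E -> forall v, D v = E v.
Proof. by move=> [_ <-] [_ <-]. Qed.

Lemma der_D f u D v : der f u D -> 'D_v f u = D v.
Proof. by move=> [df <-]; rewrite deriveE. Qed.

Lemma der_derivable f u D v : der f u D -> derivable f u v.
Proof. by move=> [df _]; apply: diff_derivable. Qed.

Lemma der_cont f u D : der f u D -> {for u, continuous f}.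
Proof. by move=> [df _]; apply: differentiable_continuous. Qed.

Lemma der_lin (f : {linear V -> W}) (u : V) : continuous f -> der f u f.
Proof.
by move=> cf; split; [exact: linear_differentiable | rewrite diff_lin].
Qed.

Lemma der_linear f u D : der f u D -> linear D.
Proof. by move=> [_ <-]; exact: linearP. Qed.

End DerRules.

Lemma der_id (V : normedModType R) (u : V) : der (fun x => x) u (fun v => v).
Proof.
have h : is_diff u (@idfun V) idfun by exact: is_diff_id.
by split; [exact: (@ex_diff _ _ _ _ _ _ _ h) | exact: (@diff_val _ _ _ _ _ _ _ h)].
Qed.

Lemma der_comp (U V W : normedModType R) (f : U -> V) (g : V -> W) u D E :
  der f u D -> der g (f u) E -> der (fun x => g (f x)) u (fun v => E (D v)).
Proof.
move=> [df <-] [dg <-]; split; first exact: differentiable_comp.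
by rewrite -[X in 'd X _]/(g \o f) diff_comp.
Qed.

Lemma derM (V : normedModType R) (f g : V -> R) u D E : der f u D -> der g u E ->
  der (fun x => f x * g x) u (fun v => D v * g u + f u * E v).
Proof.
move=> [df <-] [dg <-].
have [h1 h2] := @is_diffM _ _ _ _ _ _ u (differentiableP df) (differentiableP dg).
split; first exact: h1.
rewrite [LHS]h2; apply/funext => v.
by rewrite !fctE addrC /GRing.scale /= [X in X + _]mulrC.
Qed.

Lemma derZl (V W : normedModType R) (f : V -> R) (w : W) u D : der f u D ->
  der (fun x => f x *: w) u (fun v => D v *: w).
Proof.
by move=> [df <-]; split; [exact: differentiableZl | rewrite diffZl].
Qed.

Section DerMx.
Variable V : normedModType R.

Lemma der_mxP (p q : nat) (F : V -> 'M[R]_(p, q)) u D :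
  der F u D <-> forall i j, der (fun x => F x i j) u (fun v => D v i j).
Proof.
split=> [dF i j|h].
  have @f : {linear 'M[R]_(p, q) -> R}.
    by exists (fun N : 'M[R]_(_, _) => N i j); do 2![eexists]; do ?[constructor];
     rewrite ?mxE// => ? *; rewrite ?mxE//; move=> ?; rewrite !mxE.
  have cf : der f (F u) f by exact/der_lin/coord_continuous.
  exact: (der_comp dF cf).
have E (A : V -> 'M[R]_(p,q)) : A = fun x => \sum_i \sum_j (A x i j *: delta_mx i j).
  by apply/funext => x; exact: matrix_sum_delta.
rewrite (E F) (E D).
by apply: der_sum => i; apply: der_sum => j; apply: derZl.
Qed.

Lemma der_mul (p q r : nat) (F : V -> 'M[R]_(p, q)) (G : V -> 'M[R]_(q, r)) u D E :
  der F u D -> der G u E ->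
  der (fun x => F x *m G x) u (fun v => D v *m G u + F u *m E v).
Proof.
move=> /der_mxP dF /der_mxP dG; apply/der_mxP => i j.
have -> : (fun x => (F x *m G x) i j) = (fun x => \sum_k F x i k * G x k j).
  by apply/funext => x; rewrite mxE.
have -> : (fun v => (D v *m G u + F u *m E v) i j) =
   (fun x => \sum_k (D x i k * G u k j + F u i k * E x k j)).
  by apply/funext => x; rewrite !mxE -big_split.
apply: der_sum => k; exact: derM.
Qed.

(** Linearity of [f] is a bare proposition and continuity comes from finite dimension, by expansion
    along the elementary matrices. Block projections, [vec_mx] and [mxvec] are all differentiated
    this way. *)
Lemma linear_mx_der (p q r t : nat) (f : 'M[R]_(p, q) -> 'M[R]_(r, t)) (F : V -> 'M[R]_(p,q)) u D :
  linear f -> der F u D -> der (fun x => f (F x)) u (fun v => f (D v)).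
Proof.
move=> lf /der_mxP dF.
pose fM := GRing.isLinear.Build _ _ _ _ _ lf.
pose fL : {linear _ -> _} := HB.pack f fM.
have E (A : V -> 'M[R]_(p,q)) : (fun x => f (A x)) = fun x => \sum_i \sum_j (A x i j *: f (delta_mx i j)).
  apply/funext => x; rewrite {1}[A x]matrix_sum_delta -[LHS]/(fL _) linear_sum.
  by apply: eq_bigr => i _; rewrite linear_sum; apply: eq_bigr => j _; rewrite linearZ.
rewrite (E F) (E D).
by apply: der_sum => i; apply: der_sum => j; apply: derZl.
Qed.

End DerMx.
End Calculus.

Lemma der_of_linear {R : realType} (V W : normedModType R) (f : V -> W) u (L : {linear V -> W}) :
  continuous L ->
  (forall e : R, 0 < e -> \forall h \near 0, `|f (h + u) - (f u + L h)| <= e * `|h|) ->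
  der f u L.
Proof.
move=> cL hL.
have H : f \o shift u = cst (f u) + L +o_ 0 id by apply/eqaddoP.
have E : 'd f u = L :> (V -> W) by exact: diff_unique.
by split=> //; apply/diff_locallyP; rewrite E.
Qed.

(** * Continuous directional derivatives give a differential *)

Section C1.
Context {R : realType} {m : nat}.
Implicit Types (f : 'rV[R]_m -> R) (O : set 'rV[R]_m) (u v w : 'rV[R]_m).

Lemma is_derive_line f u v (t : R) : derivable f (u + t *: v) v ->
  is_derive t 1 (fun t => f (u + t *: v)) ('D_v f (u + t *: v)).
Proof.
move=> df; have E : (fun h : R => h^-1 *: (((fun t => f (u + t *: v)) \o shift t) (h *: 1) - f (u + t *: v)))
   = (fun h => h^-1 *: ((f \o shift (u + t *: v)) (h *: v) - f (u + t *: v))).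
  apply/funext => h /=; congr (_ *: (f _ - _)).
  by rewrite [h *: 1]mulr1 scalerDl addrCA.
split; first by rewrite /derivable E.
by rewrite /derive E.
Qed.

Lemma is_derive1_der (g : R -> R) (t d : R) : is_derive t 1 g d ->
  der g t (fun s => s * d).
Proof.
move=> [h1 h2]; split; first exact/derivable1_diffP.
by rewrite deriv1E // derive1E h2.
Qed.

(** Homogeneity in the direction before differentiability is known: the one-variable chain rule
    along the line, with t |-> c t, which also covers c = 0. *)
Lemma is_derive_scale f u v (c : R) : derivable f u v ->
  is_derive u (c *: v) f (c * 'D_v f u).
Proof.
move=> df.
have h0 : derivable f (u + (c * 0) *: v) v by rewrite mulr0 scale0r addr0.
have [h1 E1] := is_derive_line h0.
have h2 : der (fun t : R => c * t) 0 (fun s => c * s).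
  by apply: der_eq (derM (der_cst _ _) (der_id _)) _ => v' /=; rewrite mul0r add0r.
have h3 := der_comp h2 (is_derive1_der (DeriveDef h1 E1)).
have E : 'D_1 (fun t : R => f (u + (c * t) *: v)) 0 = c * 'D_v f u.
  by rewrite (der_D _ h3) mulr1 mulr0 scale0r addr0.
have h4 : derivable (fun t : R => f (u + (c * t) *: v)) 0 1 by exact: der_derivable h3.
have E2 : (fun h : R => h^-1 *: ((f \o shift u) (h *: (c *: v)) - f u)) =
   (fun h => h^-1 *: (((fun t : R => f (u + (c * t) *: v)) \o shift 0) (h *: 1) -
    f (u + (c * 0) *: v))).
  apply/funext => h /=; rewrite mulr0 scale0r !addr0; congr (_ *: (f _ - _)).
  by rewrite [h *: 1]mulr1 ?addr0 scalerA mulrC addrC.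
by split; [rewrite /derivable E2|rewrite -[RHS]E /derive E2].
Qed.

Lemma MVT_line f u v : (forall t : R, 0 <= t <= 1 -> derivable f (u + t *: v) v) ->
  exists2 t : R, 0 <= t <= 1 & f (u + v) - f u = 'D_v f (u + t *: v).
Proof.
move=> df.
have [||c c01 E] := @MVT R (fun t => f (u + t *: v)) (fun t => 'D_v f (u + t *: v)) 0 1 ltr01.
- move=> x; rewrite in_itv /= => /andP[x0 x1]; apply: is_derive_line.
  by apply: df; rewrite !ltW.
- apply: derivable_within_continuous => x; rewrite in_itv /= => x01.
  by have [] := is_derive_line (df x x01).
exists c; first by move: c01; rewrite in_itv /= => /andP[/ltW -> /ltW ->].
by move: E; rewrite scale1r scale0r addr0 subr0 mulr1.
Qed.

(** Walk from u to u + h v, then to u + h v + h w. The mean value theorem on each leg gives D_v f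
    and D_w f at nearby points, and their continuity at u concludes. *)
Lemma deriv_add f u v w : (\near u, derivable f u v /\ derivable f u w) ->
  derivable f u (v + w) ->
  {for u, continuous (fun u => 'D_v f u)} -> {for u, continuous (fun u => 'D_w f u)} ->
  'D_(v + w) f u = 'D_v f u + 'D_w f u.
Proof.
move=> hd dvw cv cw; apply/cvg_lim => //=.
apply/cvgrPdist_le => e e0.
have e2 : 0 < e / 2 by rewrite divr_gt0.
move/cvgrPdist_le/(_ _ e2): cv => cv; move/cvgrPdist_le/(_ _ e2): cw => cw.
have : \forall z \near u, [/\ derivable f z v /\ derivable f z w,
   `|'D_v f u - 'D_v f z| <= e / 2 & `|'D_w f u - 'D_w f z| <= e / 2].
  by apply: filterS3 hd cv cw => z h1 h2 h3; split; [exact: h1|exact: h2|exact: h3].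
case/nbhs_ballP => r /= r0 hr.
near=> h.
have h0 : h != 0 by near: h; exact: nbhs_dnbhs_neq.
(* Keeps both legs inside the ball of radius r; the summand 1 makes the divisor positive even when v
   = w = 0. *)
have hs : `|h| * (`|v| + `|w| + 1) < r.
  rewrite -ltr_pdivlMr ?ltr_wpDl ?addr_ge0 //.
  near: h; apply: dnbhs0_lt; rewrite divr_gt0 // ltr_wpDl ?addr_ge0 //.
have hb (s t : R) : 0 <= s <= 1 -> 0 <= t <= 1 -> ball u r (u + s *: (h *: v) + t *: (h *: w)).
  move=> /andP[s0 s1] /andP[t0 t1]; rewrite -ball_normE /= -addrA opprD addNKr normrN.
  apply: le_lt_trans hs; apply: le_trans (ler_normD _ _) _.
  rewrite !normrZ (ger0_norm s0) (ger0_norm t0) -addrA mulrDr lerD //.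
    by rewrite ler_piMl // mulr_ge0.
  rewrite mulrDr mulr1 -[leLHS]addr0 lerD // ler_piMl // mulr_ge0 //.
have [t t01 Et] : exists2 t : R, 0 <= t <= 1 & f (u + h *: v + h *: w) - f (u + h *: v) =
   'D_(h *: w) f (u + h *: v + t *: (h *: w)).
  apply: MVT_line => t t01; have [|[_ dw] _ _] := hr (u + h *: v + t *: (h *: w)).
    by have := hb 1 t; rewrite scale1r ler01 lexx; apply.
  by have [] := is_derive_scale h dw.
have [q q01 Eq] : exists2 t : R, 0 <= t <= 1 & f (u + h *: v) - f u =
   'D_(h *: v) f (u + t *: (h *: v)).
  apply: MVT_line => q q01; have [|[dv _] _ _] := hr (u + q *: (h *: v)).
    by have := hb q 0; rewrite scale0r addr0 ler01 lexx; apply.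
  by have [] := is_derive_scale h dv.
have [|[_ dw] _ bw] := hr (u + h *: v + t *: (h *: w)).
  by have := hb 1 t; rewrite scale1r ler01 lexx; apply.
have [|[dv _] bv _] := hr (u + q *: (h *: v)).
  by have := hb q 0; rewrite scale0r addr0 ler01 lexx; apply.
have [_ Ew] := is_derive_scale h dw; have [_ Ev] := is_derive_scale h dv.
have -> : (f \o shift u) (h *: (v + w)) - f u =
    h * ('D_v f (u + q *: (h *: v)) + 'D_w f (u + h *: v + t *: (h *: w))).
  rewrite mulrDr -Ew -Ev -Et -Eq [RHS]addrC subrKA /=.
  by congr (f _ - _); rewrite scalerDr addrC addrA.
rewrite [_ *: _]mulKf //.
rewrite opprD addrACA [leRHS]splitr; apply: le_trans (ler_normD _ _) _.
by apply: lerD.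
Unshelve. all: by end_near. Qed.

Definition C1on f O := forall u, O u -> forall v, derivable f u v /\ {for u, continuous (fun u => 'D_v f u)}.

Lemma C1_linear f O u : open O -> C1on f O -> O u -> linear (fun v => 'D_v f u : R).
Proof.
move=> oO hf Ou a v w.
have nO : \near u, O u by apply: open_nbhs_nbhs.
rewrite deriv_add.
- by have [dv _] := hf u Ou v; have [_ ->] := is_derive_scale a dv.
- near=> z; have Oz : O z by near: z.
  by split; have [] := hf z Oz (a *: v); have [] := hf z Oz w.
- by have [] := hf u Ou (a *: v + w).
- by have [] := hf u Ou (a *: v).
- by have [] := hf u Ou w.
Unshelve. all: by end_near. Qed.

Lemma rV_basis (h : 'rV[R]_m) : h = \sum_j h 0 j *: delta_mx 0 j.
Proof.
by rewrite {1}[h]matrix_sum_delta big_ord1.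
Qed.

(** The mean value theorem writes f(u + h) - f(u) as D_h f at a point of the segment. Linearity in h
    reduces the variation of D_h f to finitely many basis directions, which makes the estimate
    uniform in h. *)
Lemma C1_der f O u : open O -> C1on f O -> O u -> der f u (fun v => 'D_v f u).
Proof.
move=> oO hf Ou.
have nO : \near u, O u by apply: open_nbhs_nbhs.
pose fM := GRing.isLinear.Build _ _ _ _ _ (C1_linear oO hf Ou).
pose L : {linear 'rV[R]_m -> R} := HB.pack (fun v => 'D_v f u : R) fM.
have LE z (h : 'rV[R]_m) : O z -> 'D_h f z = \sum_j h 0 j * 'D_(delta_mx 0 j) f z.
  move=> Oz.
  pose gM := GRing.isLinear.Build _ _ _ _ _ (C1_linear oO hf Oz).
  pose G : {linear 'rV[R]_m -> R} := HB.pack (fun v => 'D_v f z : R) gM.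
  rewrite -[LHS]/(G h) {1}[h]rV_basis linear_sum; apply: eq_bigr => j _.
  by rewrite linearZ.
have cL : continuous L.
  have h j : der (fun h : 'rV[R]_m => h 0 j) 0 (fun h => h 0 j).
    by have /der_mxP := der_id (0 : 'rV[R]_m); apply.
  have h2 : der L 0 L.
    have -> : (L : 'rV[R]_m -> R) = fun h => \sum_j h 0 j * 'D_(delta_mx 0 j) f u.
      by apply/funext => z; exact: LE.
    apply: der_sum => j; apply: der_eq (derM (h j) (der_cst _ _)) _ => v /=.
    by rewrite mulr0 addr0.
  exact/continuousfor0_continuous/(der_cont h2).
apply: (der_of_linear (L := L)) => // e e0.
(* The successor keeps [K] positive in dimension 0 and still bounds the number of summands. *)
pose K : R := m.+1%:R.
have K0 : 0 < K by rewrite ltr0n.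
have eK : 0 < e / K by rewrite divr_gt0.
have : \forall z \near u, O z /\ forall j, `|'D_(delta_mx 0 j) f u - 'D_(delta_mx 0 j) f z| <= e / K.
  near=> z; split; first by near: z.
  near: z; apply: filter_forall => j.
  by have [_ /cvgrPdist_le/(_ _ eK)] := hf u Ou (delta_mx 0 j).
case/nbhs_ballP => r /= r0 hr.
have hn : \forall h \near (0 : 'rV[R]_m), `|h| < r by exact: nbhs0_lt.
near=> h.
have hs : `|h| < r by near: h.
have hb (t : R) : 0 <= t <= 1 -> ball u r (u + t *: h).
  move=> /andP[t0 t1]; rewrite -ball_normE /= opprD addNKr normrN.
  by apply: le_lt_trans hs; rewrite normrZ ger0_norm // ler_piMl.
have [t t01 Et] : exists2 t : R, 0 <= t <= 1 & f (u + h) - f u = 'D_h f (u + t *: h).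
  by apply: MVT_line => t /hb /hr [Oz _]; have [] := hf _ Oz h.
have [Oz hz] := hr _ (hb t t01).
rewrite opprD addrA [h + u]addrC Et /= !LE // -sumrB.
apply: le_trans (ler_norm_sum _ _ _) _.
apply: (@le_trans _ _ (\sum_(j < m) `|h| * (e / K))).
  apply: ler_sum => j _; rewrite -mulrBr normrM; apply: ler_pM => //.
    rewrite [leRHS]/Num.Def.normr/= mx_normrE.
    exact: (le_bigmax _ (fun i : 'I_1 * 'I_m => `|h i.1 i.2|) (0, j)).
  by rewrite distrC.
rewrite sumr_const card_ord -mulr_natr -mulrA mulrC ler_wpM2r //.
rewrite -mulrA ler_piMr ?ltW //.
by rewrite mulrC ltr_pdivrMr // mul1r /K ltr_nat.
Unshelve. all: by end_near. Qed.

End C1.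

(** * Symmetry of second derivatives *)

Section Schwarz.
Context {R : realType} {m : nat}.
Implicit Types (f : 'rV[R]_m -> R) (O : set 'rV[R]_m) (u v w : 'rV[R]_m).

(** Two uses of the mean value theorem: along v for g(z) = f(z + t w) - f(z), then along w for D_v
    f. *)
Lemma second_difference f (O : set 'rV[R]_m) u v w (t : R) : C1on f O ->
  (forall z, O z -> derivable (fun x => 'D_v f x) z w) ->
  (forall a b : R, 0 <= a <= 1 -> 0 <= b <= 1 -> O (u + a *: (t *: v) + b *: (t *: w))) ->
  exists a b : R, [/\ 0 <= a <= 1, 0 <= b <= 1 &
    f (u + t *: v + t *: w) - f (u + t *: v) - (f (u + t *: w) - f u) =
    t * (t * 'D_w ('D_v f) (u + a *: (t *: v) + b *: (t *: w)))].
Proof.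
move=> hf hvw hO.
pose g z := f (z + t *: w) - f z.
have dg (a : R) : 0 <= a <= 1 -> is_derive (u + a *: (t *: v)) (t *: v) g
    (t * ('D_v f (u + a *: (t *: v) + t *: w) - 'D_v f (u + a *: (t *: v)))).
  move=> a01; rewrite mulrBr; set z := u + a *: (t *: v).
  have O1 : O z by have := hO a 0 a01; rewrite scale0r addr0 ler01 lexx; apply.
  have O2 : O (z + t *: w) by have := hO a 1 a01; rewrite scale1r ler01 lexx; apply.
  apply: is_deriveB.
    have [d1 e1] := is_derive_scale t (hf _ O2 v).1.
    have E : (fun h : R => h^-1 *: (((fun z => f (z + t *: w)) \o shift z) (h *: (t *: v)) - f (z + t *: w)))
      = (fun h : R => h^-1 *: ((f \o shift (z + t *: w)) (h *: (t *: v)) - f (z + t *: w))).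
      by apply/funext => h /=; congr (_ *: (f _ - _)); rewrite -[in LHS]addrA.
    by split; [rewrite /derivable E|rewrite /derive E].
  exact: (is_derive_scale t (hf _ O1 v).1).
have [a a01 Ea] : exists2 a : R, 0 <= a <= 1 & g (u + t *: v) - g u = 'D_(t *: v) g (u + a *: (t *: v)).
  by apply: MVT_line => a /dg [].
set z := u + a *: (t *: v) in Ea.
have hz (b : R) : 0 <= b <= 1 -> derivable ('D_v f) (z + b *: (t *: w)) w.
  by move=> b01; exact/hvw/hO.
have [b b01 Eb] : exists2 b : R, 0 <= b <= 1 & 'D_v f (z + t *: w) - 'D_v f z =
  'D_(t *: w) ('D_v f) (z + b *: (t *: w)).
  apply: (@MVT_line _ _ (fun x => 'D_v f x) z (t *: w)) => b /hz db.
  by have [] := is_derive_scale (f := fun x => 'D_v f x) t db.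
exists a, b; split => //.
rewrite -[LHS]/(g (u + t *: v) - g u) Ea; have [_ ->] := dg a a01.
rewrite -/z Eb.
by have [_ ->] := is_derive_scale (f := fun x => 'D_v f x) t (hz b b01).
Qed.

(** The second difference is symmetric in v and w. Evaluated in both orders, it equates D_w D_v f at
    one nearby point with D_v D_w f at another, and continuity moves both to u. *)
Lemma schwarz f O u v w : open O -> O u -> C1on f O -> C1on ('D_v f) O -> C1on ('D_w f) O ->
  'D_w ('D_v f) u = 'D_v ('D_w f) u.
Proof.
move=> oO Ou hf hv hw.
apply/eqP; rewrite -subr_eq0 -normr_le0; apply/ler_addgt0Pr => e e0; rewrite add0r.
have e2 : 0 < e / 2 by rewrite divr_gt0.
have [_ /cvgrPdist_le/(_ _ e2) cv] := hv u Ou w.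
have [_ /cvgrPdist_le/(_ _ e2) cw] := hw u Ou v.
have nO : \forall z \near u, O z by apply: open_nbhs_nbhs.
have : \forall z \near u, [/\ O z, `|'D_w ('D_v f) u - 'D_w ('D_v f) z| <= e / 2 &
   `|'D_v ('D_w f) u - 'D_v ('D_w f) z| <= e / 2].
  by apply: filterS3 nO cv cw => z h1 h2 h3; split; [exact: h1|exact: h2|exact: h3].
case/nbhs_ballP => r /= r0 hr.
have k0 : 0 < `|v| + `|w| + 1 by rewrite ltr_wpDl ?addr_ge0.
(* Halving the radius gives a strict inequality, so the whole parallelogram spanned by t v and t w
   lies in the ball. *)
pose t := r / 2 / (`|v| + `|w| + 1).
have t0 : 0 < t by rewrite !divr_gt0.
have hs : t * (`|v| + `|w| + 1) < r.
  by rewrite divfK ?gt_eqF // gtr_pMr // invf_lt1 // ltr1n.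
clearbody t.
have hb (a b : R) : 0 <= a <= 1 -> 0 <= b <= 1 -> ball u r (u + a *: (t *: v) + b *: (t *: w)).
  move=> /andP[s0 s1] /andP[b0 b1]; rewrite -ball_normE /= -addrA opprD addNKr normrN.
  apply: le_lt_trans hs; apply: le_trans (ler_normD _ _) _.
  rewrite !normrZ (ger0_norm s0) (ger0_norm b0) ?(gtr0_norm t0) -addrA mulrDr lerD //.
    by rewrite ler_piMl // mulr_ge0 // ltW.
  by rewrite mulrDr mulr1 -[leLHS]addr0 lerD ?(ltW t0) // ler_piMl // mulr_ge0 // ltW.
have hf' : C1on f (ball u r) by move=> z /hr[Oz _ _]; exact: hf.
have [||a [b [a01 b01 E1]]] := @second_difference f (ball u r) u v w t hf'.
- by move=> z /hr[Oz _ _]; have [] := hv z Oz w.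
- exact: hb.
have [||c [d [c01 d01 E2]]] := @second_difference f (ball u r) u w v t hf'.
- by move=> z /hr[Oz _ _]; have [] := hw z Oz v.
- by move=> x y x01 y01; rewrite addrAC; exact: hb.
have E3 : 'D_w ('D_v f) (u + a *: (t *: v) + b *: (t *: w)) =
  'D_v ('D_w f) (u + c *: (t *: w) + d *: (t *: v)).
  have t0' : t != 0 by rewrite gt_eqF.
  apply: (mulfI t0'); apply: (mulfI t0').
  refine (etrans (esym E1) (etrans _ E2)).
  rewrite [u + t *: w + t *: v]addrAC !opprB -!addrA; congr (_ + _).
  by rewrite addrCA [RHS]addrCA; congr (_ + _); exact: addrC.
have [_ h1 _] := hr _ (hb a b a01 b01).
have [_ _ h2] := hr _ (hb d c d01 c01).
rewrite addrAC -E3 distrC in h2.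
rewrite [leRHS]splitr; apply: le_trans (ler_distD _ _ _) (lerD h1 h2).
Qed.
End Schwarz.

(** * Smooth matrix-valued maps *)
Section Smooth.
Context {R : realType}.

(** [Ck] with matrix values, so that products, blocks and Jacobians stay in the class; [CkM_Ck]
    compares the two on row vectors. *)
Fixpoint CkM (m p q k : nat) (O : set 'rV[R]_m) (f : 'rV[R]_m -> 'M[R]_(p, q)) : Prop :=
  (forall u, O u -> {for u, continuous f}) /\
  if k is k'.+1 then
    forall v : 'rV[R]_m, (forall u, O u -> derivable f u v) /\
      CkM k' O (fun u => 'D_v f u : 'M[R]_(p, q))
  else True.

Lemma CkM_Ck m p k O (f : 'rV[R]_m -> 'rV[R]_p) : CkM k O f <-> Ck k O f.
Proof.
elim: k f => [//|k IH] f /=.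
by split=> -[? h]; split => // v; have [? /IH ?] := h v; split.
Qed.

Lemma CkM_sub m p q k (O O' : set 'rV[R]_m) (f : 'rV[R]_m -> 'M[R]_(p, q)) :
  O' `<=` O -> CkM k O f -> CkM k O' f.
Proof.
move=> s; elim: k f => [|k IH] f [h1 h2]; (split; first by move=> u /s/h1); first by [].
by move=> v; have [h3 /IH h4] := h2 v; split; [move=> u /s/h3|].
Qed.

Lemma CkM_loc m p q k (O : set 'rV[R]_m) (f : 'rV[R]_m -> 'M[R]_(p, q)) :
  (forall u, O u -> exists O', [/\ O' u & CkM k O' f]) -> CkM k O f.
Proof.
elim: k f => [|k IH] f h; split.
- by move=> u /h[U [Uu [c _]]]; exact: c.
- by [].
- by move=> u /h[U [Uu [c _]]]; exact: c.
- move=> v; split.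
    by move=> u /h[U [Uu [_ d]]]; exact: (d v).1.
  apply: IH => u /h[U [Uu [_ d]]]; exists U; split => //; exact: (d v).2.
Qed.

Lemma CkM_ext m p q k (O : set 'rV[R]_m) (f g : 'rV[R]_m -> 'M[R]_(p, q)) :
  open O -> (forall u, O u -> f u = g u) -> CkM k O f -> CkM k O g.
Proof.
move=> oO; elim: k f g => [|k IH] f g fg /=.
  case=> h _; split; last by [].
  move=> u Ou.
  have nfg : \forall z \near u, f z = g z by near=> z; apply: fg; near: z; exact: open_nbhs_nbhs.
  have := h u Ou; rewrite /prop_for /continuous_at -(fg u Ou) => cu.
  exact: cvg_trans (near_eq_cvg nfg) cu.
case=> h1 h2; split.
  move=> u Ou.
  have nfg : \forall z \near u, f z = g z by near=> z; apply: fg; near: z; exact: open_nbhs_nbhs.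
  have := h1 u Ou; rewrite /prop_for /continuous_at -(fg u Ou) => cu.
  exact: cvg_trans (near_eq_cvg nfg) cu.
move=> v; have [h3 h4] := h2 v.
have nfg u : O u -> \forall z \near u, f z = g z.
  by move=> Ou; near=> z; apply: fg; near: z; exact: open_nbhs_nbhs.
split; first by move=> u Ou; apply: near_eq_derivable (nfg u Ou) (h3 u Ou).
by apply: IH h4 => u Ou; apply: near_eq_derive; exact: nfg.
Unshelve. all: by end_near. Qed.

Lemma CkM_S m p q k (O : set 'rV[R]_m) (f : 'rV[R]_m -> 'M[R]_(p, q)) :
  CkM k.+1 O f -> CkM k O f.
Proof.
elim: k f => [|k IH] f [h1 h2]; split => // v; have [h3 h4] := h2 v.
by split => //; exact: IH.
Qed.

Lemma CkM_der m p q k (O : set 'rV[R]_m) (f : 'rV[R]_m -> 'M[R]_(p, q)) u :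
  open O -> CkM k.+1 O f -> O u -> der f u (fun v => 'D_v f u).
Proof.
move=> oO [h1 h2] Ou; apply/der_mxP => i j.
have E v z : O z -> 'D_v f z i j = 'D_v (fun x => f x i j) z.
  by move=> Oz; have [h3 _] := h2 v; rewrite derive_mx ?mxE //; exact: h3.
have C : C1on (fun x => f x i j) O.
  move=> z Oz v; have [h3 h4] := h2 v; split.
    by have /derivable_mxP := h3 z Oz; apply.
  have h5 : {for z, continuous (fun u => 'D_v f u)} by case: (k) h4 => [|k'] [+ _]; apply.
  have h6 : {for z, continuous (fun u => 'D_v f u i j)}.
    apply: (@continuous_comp _ _ _ (fun u => 'D_v f u) (fun A : 'M[R]_(p, q) => A i j)); first exact: h5.
    exact: coord_continuous.
  have nE : \forall z \near z, 'D_v f z i j = 'D_v (fun x => f x i j) z.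
    by near=> y; apply: E; near: y; exact: open_nbhs_nbhs.
  move: h6; rewrite /prop_for /continuous_at (E v z Oz) => h6.
  exact: cvg_trans (near_eq_cvg nE) h6.
by apply: der_eq (C1_der oO C Ou) _ => v; rewrite E.
Unshelve. all: by end_near. Qed.

(** The induction step of the closure properties below: it suffices to exhibit a differential whose
    value in each fixed direction is of class C^k. *)
Lemma CkM_SI m p q k (O : set 'rV[R]_m) (f : 'rV[R]_m -> 'M[R]_(p, q))
   (D : 'rV[R]_m -> 'rV[R]_m -> 'M[R]_(p, q)) :
  open O -> (forall u, O u -> der f u (D u)) -> (forall v, CkM k O (D ^~ v)) ->
  CkM k.+1 O f.
Proof.
move=> oO df kD; split; first by move=> u /df; exact: der_cont.
move=> v; split; first by move=> u /df; exact: der_derivable.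
by apply: CkM_ext (kD v) => // u /df h; rewrite (der_D _ h).
Qed.

Lemma CkM_cst m p q k (O : set 'rV[R]_m) (w : 'M[R]_(p, q)) : open O -> CkM k O (fun=> w).
Proof.
move=> oO; elim: k w => [|k IH] w; first by split; [move=> u _; exact: cst_continuous|].
apply: (@CkM_SI _ _ _ _ _ _ (fun _ _ => 0)) => [//|u _|v]; first exact: der_cst.
  exact: IH.
Qed.

Lemma CkM_id m k (O : set 'rV[R]_m) : open O -> CkM k O (fun u => u).
Proof.
case: k => [|k] oO; first by split; [move=> u _; exact: der_cont (der_id _)|].
apply: (@CkM_SI _ _ _ _ _ _ (fun _ v => v)) => [//|u _|v]; first exact: der_id.
exact: CkM_cst.
Qed.

Lemma CkM_add m p q k (O : set 'rV[R]_m) (f g : 'rV[R]_m -> 'M[R]_(p, q)) : open O ->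
  CkM k O f -> CkM k O g -> CkM k O (fun u => f u + g u).
Proof.
move=> oO; elim: k f g => [|k IH] f g kf kg.
  split; last by [].
  by move=> u Ou; apply: continuousD; [apply kf.1|apply kg.1].
apply: (@CkM_SI _ _ _ _ _ _ (fun u v => 'D_v f u + 'D_v g u)) => [//|u Ou|v].
  by apply: derD; apply: (CkM_der oO _ Ou); [exact: kf|exact: kg].
by apply: IH; [exact: (kf.2 v).2|exact: (kg.2 v).2].
Qed.

Lemma CkM_lin m p q r t k (O : set 'rV[R]_m) (l : 'M[R]_(p,q) -> 'M[R]_(r,t))
  (f : 'rV[R]_m -> 'M[R]_(p, q)) : open O -> linear l ->
  CkM k O f -> CkM k O (fun u => l (f u)).
Proof.
move=> oO ll; elim: k f => [|k IH] f kf.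
  split; last by [].
  move=> u Ou; apply: continuous_comp; first exact: kf.1.
  exact: der_cont (linear_mx_der ll (der_id _)).
apply: (@CkM_SI _ _ _ _ _ _ (fun u v => l ('D_v f u))) => [//|u Ou|v].
  exact: linear_mx_der ll (CkM_der oO kf Ou).
by apply: IH; exact: (kf.2 v).2.
Qed.

Lemma mulmx_cont (T : topologicalType) p q r (f : T -> 'M[R]_(p, q)) (g : T -> 'M[R]_(q, r)) u :
  {for u, continuous f} -> {for u, continuous g} -> {for u, continuous (fun x => f x *m g x)}.
Proof.
move=> cf cg.
pose h (x : 'M[R]_(p,q) * 'M[R]_(q,r)) := x.1 *m x.2.
have d1 : der (fun x : 'M[R]_(p,q) * 'M[R]_(q,r) => x.1) (f u, g u) fst.
  by apply: (der_lin (f := fst)) => ?; exact: cvg_fst.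
have d2 : der (fun x : 'M[R]_(p,q) * 'M[R]_(q,r) => x.2) (f u, g u) snd.
  by apply: (der_lin (f := snd)) => ?; exact: cvg_snd.
have ch : {for (f u, g u), continuous h} by exact: der_cont (der_mul d1 d2).
exact: (cvg_comp2 cf cg ch).
Qed.

Lemma CkM_mul m p q r k (O : set 'rV[R]_m) (f : 'rV[R]_m -> 'M[R]_(p, q))
   (g : 'rV[R]_m -> 'M[R]_(q, r)) : open O ->
  CkM k O f -> CkM k O g -> CkM k O (fun u => f u *m g u).
Proof.
move=> oO; elim: k f g => [|k IH] f g kf kg.
  split; last by [].
  by move=> u Ou; apply: mulmx_cont; [apply kf.1|apply kg.1].
apply: (@CkM_SI _ _ _ _ _ _ (fun u v => 'D_v f u *m g u + f u *m 'D_v g u)) => [//|u Ou|v].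
  by apply: der_mul; apply: (CkM_der oO _ Ou); [exact: kf|exact: kg].
apply: (CkM_add oO).
  exact: IH (kf.2 v).2 (CkM_S kg).
exact: IH (CkM_S kf) (kg.2 v).2.
Qed.

Lemma CkM_sum m p q k (O : set 'rV[R]_m) (I : Type) (r : seq I)
  (f : I -> 'rV[R]_m -> 'M[R]_(p, q)) : open O ->
  (forall i, CkM k O (f i)) -> CkM k O (fun u => \sum_(i <- r) f i u).
Proof.
move=> oO h; elim: r => [|i r IH].
  apply: (@CkM_ext _ _ _ _ _ (fun=> 0) _ oO); first by move=> u _; rewrite big_nil.
  exact: (@CkM_cst _ _ _ _ _ 0 oO).
apply: (@CkM_ext _ _ _ _ _ (fun u => f i u + \sum_(i <- r) f i u) _ oO).
  by move=> u _; rewrite big_cons.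
exact: CkM_add.
Qed.

Lemma CkM_comp m n p q k (O : set 'rV[R]_m) (O' : set 'rV[R]_n) (f : 'rV[R]_m -> 'rV[R]_n)
   (g : 'rV[R]_n -> 'M[R]_(p, q)) : open O -> open O' -> (forall u, O u -> O' (f u)) ->
  CkM k O f -> CkM k O' g -> CkM k O (fun u => g (f u)).
Proof.
move=> oO oO' fO; elim: k f g fO => [|k IH] f g fO kf kg.
  split; last by [].
  by move=> u Ou; apply: continuous_comp; [apply kf.1|apply kg.1; exact: fO].
(* The direction ['D_v f u] varies with u, while the induction hypothesis covers derivatives of g in
   fixed directions only; hence the expansion over the basis. Scalar matrices turn the coefficients
   into factors for [CkM_mul]. *)
apply: (@CkM_SI _ _ _ _ _ _ (fun u v => \sum_j ('D_v f u 0 j)%:M *m 'D_(delta_mx 0 j) g (f u))) => [//|u Ou|v].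
  have dg := CkM_der oO' kg (fO _ Ou).
  apply: der_eq (der_comp (CkM_der oO kf Ou) dg) _ => v /=.
  pose L := GRing.isLinear.Build _ _ _ _ _ (der_linear dg).
  pose G : {linear 'rV[R]_n -> 'M[R]_(p,q)} := HB.pack (fun v => 'D_v g (f u)) L.
  rewrite -[LHS]/(G _) {1}[ 'D_v f u]rV_basis linear_sum; apply: eq_bigr => j _.
  by rewrite linearZ mul_scalar_mx.
apply: (CkM_sum _ oO) => j; apply: (CkM_mul oO); last first.
  exact: IH fO (CkM_S kf) (kg.2 _).2.
apply: (@CkM_lin _ _ _ _ _ _ _ (fun w : 'rV[R]_n => (w 0 j)%:M) _ oO _ (kf.2 v).2).
move=> a x y; apply/matrixP => i i'; rewrite !mxE.
by rewrite mulrnDl mulrnAr.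
Qed.

End Smooth.

(** * Smoothness at a point and Jacobians *)

Section Pointwise.
Context {R : realType}.

Lemma near_open (T : topologicalType) (u : T) (P : T -> Prop) :
  (\forall z \near u, P z) -> exists U, [/\ open U, U u & forall z, U z -> P z].
Proof.
move=> h; have : nbhs u [set z | P z] := h.
by rewrite nbhsE => -[V [oV Vu] VP]; exists V.
Qed.

Lemma near_in (T : topologicalType) (u : T) (U : set T) :
  open U -> U u -> \forall z \near u, U z.
Proof. by move=> oU Uu; exact: open_nbhs_nbhs. Qed.

(** One neighbourhood serves all orders k at once. *)
Definition smooth m p q (F : 'rV[R]_m -> 'M[R]_(p, q)) u :=
  exists O, [/\ open O, O u & forall k, CkM k O F].

Lemma Cinf_CkM m p (O : set 'rV[R]_m) (f : 'rV[R]_m -> 'rV[R]_p) :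
  Cinf O f <-> forall k, CkM k O f.
Proof. by split=> h k; apply/CkM_Ck; exact: h. Qed.

Lemma Cinf_smooth m p (O : set 'rV[R]_m) (f : 'rV[R]_m -> 'rV[R]_p) u :
  open O -> O u -> Cinf O f -> smooth f u.
Proof. by move=> oO Ou /Cinf_CkM h; exists O. Qed.

Lemma smooth_Cinf m p (O : set 'rV[R]_m) (f : 'rV[R]_m -> 'rV[R]_p) :
  (forall u, O u -> smooth f u) -> Cinf O f.
Proof.
move=> h; apply/Cinf_CkM => k; apply: CkM_loc => u /h[U [oU Uu kU]].
by exists U; split; [exact: Uu | exact: kU].
Qed.

Lemma smooth_nbhs m p q (F : 'rV[R]_m -> 'M[R]_(p, q)) u : smooth F u -> \forall z \near u, smooth F z.
Proof.
case=> U [oU Uu kU]; have nU : \forall z \near u, U z by exact: open_nbhs_nbhs.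
by apply: filterS nU => z Uz; exists U; split; [exact: oU|exact: Uz|exact: kU].
Qed.

Lemma smooth_der m p q (F : 'rV[R]_m -> 'M[R]_(p, q)) u : smooth F u ->
  der F u (fun v => 'D_v F u).
Proof. by case=> U [oU Uu kU]; exact: CkM_der oU (kU 1%N) Uu. Qed.

Lemma smooth_D m p q (F : 'rV[R]_m -> 'M[R]_(p, q)) v u : smooth F u ->
  smooth (fun u => 'D_v F u) u.
Proof.
case=> U [oU Uu kU]; exists U; split; [exact: oU|exact: Uu|move=> k].
exact: ((kU k.+1).2 v).2.
Qed.

Lemma smooth_cont m p q (F : 'rV[R]_m -> 'M[R]_(p, q)) u : smooth F u -> {for u, continuous F}.
Proof. by move=> /smooth_der/der_cont. Qed.

Lemma smooth_near m p q (F G : 'rV[R]_m -> 'M[R]_(p, q)) u :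
  (\forall z \near u, F z = G z) -> smooth F u -> smooth G u.
Proof.
move=> FG [U [oU Uu kU]].
have : \forall z \near u, F z = G z /\ U z.
  by apply: filterI => //; exact: open_nbhs_nbhs.
case/near_open => V [oV Vu VFG]; exists V; split; [exact: oV|exact: Vu|move=> k].
apply: (CkM_ext (f := F) oV); first by move=> z /VFG [].
by apply: CkM_sub (kU k) => z /VFG [].
Qed.

Lemma smooth_cst m p q (w : 'M[R]_(p, q)) (u : 'rV[R]_m) : smooth (fun=> w) u.
Proof. by exists setT; split=> [||k]; [exact: openT| |apply: CkM_cst; exact: openT]. Qed.

Lemma smooth_id m (u : 'rV[R]_m) : smooth (fun u => u) u.
Proof. by exists setT; split=> [||k]; [exact: openT| |apply: CkM_id; exact: openT]. Qed.

Lemma smooth_lin m p q r t (l : 'M[R]_(p,q) -> 'M[R]_(r,t)) (f : 'rV[R]_m -> 'M[R]_(p, q)) u :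
  linear l -> smooth f u -> smooth (fun u => l (f u)) u.
Proof.
move=> ll [U [oU Uu kU]]; exists U; split; [exact: oU|exact: Uu|move=> k].
exact: CkM_lin oU ll (kU k).
Qed.

Lemma smooth_mul m p q r (f : 'rV[R]_m -> 'M[R]_(p, q)) (g : 'rV[R]_m -> 'M[R]_(q, r)) u :
  smooth f u -> smooth g u -> smooth (fun u => f u *m g u) u.
Proof.
move=> [U [oU Uu kU]] [V [oV Vu kV]]; exists (U `&` V).
have oUV : open (U `&` V) by exact: openI.
split; [exact: oUV|by split|move=> k].
by apply: CkM_mul oUV _ _; [apply: CkM_sub (kU k)|apply: CkM_sub (kV k)] => z [].
Qed.

Lemma smooth_add m p q (f g : 'rV[R]_m -> 'M[R]_(p, q)) u :
  smooth f u -> smooth g u -> smooth (fun u => f u + g u) u.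
Proof.
move=> [U [oU Uu kU]] [V [oV Vu kV]]; exists (U `&` V).
have oUV : open (U `&` V) by exact: openI.
split; [exact: oUV|by split|move=> k].
by apply: CkM_add oUV _ _; [apply: CkM_sub (kU k)|apply: CkM_sub (kV k)] => z [].
Qed.

Lemma smooth_opp m p q (f : 'rV[R]_m -> 'M[R]_(p, q)) u : smooth f u -> smooth (fun u => - f u) u.
Proof. by apply: smooth_lin => a x y; rewrite opprD scalerN. Qed.

Lemma smooth_scale m p q (f : 'rV[R]_m -> 'M[R]_(p, q)) a u : smooth f u -> smooth (fun u => a *: f u) u.
Proof. by apply: smooth_lin => b x y; rewrite scalerDr !scalerA mulrC. Qed.

Lemma smooth_sum m p q (I : Type) (r : seq I) (f : I -> 'rV[R]_m -> 'M[R]_(p, q)) u :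
  (forall i, smooth (f i) u) -> smooth (fun u => \sum_(i <- r) f i u) u.
Proof.
move=> h; elim: r => [|i r IH].
  apply: smooth_near (smooth_cst 0 u); apply: filterE => z; by rewrite big_nil.
apply: smooth_near (smooth_add (h i) IH); apply: filterE => z; by rewrite big_cons.
Qed.

Lemma smooth_comp m n p q (f : 'rV[R]_m -> 'rV[R]_n) (g : 'rV[R]_n -> 'M[R]_(p, q)) u :
  smooth f u -> smooth g (f u) -> smooth (fun u => g (f u)) u.
Proof.
move=> sf [V [oV Vu kV]]; have cf := smooth_nbhs sf; case: (sf) => [U [oU Uu kU]].
have nV : \forall z \near u, V (f z).
  by have := smooth_cont sf; apply; exact: open_nbhs_nbhs.
have : \forall z \near u, V (f z) /\ U z.
  by apply: filterI => //; exact: open_nbhs_nbhs.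
case/near_open => W [oW Wu VW]; exists W; split; [exact: oW|exact: Wu|move=> k].
apply: (CkM_comp oW oV _ _ (kV k)); first by move=> z /VW [].
by apply: CkM_sub (kU k) => z /VW [].
Qed.

Lemma lin_row_mx m p1 p2 :
  (linear (fun A : 'M[R]_(m, p1) => row_mx A (0 : 'M_(m, p2)))) *
  (linear (fun A : 'M[R]_(m, p2) => row_mx (0 : 'M_(m, p1)) A)).
Proof.
by split=> a x y; rewrite scale_row_mx add_row_mx scaler0 addr0.
Qed.

Lemma row_mxD m p1 p2 (A : 'M[R]_(m, p1)) (B : 'M[R]_(m, p2)) :
  row_mx A B = row_mx A 0 + row_mx 0 B.
Proof. by rewrite add_row_mx addr0 add0r. Qed.

Lemma smooth_row n m p1 p2 (f : 'rV[R]_n -> 'M[R]_(m, p1)) (g : 'rV[R]_n -> 'M[R]_(m, p2)) u :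
  smooth f u -> smooth g u -> smooth (fun u => row_mx (f u) (g u)) u.
Proof.
move=> sf sg; have h := smooth_add (smooth_lin (lin_row_mx _ _ p2).1 sf) (smooth_lin (lin_row_mx _ p1 _).2 sg).
by apply: smooth_near h; apply: filterE => z; rewrite -row_mxD.
Qed.

Lemma der_row (V : normedModType R) m p1 p2 (f : V -> 'M[R]_(m, p1)) (g : V -> 'M[R]_(m, p2)) u D E :
  der f u D -> der g u E -> der (fun u => row_mx (f u) (g u)) u (fun v => row_mx (D v) (E v)).
Proof.
move=> df dg.
have h := derD (linear_mx_der (lin_row_mx _ _ p2).1 df) (linear_mx_der (lin_row_mx _ p1 _).2 dg).
apply: der_eq (der_near h _) _ => [|v]; last by rewrite -row_mxD.
by apply: filterE => z; rewrite -row_mxD.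
Qed.

Lemma lin_lsub m p1 p2 : linear (@lsubmx R m p1 p2). Proof. by move=> a x y; rewrite linearP. Qed.
Lemma lin_rsub m p1 p2 : linear (@rsubmx R m p1 p2). Proof. by move=> a x y; rewrite linearP. Qed.
Lemma lin_vec m p : linear (@vec_mx R m p). Proof. by move=> a x y; rewrite linearP. Qed.
Lemma lin_mxvec m p : linear (@mxvec R m p). Proof. by move=> a x y; rewrite linearP. Qed.

Lemma J_mul m p (f : 'rV[R]_m -> 'rV[R]_p) u D v : der f u D -> v *m 'J f u = D v.
Proof. by case=> _ <-; rewrite mul_rV_lin1. Qed.

Lemma eq_mul_rV m p (A B : 'M[R]_(m, p)) : (forall v : 'rV_m, v *m A = v *m B) -> A = B.
Proof. by move=> h; apply/row_matrixP => i; rewrite !rowE. Qed.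

Lemma J_uniq m p (f : 'rV[R]_m -> 'rV[R]_p) u D A : der f u D ->
  (forall v, D v = v *m A) -> 'J f u = A.
Proof. by move=> df h; apply: eq_mul_rV => v; rewrite (J_mul v df). Qed.

Lemma der_J m p (f : 'rV[R]_m -> 'rV[R]_p) u D : der f u D -> der f u (fun v => v *m 'J f u).
Proof. by move=> df; apply: der_eq (df) _ => v; rewrite (J_mul v df). Qed.

Lemma smooth_derJ m p (f : 'rV[R]_m -> 'rV[R]_p) u : smooth f u -> der f u (fun v => v *m 'J f u).
Proof. by move=> /smooth_der/der_J. Qed.

Lemma J_near m p (f g : 'rV[R]_m -> 'rV[R]_p) u : smooth f u ->
  (\forall z \near u, f z = g z) -> 'J f u = 'J g u.
Proof.
by move=> sf fg; apply/esym; apply: J_uniq (der_near (smooth_derJ sf) fg) _.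
Qed.

Lemma J_comp m n p (f : 'rV[R]_m -> 'rV[R]_n) (g : 'rV[R]_n -> 'rV[R]_p) u :
  smooth f u -> smooth g (f u) -> 'J (fun u => g (f u)) u = 'J f u *m 'J g (f u).
Proof.
move=> sf sg; apply: J_uniq (der_comp (smooth_derJ sf) (smooth_derJ sg)) _ => v.
by rewrite mulmxA.
Qed.

Lemma J_id m (u : 'rV[R]_m) : 'J (fun u => u) u = 1%:M.
Proof. by apply: J_uniq (der_id u) _ => v; rewrite mulmx1. Qed.

Lemma mx_rows m p (A : 'M[R]_(m, p)) :
  A = \sum_i delta_mx i (0 : 'I_1) *m (delta_mx 0 i *m A).
Proof.
under eq_bigr do rewrite mulmxA mul_delta_mx.
by rewrite -mulmx_suml -[LHS]mul1mx [1%:M]scalar_mx_sum_delta; under [in LHS]eq_bigr do rewrite scale1r.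
Qed.

Lemma smooth_rows n m p (F : 'rV[R]_n -> 'M[R]_(m, p)) u :
  (forall v : 'rV_m, smooth (fun u => v *m F u) u) -> smooth F u.
Proof.
move=> h.
have k i : smooth (fun u => delta_mx i (0 : 'I_1) *m (delta_mx 0 i *m F u)) u.
  by apply: smooth_mul (h _); exact: smooth_cst.
apply: smooth_near (smooth_sum (index_enum 'I_m) k).
by apply: filterE => z; rewrite [RHS]mx_rows.
Qed.

(** A row vector times the Jacobian is a directional derivative, so smoothness is checked after
    multiplication by each fixed row vector. *)
Lemma smooth_J m p (f : 'rV[R]_m -> 'rV[R]_p) u : smooth f u -> smooth (fun u => 'J f u) u.
Proof.
move=> sf; apply: smooth_rows => v; apply: smooth_near (smooth_D v sf).
by apply: filterS (smooth_nbhs sf) => z sz; rewrite (J_mul v (smooth_der sz)).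
Qed.

(** Schwarz's theorem for each entry; the work lies in identifying, on a whole neighbourhood, an
    entry of a derivative with the derivative of that entry. *)
Lemma D_swap m p q (F : 'rV[R]_m -> 'M[R]_(p, q)) u v w : smooth F u ->
  'D_w (fun u => 'D_v F u) u = 'D_v (fun u => 'D_w F u) u.
Proof.
case=> U [oU Uu kU].
have key (G : 'rV[R]_m -> 'M[R]_(p, q)) i j : (forall k, CkM k U G) ->
   C1on (fun z => G z i j) U /\ (forall z v, U z -> 'D_v (fun z => G z i j) z = 'D_v G z i j).
  move=> kG; split=> [z Uz y|z y Uz].
    have dG := CkM_der oU (kG 1%N).
    split; first by have /der_mxP/(_ i j)/der_derivable := dG z Uz; apply.
    have E : \forall x \near z, 'D_y G x i j = 'D_y (fun z => G z i j) x.
      have nU : \forall x \near z, U x by exact: open_nbhs_nbhs.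
      by apply: filterS nU => x Ux; have /der_mxP/(_ i j)/der_D -> := dG x Ux.
    have c : {for z, continuous (fun u => 'D_y G u i j)}.
      apply: (@continuous_comp _ _ _ (fun u => 'D_y G u) (fun A : 'M[R]_(p, q) => A i j)).
        exact: ((kG 1%N).2 y).2.1.
      exact: coord_continuous.
    move: c; rewrite /prop_for /continuous_at.
    have -> : 'D_y G z i j = 'D_y (fun z => G z i j) z by exact: (nbhs_singleton E).
    by move=> c; exact: cvg_trans (near_eq_cvg E) c.
  by have /der_mxP/(_ i j)/der_D -> := CkM_der oU (kG 1%N) Uz.
apply/matrixP => i j.
have kD y : forall k, CkM k U (fun u => 'D_y F u) by move=> k; exact: ((kU k.+1).2 y).2.
have [c1 e1] := key F i j kU; have [cv ev] := key _ i j (kD v); have [cw ew] := key _ i j (kD w).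
refine (etrans (esym (ev u w Uu)) (etrans _ (ew u v Uu))).
have C y : C1on (fun u => 'D_y F u i j) U -> C1on (fun u => 'D_y (fun z => F z i j) u) U.
  move=> c z Uz x.
  have E : \forall z \near z, 'D_y F z i j = 'D_y (fun z => F z i j) z.
    have nU : \forall x \near z, U x by exact: open_nbhs_nbhs.
    by apply: filterS nU => x' Ux; rewrite e1.
  have nU : \forall x \near z, U x by exact: open_nbhs_nbhs.
  have [h1 h2] := c z Uz x; split; first exact: near_eq_derivable E h1.
  have E2 : \forall z \near z, 'D_x (fun u => 'D_y F u i j) z = 'D_x (fun u => 'D_y (fun z => F z i j) u) z.
    apply: filterS nU => z' Uz'; apply: near_eq_derive.
    have nU' : \forall x \near z', U x by exact: open_nbhs_nbhs.
    by apply: filterS nU' => x' Ux; rewrite e1.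
  move: h2; rewrite /prop_for /continuous_at (nbhs_singleton E2) => h2.
  exact: cvg_trans (near_eq_cvg E2) h2.
have S := schwarz oU Uu c1 (C v cv) (C w cw).
have nU := near_in oU Uu.
have E x y : 'D_y (fun z => 'D_x F z i j) u = 'D_y (fun z => 'D_x (fun z => F z i j) z) u.
  by apply: near_eq_derive; apply: filterS nU => x' Ux; rewrite e1.
exact: (etrans (E v w) (etrans S (esym (E w v)))).
Qed.

End Pointwise.

(** * Atlases *)
Section Atlas.
Context {R : realType}.

Lemma cont_near (T T' : topologicalType) (f : T -> T') u (P : T' -> Prop) :
  {for u, continuous f} -> (\forall w \near f u, P w) -> \forall z \near u, P (f z).
Proof. by move=> cf hP; exact: (cf _ hP). Qed.

(** The chart axioms of [is_manifold]. They pass to [Tan] and [HomB] by a local computation, so that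
    the same lemmas serve M and the iterated tangent and jet manifolds. *)
Definition atlas m (N : charted R m) : Prop :=
  [/\ (forall x : N, dom (chart_at x) x),
      (forall (c : chart N) x, dom c x -> inv c (phi c x) = x) &
      (forall c d : chart N, open (phi c @` (dom c `&` dom d)) /\
         Cinf (phi c @` (dom c `&` dom d)) (phi d \o inv c))].

Lemma manifold_atlas m (N : charted R m) : is_manifold N -> atlas N.
Proof. by case. Qed.

(** The carrier has no topology of its own, so neighbourhoods are read in a chart; by [mnearP] every
    chart around x gives the same notion. *)
Definition mnear m (N : charted R m) (x : N) (P : N -> Prop) : Prop :=
  \forall u \near phi (chart_at x) x, P (inv (chart_at x) u).

Section OneAtlas.
Variables (m : nat) (N : charted R m) (aN : atlas N).
Implicit Types (c d e : chart N) (x : N).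

Lemma domx x : dom (chart_at x) x. Proof. by case: aN. Qed.
Lemma phiK c x : dom c x -> inv c (phi c x) = x. Proof. by case: aN => _ + _; exact. Qed.

Lemma atlas_near c d x : dom c x -> dom d x ->
  \forall u \near phi c x, [/\ dom c (inv c u), dom d (inv c u) & phi c (inv c u) = u].
Proof.
move=> cx dx; case: aN => _ _ /(_ c d) [oI _].
have Ix : (phi c @` (dom c `&` dom d)) (phi c x) by exists x.
apply: filterS (near_in oI Ix) => u [z [cz dz] <-].
by rewrite phiK.
Qed.

Lemma smooth_trans c d x : dom c x -> dom d x -> smooth (fun u => phi d (inv c u)) (phi c x).
Proof.
move=> cx dx; case: aN => _ _ /(_ c d) [oI sI].
by apply: (Cinf_smooth oI _ sI); exists x.
Qed.

Lemma chart_near c d x (P : N -> Prop) : dom c x -> dom d x ->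
  (\forall u \near phi c x, P (inv c u)) -> \forall u \near phi d x, P (inv d u).
Proof.
move=> cx dx Pc.
have h1 := atlas_near dx cx.
have c1 := smooth_cont (smooth_trans dx cx).
have : \forall u \near phi d x, P (inv c (phi c (inv d u))).
  by apply: (cont_near (P := fun w => P (inv c w)) c1); rewrite phiK.
by apply: filterS2 h1 => u [du cu _]; rewrite phiK.
Qed.

Lemma mnearP c x (P : N -> Prop) : dom c x ->
  mnear x P <-> \forall u \near phi c x, P (inv c u).
Proof. by move=> cx; split; apply: chart_near => //; exact: domx. Qed.

Lemma mnear_self x (P : N -> Prop) : mnear x P -> P x.
Proof. by move=> /nbhs_singleton; rewrite phiK //; exact: domx. Qed.

Lemma mnearS x (P Q : N -> Prop) : (forall z, P z -> Q z) -> mnear x P -> mnear x Q.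
Proof. by move=> PQ; apply: filterS => u; exact: PQ. Qed.

Lemma mnearI x (P Q : N -> Prop) : mnear x P -> mnear x Q -> mnear x (fun z => P z /\ Q z).
Proof. exact: filterI. Qed.

Lemma mopenP (U : set N) : mopen U <-> forall x, U x -> mnear x U.
Proof.
split=> [oU x Ux|h c].
  have Ix : (phi (chart_at x) @` (dom (chart_at x) `&` U)) (phi (chart_at x) x).
    by exists x => //; split => //; exact: domx.
  by apply: filterS (near_in (oU _) Ix) => u [z [cz Uz] <-]; rewrite phiK.
rewrite openE => _ [x [cx Ux] <-]; rewrite /interior.
have h1 : \forall u \near phi c x, U (inv c u) by apply/mnearP => //; exact: h.
have h2 := atlas_near cx cx.
apply: filterS2 h1 h2 => u Uu [cu _ E]; exists (inv c u) => //.
Qed.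

Lemma mopen_near (U : set N) x : mopen U -> U x -> mnear x U.
Proof. by move=> /mopenP; apply. Qed.

Lemma mopen_dom c : mopen (dom c).
Proof.
by apply/mopenP => x cx; apply/(mnearP _ cx); apply: filterS (atlas_near cx cx) => u [].
Qed.

Lemma dom_near c x : dom c x -> mnear x (dom c).
Proof. exact/mopen_near/mopen_dom. Qed.

Lemma mnear_chart c x (P : N -> Prop) : dom c x ->
  mnear x P -> \forall u \near phi c x, [/\ dom c (inv c u), P (inv c u) & phi c (inv c u) = u].
Proof.
by move=> cx /(mnearP _ cx) h; apply: filterS2 h (atlas_near cx cx) => u Pu [].
Qed.

Lemma mopen_pull c (O : set 'rV[R]_m) : open O -> mopen (fun x => dom c x /\ O (phi c x)).
Proof.
move=> oO; apply/mopenP => x [cx Ox]; apply/(mnearP _ cx).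
have h := near_in oO Ox.
by apply: filterS2 h (atlas_near cx cx) => u Ou [du _ E]; rewrite E.
Qed.

Lemma mopenI (U V : set N) : mopen U -> mopen V -> mopen (U `&` V).
Proof.
move=> /mopenP oU /mopenP oV; apply/mopenP => x [Ux Vx].
by apply: mnearS (mnearI (oU _ Ux) (oV _ Vx)).
Qed.

Lemma trans_id c x : dom c x -> trans c c x = 1%:M.
Proof.
move=> cx; rewrite /trans.
have h : \forall u \near phi c x, u = phi c (inv c u).
  by apply: filterS (atlas_near cx cx) => u [].
by rewrite -(J_near (smooth_id _) h) J_id.
Qed.

End OneAtlas.

Section TwoAtlas.
Variables (m p : nat) (N : charted R m) (N' : charted R p).
Variables (aN : atlas N) (aN' : atlas N').
Implicit Types (f g : N -> N').

Definition loc (c : chart N) (d : chart N') f u := phi d (f (inv c u)).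
(** Smoothness of [loc] says nothing about f where f leaves [dom d]; the first clause keeps f inside
    near x, and both together give continuity, as in [smap_mnear]. *)
Definition smap_in (c : chart N) (d : chart N') f (x : N) :=
  mnear x (fun z => dom d (f z)) /\ smooth (loc c d f) (phi c x).
Definition smap f (x : N) := smap_in (chart_at x) (chart_at (f x)) f x.
Definition tmx (c : chart N) (d : chart N') f (x : N) : 'M[R]_(m, p) := 'J (loc c d f) (phi c x).

Lemma loc_change c d c' d' f x : smap_in c d f x -> dom c x -> dom d (f x) ->
  dom c' x -> dom d' (f x) ->
  mnear x (fun z => dom d' (f z)) /\ \forall u \near phi c' x,
    phi d' (inv d (loc c d f (phi c (inv c' u)))) = loc c' d' f u.
Proof.
move=> [df sf] cx dx cx' dx'; split.
  apply/(mnearP aN _ cx).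
  have h := atlas_near aN' dx dx'.
  have cf := smooth_cont sf; have : \forall u \near phi c x, dom d' (inv d (loc c d f u)).
    apply: (cont_near (P := fun w => dom d' (inv d w)) cf).
    by rewrite /loc phiK //; apply: filterS h => w [].
  by apply: filterS2 ((mnearP aN _ cx).1 df) => u du; rewrite /loc phiK.
apply: filterS2 (atlas_near aN cx' cx) ((mnearP aN _ cx').1 df) => u [cu cu' E] du.
by rewrite /loc !phiK.
Qed.

Lemma smap_in_change c d c' d' f x : smap_in c d f x -> dom c x -> dom d (f x) ->
  dom c' x -> dom d' (f x) -> smap_in c' d' f x.
Proof.
move=> sf cx dx cx' dx'; have [h1 h2] := loc_change sf cx dx cx' dx'.
split; first exact: h1.
apply: smooth_near h2 _.
apply: (@smooth_comp _ _ _ _ _ _ (fun w => phi d' (inv d w))).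
  apply: (@smooth_comp _ _ _ _ _ _ (loc c d f)); first exact: smooth_trans.
  by rewrite phiK //; exact: sf.2.
by rewrite /loc !phiK //; exact: smooth_trans.
Qed.

Lemma tmx_change c d c' d' f x : smap_in c d f x -> dom c x -> dom d (f x) ->
  dom c' x -> dom d' (f x) ->
  tmx c' d' f x = trans c' c x *m tmx c d f x *m trans d d' (f x).
Proof.
move=> sf cx dx cx' dx'; have [h1 h2] := loc_change sf cx dx cx' dx'.
have Ex : phi c (inv c' (phi c' x)) = phi c x by rewrite phiK.
have Ef : loc c d f (phi c x) = phi d (f x) by rewrite /loc phiK.
have s1 : smooth (fun u => phi c (inv c' u)) (phi c' x) by exact: smooth_trans.
have s2 : smooth (loc c d f) (phi c (inv c' (phi c' x))) by rewrite Ex; exact: sf.2.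
have s12 := smooth_comp s1 s2.
have s3 : smooth (fun w => phi d' (inv d w)) (loc c d f (phi c (inv c' (phi c' x)))).
  by rewrite Ex Ef; exact: smooth_trans.
refine (etrans (esym (J_near (smooth_comp s12 s3) h2)) (etrans (J_comp s12 s3) _)).
by have E := J_comp s1 s2; rewrite E Ex Ef.
Qed.

Lemma smap_in_charts c d f x : smap f x -> dom c x -> dom d (f x) -> smap_in c d f x.
Proof. by move=> sf cx dx; apply: smap_in_change sf _ _ _ _; try exact: domx. Qed.

Lemma smapI c d f x : smap_in c d f x -> dom c x -> dom d (f x) -> smap f x.
Proof. by move=> sf cx dx; apply: smap_in_change sf _ _ _ _; try exact: domx. Qed.

Lemma tanmxE c d f x : smap f x -> dom c x -> dom d (f x) ->
  tmx c d f x = trans c (chart_at x) x *m tanmx f x *m trans (chart_at (f x)) d (f x).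
Proof. by move=> sf cx dx; apply: tmx_change sf _ _ _ _; try exact: domx. Qed.

Lemma smooth_onP (U : set N) f : smooth_on U f <-> mopen U /\ forall x, U x -> smap f x.
Proof.
split=> -[oU h]; split=> //.
  move=> x Ux; have cx := domx aN x; have dx := domx aN' (f x).
  have [oO sO] := h (chart_at x) (chart_at (f x)).
  have Ox : (phi (chart_at x) @` (dom (chart_at x) `&` U `&` f @^-1` dom (chart_at (f x)))) (phi (chart_at x) x).
    by exists x.
  split; last exact: (Cinf_smooth oO Ox sO).
  by apply: filterS (near_in oO Ox) => u [z [[cz Uz] dz] <-]; rewrite phiK.
move=> c d O.
have key z : dom c z -> U z -> dom d (f z) -> smap_in c d f z by move=> *; apply: smap_in_charts => //; exact: h.
split.
  rewrite openE => _ [x [[cx Ux] dx] <-]; rewrite /interior.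
  have [h1 _] := key x cx Ux dx.
  apply: filterS (mnear_chart aN cx (mnearI h1 (mopen_near aN oU Ux))) => u [cu [du Uu] E].
  by exists (inv c u).
by apply: smooth_Cinf => _ [x [[cx Ux] dx] <-]; have [_] := key x cx Ux dx.
Qed.

Lemma smap_ext f g x : mnear x (fun z => f z = g z) -> smap f x -> smap g x.
Proof.
move=> fg [h1 h2]; have fgx := mnear_self aN fg.
rewrite /smap /smap_in -fgx; split.
  by apply: filterS2 fg h1 => u <-.
by apply: smooth_near h2; rewrite /mnear in fg; apply: filterS fg => u; rewrite /loc => ->.
Qed.

Lemma tmx_ext c d f g x : mnear x (fun z => f z = g z) -> smap f x -> dom c x -> dom d (f x) ->
  tmx c d f x = tmx c d g x.
Proof.
move=> fg sf cx dx; apply: J_near; first by have [] := smap_in_charts sf cx dx.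
by apply: filterS ((mnearP aN _ cx).1 fg) => u; rewrite /loc => ->.
Qed.

Lemma smap_mnear f x (P : N' -> Prop) : smap f x -> mnear (f x) P -> mnear x (fun z => P (f z)).
Proof.
move=> [df sf] hP; have cx := domx aN x.
have h : \forall u \near phi (chart_at x) x, P (inv (chart_at (f x)) (loc (chart_at x) (chart_at (f x)) f u)).
  apply: (cont_near (P := fun w => P (inv (chart_at (f x)) w)) (smooth_cont sf)).
  by rewrite /loc phiK.
rewrite /mnear in df *; by apply: filterS2 df h => u du; rewrite /loc phiK.
Qed.

End TwoAtlas.

Section ThreeAtlas.
Variables (m p q : nat) (N1 : charted R m) (N2 : charted R p) (N3 : charted R q).
Variables (a1 : atlas N1) (a2 : atlas N2) (a3 : atlas N3).

Lemma loc_comp (f : N1 -> N2) (g : N2 -> N3) x c d e : smap f x ->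
  dom c x -> dom d (f x) ->
  \forall u \near phi c x, loc d e g (loc c d f u) = loc c e (g \o f) u.
Proof.
move=> sf cx dx; have [df _] := smap_in_charts a1 a2 sf cx dx.
by apply: filterS ((mnearP a1 _ cx).1 df) => u du; rewrite /loc phiK.
Qed.

Lemma smap_comp (f : N1 -> N2) (g : N2 -> N3) x : smap f x -> smap g (f x) -> smap (g \o f) x.
Proof.
move=> sf sg; have cx := domx a1 x; have dx := domx a2 (f x); have ex := domx a3 (g (f x)).
split; first exact: (smap_mnear a1 a2 sf sg.1).
apply: (smooth_near (loc_comp g (chart_at (g (f x))) sf cx dx)).
apply: smooth_comp; first exact: sf.2.
by rewrite /loc phiK //; exact: sg.2.
Qed.

Lemma tmx_comp (f : N1 -> N2) (g : N2 -> N3) x c d e : smap f x -> smap g (f x) ->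
  dom c x -> dom d (f x) -> dom e (g (f x)) ->
  tmx c e (g \o f) x = tmx c d f x *m tmx d e g (f x).
Proof.
move=> sf sg cx dx ex; have [_ s1] := smap_in_charts a1 a2 sf cx dx.
have [_ s2] := smap_in_charts a2 a3 sg dx ex.
have Ef : loc c d f (phi c x) = phi d (f x) by rewrite /loc phiK.
have s2' : smooth (loc d e g) (loc c d f (phi c x)) by rewrite Ef.
refine (etrans (esym (J_near (smooth_comp s1 s2') (loc_comp g e sf cx dx))) (etrans (J_comp s1 s2') _)).
by rewrite Ef.
Qed.
End ThreeAtlas.

Section Trans.
Variables (m : nat) (N : charted R m) (aN : atlas N).

Lemma smap_id (x : N) : smap id x.
Proof.
have cx := domx aN x.
by split; [exact: (dom_near aN cx)|exact: (smooth_trans aN cx cx)].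
Qed.

Lemma trans_comp (c d e : chart N) x : dom c x -> dom d x -> dom e x ->
  trans c d x *m trans d e x = trans c e x.
Proof.
move=> cx dx ex; rewrite -[RHS]/(tmx c e (id \o id) x).
by rewrite (tmx_comp aN aN aN (smap_id x) (smap_id x) cx dx ex).
Qed.

Lemma transK (c d : chart N) x : dom c x -> dom d x -> trans c d x *m trans d c x = 1%:M.
Proof. by move=> cx dx; rewrite trans_comp // trans_id. Qed.
End Trans.

End Atlas.

(** * Tangent and jet manifolds *)
Section Induced.
Context {R : realType}.

Lemma near_lsub m p1 p2 (u : 'M[R]_(m, p1 + p2)) (P : 'M[R]_(m, p1) -> Prop) :
  (\forall a \near lsubmx u, P a) -> \forall z \near u, P (lsubmx z).
Proof. by apply: cont_near; exact: continuous_lsubmx. Qed.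

Lemma near_rsub m p1 p2 (u : 'M[R]_(m, p1 + p2)) (P : 'M[R]_(m, p2) -> Prop) :
  (\forall a \near rsubmx u, P a) -> \forall z \near u, P (rsubmx z).
Proof. by apply: cont_near; exact: continuous_rsubmx. Qed.

Lemma smooth_lsub m n p1 p2 (f : 'rV[R]_n -> 'M[R]_(m, p1 + p2)) u : smooth f u -> smooth (fun z => lsubmx (f z)) u.
Proof. exact/smooth_lin/lin_lsub. Qed.

Lemma smooth_rsub m n p1 p2 (f : 'rV[R]_n -> 'M[R]_(m, p1 + p2)) u : smooth f u -> smooth (fun z => rsubmx (f z)) u.
Proof. exact/smooth_lin/lin_rsub. Qed.

Lemma smooth_vec m n p (f : 'rV[R]_n -> 'rV[R]_(m * p)) u : smooth f u -> smooth (fun z => vec_mx (f z)) u.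
Proof. exact/smooth_lin/lin_vec. Qed.

Lemma smooth_mxvec m n p (f : 'rV[R]_n -> 'M[R]_(m, p)) u : smooth f u -> smooth (fun z => mxvec (f z)) u.
Proof. exact/smooth_lin/lin_mxvec. Qed.

Lemma atlas_intro m (N : charted R m) :
  (forall x : N, dom (chart_at x) x) ->
  (forall (c : chart N) x, dom c x -> inv c (phi c x) = x) ->
  (forall (c d : chart N) x, dom c x -> dom d x ->
     (\forall u \near phi c x, [/\ dom c (inv c u), dom d (inv c u) & phi c (inv c u) = u]) /\
     smooth (fun u => phi d (inv c u)) (phi c x)) -> atlas N.
Proof.
move=> h1 h2 h3; split=> // c d; split.
  rewrite openE => _ [x [cx dx] <-]; rewrite /interior.
  have [h _] := h3 c d x cx dx.
  by apply: filterS h => u [cu du E]; exists (inv c u).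
by apply: smooth_Cinf => _ [x [cx dx] <-]; have [] := h3 c d x cx dx.
Qed.

Section Tangent.
Variables (m : nat) (N : charted R m) (aN : atlas N).

Lemma atlas_Tan : atlas (Tan N).
Proof.
(* The preferred chart at x may jump with x, so a coordinate change that passes through it could be
   irregular. By the cocycle rule it cancels and the smooth transition from c to d remains. *)
have tE (c d : chart N) (x : N) (b : 'rV[R]_m) : dom c x -> dom d x ->
    b *m trans c (chart_at x) x *m trans (chart_at x) d x = b *m trans c d x.
  by move=> cx dx; rewrite -mulmxA trans_comp //; exact: domx.
apply: atlas_intro => [X|c [x v] /= cx|c d [x v] /= cx dx].
- exact: (domx aN X.1).
- have px := domx aN x.
  by rewrite row_mxKl row_mxKr phiK // -mulmxA trans_comp // trans_id // mulmx1.
move: (c : chart N) (d : chart N) cx dx => {}c {}d cx dx.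
set w := row_mx _ _.
have nw : \forall u \near w, [/\ dom c (inv c (lsubmx u)),
  dom d (inv c (lsubmx u)) & phi c (inv c (lsubmx u)) = lsubmx u].
  apply: (near_lsub (P := fun a => [/\ dom c (inv c a), dom d (inv c a) & phi c (inv c a) = a])).
  by rewrite /w row_mxKl; exact: atlas_near.
split.
  apply: filterS nw => u [cu du E]; split => //.
  by rewrite E tE // trans_id // mulmx1 hsubmxK.
have sl : smooth lsubmx w by apply: smooth_lsub; exact: smooth_id.
have st : smooth (fun a => phi d (inv c a)) (lsubmx w) by rewrite row_mxKl; exact: smooth_trans.
have S : smooth (fun u => row_mx (phi d (inv c (lsubmx u))) (rsubmx u *m 'J (fun a => phi d (inv c a)) (lsubmx u))) w.
  apply: smooth_row; first exact: (smooth_comp sl st).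
  apply: smooth_mul; first by apply: smooth_rsub; exact: smooth_id.
  exact: (smooth_comp sl (smooth_J st)).
apply: smooth_near S; apply: filterS nw => u [cu du E].
rewrite (tE c d (inv c (lsubmx u)) (rsubmx u) cu du) /trans E.
exact: erefl.
Qed.

Lemma phi_Tan_chart_at (x : N) (v : 'rV[R]_m) :
  phi (N := Tan N) (chart_at x) (x, v) = row_mx (phi (chart_at x) x) v.
Proof. by rewrite /= trans_id ?mulmx1 //; exact: domx. Qed.

Definition vsec (X : N -> 'rV[R]_m) : N -> Tan N := fun x => (x, X x).

Lemma loc_vfield (X : N -> 'rV[R]_m) (c : chart N) u :
  loc (N' := Tan N) c c (vsec X) u = row_mx (phi c (inv c u)) (vf_comp c X u).
Proof. by []. Qed.

Lemma smap_vfield (X : N -> 'rV[R]_m) (c : chart N) x : dom c x ->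
  smap (N' := Tan N) (vsec X) x <-> smooth (vf_comp c X) (phi c x).
Proof.
move=> cx; split=> [sX|sX].
  have [_ /smooth_rsub s] := smap_in_charts (d := c) aN atlas_Tan sX cx cx.
  by apply: smooth_near s; apply: filterE => u; rewrite loc_vfield row_mxKr.
refine (smapI (c := c) (d := c : chart (Tan N)) (f := vsec X) aN atlas_Tan _ cx cx).
split; first exact: (dom_near aN cx).
apply: smooth_near (smooth_row (smooth_id _) sX).
by apply: filterS (atlas_near aN cx cx) => u [_ _ E]; rewrite loc_vfield E.
Qed.

Lemma vfield_onP (U : set N) X : vfield_on U X <->
  mopen U /\ forall x, U x -> forall c, dom c x -> smooth (vf_comp c X) (phi c x).
Proof.
split=> [/(smooth_onP aN atlas_Tan) [oU h]|[oU h]].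
  by split=> // x Ux c cx; apply/(smap_vfield X cx); exact: h.
apply/(smooth_onP aN atlas_Tan); split=> // x Ux.
by apply/(smap_vfield X (domx aN x)); apply: h => //; exact: domx.
Qed.

Lemma vf_comp_at (X : N -> 'rV[R]_m) (c : chart N) x : dom c x ->
  vf_comp c X (phi c x) = X x *m trans (chart_at x) c x.
Proof. by move=> cx; rewrite /vf_comp phiK. Qed.

Lemma vf_comp_chart_at (X : N -> 'rV[R]_m) x :
  vf_comp (chart_at x) X (phi (chart_at x) x) = X x.
Proof. by rewrite vf_comp_at ?trans_id ?mulmx1 //; exact: domx. Qed.

Definition vf_of (c : chart N) (V : 'rV[R]_m -> 'rV[R]_m) (x : N) :=
  V (phi c x) *m trans c (chart_at x) x.

Lemma vf_ofE (c : chart N) V x : dom c x ->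
  \forall u \near phi c x, V u = vf_comp c (vf_of c V) u.
Proof.
move=> cx; apply: filterS (atlas_near aN cx cx) => u [cu _ E].
have px := domx aN (inv c u).
by rewrite /vf_comp /vf_of E -mulmxA trans_comp // trans_id // mulmx1.
Qed.

Lemma vf_of_near (c : chart N) V x : dom c x -> smooth V (phi c x) -> smooth (vf_comp c (vf_of c V)) (phi c x).
Proof. by move=> cx; apply: smooth_near; exact: vf_ofE. Qed.

Lemma vf_comp_change (X : N -> 'rV[R]_m) (c d : chart N) x : dom c x -> dom d x ->
  vf_comp d X (phi d x) = vf_comp c X (phi c x) *m trans c d x.
Proof. move=> cx dx; have px := domx aN x.
by rewrite (vf_comp_at X dx) (vf_comp_at X cx) -mulmxA trans_comp. Qed.

End Tangent.

Lemma phi_tmap m p (N : charted R m) (N' : charted R p) (aN : atlas N) (aN' : atlas N')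
  (f : N -> N') (X : Tan N) (c : chart N) (d : chart N') : smap f X.1 -> dom c X.1 -> dom d (f X.1) ->
  phi (N := Tan N') d (tmap f X) =
  row_mx (phi d (f X.1)) (rsubmx (phi (N := Tan N) c X) *m tmx c d f X.1).
Proof.
move=> sf cx dx; rewrite /= row_mxKr; congr row_mx.
rewrite (tanmxE aN aN' sf cx dx) -!mulmxA [trans _ c _ *m _]mulmxA trans_comp //; try exact: domx.
by rewrite trans_id ?mul1mx //; exact: domx.
Qed.

Lemma conj_mx m1 m2 m3 m4 m5 m6 (T1 : 'M[R]_(m1, m2)) (T2 : 'M_(m2, m3)) (T12 : 'M_(m1, m3))
  (A : 'M_(m3, m4)) (T3 : 'M_(m4, m5)) (T4 : 'M_(m5, m6)) T34 :
  T1 *m T2 = T12 -> T3 *m T4 = T34 ->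
  T1 *m (T2 *m A *m T3) *m T4 = T12 *m A *m T34.
Proof. by move=> <- <-; rewrite !mulmxA. Qed.

Section HomAtlas.
Variables (m p : nat) (N : charted R m) (N' : charted R p) (aN : atlas N) (aN' : atlas N').

Lemma atlas_HomB : atlas (HomB N N').
Proof.
(* As for [Tan]: the preferred charts at the source and at the target cancel, leaving fixed charts
   on both sides. *)
have tE (c c' : chart N) (d d' : chart N') x y (A : 'M[R]_(m, p)) :
   dom c x -> dom c' x -> dom d y -> dom d' y ->
   trans c' (chart_at x) x *m (trans (chart_at x) c x *m A *m trans d (chart_at y) y)
     *m trans (chart_at y) d' y = trans c' c x *m A *m trans d d' y.
  move=> cx cx' dy dy'; have px := domx aN x; have py := domx aN' y.
  exact: conj_mx (trans_comp aN cx' px cx) (trans_comp aN' dy py dy').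
apply: atlas_intro => [j|[c d] [x y A] /= [cx dy]|[c d] [c' d'] [x y A] /= [cx dy] [cx' dy']].
- by split; exact: domx.
- rewrite !row_mxKl !row_mxKr !phiK // mxvecK; congr Hom.
  have px := domx aN x; have py := domx aN' y.
  rewrite (conj_mx _ (trans_comp aN px cx px) (trans_comp aN' py dy py)).
  by rewrite (trans_id aN px) (trans_id aN' py) mul1mx mulmx1.
set w := row_mx _ _.
have nc : \forall u \near w, [/\ dom c (inv c (lsubmx (lsubmx u))),
  dom c' (inv c (lsubmx (lsubmx u))) & phi c (inv c (lsubmx (lsubmx u))) = lsubmx (lsubmx u)].
  apply: (near_lsub (P := fun b => [/\ dom c (inv c (lsubmx b)),
    dom c' (inv c (lsubmx b)) & phi c (inv c (lsubmx b)) = lsubmx b])).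
  apply: (near_lsub (P := fun a => [/\ dom c (inv c a), dom c' (inv c a) & phi c (inv c a) = a])).
  by rewrite /w !row_mxKl; exact: atlas_near.
have nd : \forall u \near w, [/\ dom d (inv d (rsubmx (lsubmx u))),
  dom d' (inv d (rsubmx (lsubmx u))) & phi d (inv d (rsubmx (lsubmx u))) = rsubmx (lsubmx u)].
  apply: (near_lsub (P := fun b => [/\ dom d (inv d (rsubmx b)),
    dom d' (inv d (rsubmx b)) & phi d (inv d (rsubmx b)) = rsubmx b])).
  apply: (near_rsub (P := fun a => [/\ dom d (inv d a), dom d' (inv d a) & phi d (inv d a) = a])).
  by rewrite /w row_mxKl row_mxKr; exact: atlas_near.
split.
  apply: filterS2 nc nd => u [cu cu' E] [du du' E']; split => //.
  rewrite E E' (tE c c d d (inv c (lsubmx (lsubmx u))) (inv d (rsubmx (lsubmx u))) (vec_mx (rsubmx u)) cu cu du du).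
  by rewrite (trans_id aN cu) (trans_id aN' du) mul1mx mulmx1 vec_mxK !hsubmxK.
have sl1 : smooth lsubmx w by apply: smooth_lsub; exact: smooth_id.
have sl : smooth (fun u => lsubmx (lsubmx u)) w by apply: smooth_lsub.
have sr : smooth (fun u => rsubmx (lsubmx u)) w by apply: smooth_rsub.
have st : smooth (fun a => phi c' (inv c a)) (lsubmx (lsubmx w)) by rewrite !row_mxKl; exact: smooth_trans.
have st' : smooth (fun a => phi d' (inv d a)) (rsubmx (lsubmx w)) by rewrite row_mxKl row_mxKr; exact: smooth_trans.
(* The source side changes contravariantly: the left factor is the Jacobian of the transition from
   c' back to c, taken at the c'-coordinates of the source. *)
have sb : smooth (fun a => phi c (inv c' a)) (phi c' (inv c (lsubmx (lsubmx w)))).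
  by rewrite !row_mxKl phiK //; exact: smooth_trans.
have S : smooth (fun u => row_mx (row_mx (phi c' (inv c (lsubmx (lsubmx u)))) (phi d' (inv d (rsubmx (lsubmx u)))))
    (mxvec ('J (fun a => phi c (inv c' a)) (phi c' (inv c (lsubmx (lsubmx u)))) *m
       vec_mx (rsubmx u) *m 'J (fun a => phi d' (inv d a)) (rsubmx (lsubmx u))))) w.
  apply: smooth_row.
    by apply: smooth_row; [exact: (smooth_comp sl st)|exact: (smooth_comp sr st')].
  apply/smooth_mxvec/smooth_mul; last exact: (smooth_comp sr (smooth_J st')).
  apply: smooth_mul; first exact: (smooth_comp (smooth_comp sl st) (smooth_J sb)).
  by apply/smooth_vec/smooth_rsub; exact: smooth_id.
apply: smooth_near S; apply: filterS2 nc nd => u [cu cu' E] [du du' E'].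
rewrite (tE c c' d d' (inv c (lsubmx (lsubmx u))) (inv d (rsubmx (lsubmx u))) (vec_mx (rsubmx u)) cu cu' du du')
  /trans E'.
exact: erefl.
Qed.

End HomAtlas.
End Induced.

(** * Coordinates of linear maps, and sections written in charts *)

Section Sections.
Context {R : realType}.

(** Genuine coordinate vectors of c: [inv c] is a total function, unconstrained outside this set. *)
Definition cimage m (N : charted R m) (c : chart N) (w : 'rV[R]_m) : Prop :=
  dom c (inv c w) /\ phi c (inv c w) = w.

Section Good.
Variables (m : nat) (N : charted R m) (aN : atlas N).

Lemma cimage_phi (c : chart N) x : dom c x -> cimage c (phi c x).
Proof. by move=> cx; rewrite /cimage phiK. Qed.

Lemma cimage_near (c : chart N) w : cimage c w -> \forall u \near w, cimage c u.
Proof.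
move=> [dw E]; have := atlas_near aN dw dw; rewrite E.
by apply: filterS => u [].
Qed.

End Good.

Lemma cimage_HomB m p (N : charted R m) (N' : charted R p) (aN : atlas N) (aN' : atlas N')
  (c : chart N) (d : chart N') u v (A : 'M[R]_(m, p)) :
  cimage c u -> cimage d v -> cimage (N := HomB N N') (c, d) (row_mx (row_mx u v) (mxvec A)).
Proof.
move=> [cu Eu] [dv Ev]; have cdx : dom (N := HomB N N') (c, d) (inv (N := HomB N N') (c,
  d) (row_mx (row_mx u v) (mxvec A))).
  by split; rewrite /= !row_mxKl ?row_mxKr.
split; first exact: cdx.
pose j : HomB N N' := Hom (inv c u) (inv d v) (trans (chart_at (inv c u)) c (inv c u) *m A *m trans d (chart_at
  (inv d v)) (inv d v)).
have -> : inv (N := HomB N N') (c, d) (row_mx (row_mx u v) (mxvec A)) = j.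
  by rewrite /= !row_mxKl !row_mxKr mxvecK.
have pu := domx aN (inv c u); have pv := domx aN' (inv d v).
rewrite /= Eu Ev (conj_mx _ (trans_comp aN cu pu cu) (trans_comp aN' dv pv dv)).
by rewrite (trans_id aN cu) (trans_id aN' dv) mul1mx mulmx1.
Qed.

(** The matrix block of the coordinates of j; for a jet it is the Jacobian [tmx], by
    [hom_mx_jet]. *)
Definition hom_mx m p (N : charted R m) (N' : charted R p) (c : chart N) (d : chart N')
    (j : HomB N N') : 'M[R]_(m, p) :=
  trans c (chart_at (src j)) (src j) *m lin j *m trans (chart_at (tgt j)) d (tgt j).

Lemma phi_HomB m p (N : charted R m) (N' : charted R p) (c : chart N) (d : chart N') (j : HomB N N') :
  phi (N := HomB N N') (c, d) j = row_mx (row_mx (phi c (src j)) (phi d (tgt j))) (mxvec (hom_mx c d j)).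
Proof. by []. Qed.

Section HomFacts.
Variables (m p : nat) (N : charted R m) (N' : charted R p) (aN : atlas N) (aN' : atlas N').

Lemma hom_eq (c : chart N) (d : chart N') (j k : HomB N N') : dom c (src j) -> dom d (tgt j) ->
  src j = src k -> tgt j = tgt k -> hom_mx c d j = hom_mx c d k -> j = k.
Proof.
case: j k => x y A [x' y' B] /= cx dy <- <-; rewrite /hom_mx /= => E; congr Hom.
have px := domx aN x; have py := domx aN' y.
have H (C : 'M[R]_(m, p)) : trans (chart_at x) c x *m (trans c (chart_at x) x *m C *m trans (chart_at y) d y) *m
  trans d (chart_at y) y = C.
  rewrite (conj_mx _ (trans_comp aN px cx px) (trans_comp aN' py dy py)).
  by rewrite (trans_id aN px) (trans_id aN' py) mul1mx mulmx1.
by refine (etrans (esym (H A)) (etrans (congr1 (fun X => _ *m X *m _) E) (H B))).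
Qed.

Lemma hom_mx_chart_at (j : HomB N N') : hom_mx (chart_at (src j)) (chart_at (tgt j)) j = lin j.
Proof. by rewrite /hom_mx (trans_id aN (domx aN _)) (trans_id aN' (domx aN' _)) mul1mx mulmx1. Qed.

Lemma hom_mx_jet (b : N -> N') x (c : chart N) (d : chart N') : smap b x -> dom c x -> dom d (b x) ->
  hom_mx c d (jet b x) = tmx c d b x.
Proof. by move=> sb cx dx; rewrite (tanmxE aN aN' sb cx dx). Qed.

Lemma src_smap_in (c : chart N) (d : chart N') (j : HomB N N') : dom c (src j) -> dom d (tgt j) ->
  smap (@src _ _ _ N N' : HomB N N' -> N) j /\
  \forall u \near phi (N := HomB N N') (c, d) j, lsubmx (lsubmx u) = loc (N := HomB N N') (c, d) c (@src _ _ _ N N') u.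
Proof.
move=> cx dx; have aH := atlas_HomB aN aN'.
have cdx : dom (N := HomB N N') (c, d) j by split.
have E : \forall u \near phi (N := HomB N N') (c, d) j, lsubmx (lsubmx u) = loc (N := HomB N N') (c,
  d) c (@src _ _ _ N N') u.
  by apply: filterS (atlas_near aH cdx cdx) => u [_ _ Eu]; rewrite /loc -{1}Eu phi_HomB !row_mxKl.
split; last exact: E.
apply: (smapI aH aN _ cdx cx); split.
  by apply: mnearS (dom_near aH cdx) => z [].
by apply: smooth_near E _; apply/smooth_lsub/smooth_lsub; exact: smooth_id.
Qed.

Lemma tgt_smap_in (c : chart N) (d : chart N') (j : HomB N N') : dom c (src j) -> dom d (tgt j) ->
  smap (@tgt _ _ _ N N' : HomB N N' -> N') j /\
  \forall u \near phi (N := HomB N N') (c, d) j, rsubmx (lsubmx u) = loc (N := HomB N N') (c, d) d (@tgt _ _ _ N N') u.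
Proof.
move=> cx dx; have aH := atlas_HomB aN aN'.
have cdx : dom (N := HomB N N') (c, d) j by split.
have E : \forall u \near phi (N := HomB N N') (c, d) j, rsubmx (lsubmx u) = loc (N := HomB N N') (c,
  d) d (@tgt _ _ _ N N') u.
  by apply: filterS (atlas_near aH cdx cdx) => u [_ _ Eu]; rewrite /loc -{1}Eu phi_HomB row_mxKl row_mxKr.
split; last exact: E.
apply: (smapI aH aN' _ cdx dx); split.
  by apply: mnearS (dom_near aH cdx) => z [].
by apply: smooth_near E _; apply/smooth_rsub/smooth_lsub; exact: smooth_id.
Qed.

(** In coordinates the source is a linear block projection, hence equal to its own derivative. *)
Lemma tmx_src k (c : chart N) (d : chart N') (j : HomB N N') (A : 'M[R]_(k, _)) : dom c (src j) -> dom d (tgt j) ->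
  A *m tmx (N := HomB N N') (c, d) c (@src _ _ _ N N') j = lsubmx (lsubmx A).
Proof.
move=> cx dx; have [_ E] := src_smap_in cx dx.
have s : smooth (fun u : 'rV[R]_(m + p + m * p) => lsubmx (lsubmx u)) (phi (N := HomB N N') (c, d) j).
  by apply/smooth_lsub/smooth_lsub; exact: smooth_id.
rewrite /tmx -(J_near s E).
have D : der (fun u : 'rV[R]_(m + p + m * p) => lsubmx (lsubmx u)) (phi (N := HomB N N') (c,
  d) j) (fun u => lsubmx (lsubmx u)).
  by apply: (linear_mx_der (@lin_lsub _ _ _ _)); apply: (linear_mx_der (@lin_lsub _ _ _ _)); exact: der_id.
apply/row_matrixP => i; rewrite row_mul (J_mul _ D).
by apply/rowP => l; rewrite !mxE.
Qed.

Lemma tmx_tgt k (c : chart N) (d : chart N') (j : HomB N N') (A : 'M[R]_(k, _)) : dom c (src j) -> dom d (tgt j) ->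
  A *m tmx (N := HomB N N') (c, d) d (@tgt _ _ _ N N') j = rsubmx (lsubmx A).
Proof.
move=> cx dx; have [_ E] := tgt_smap_in cx dx.
have s : smooth (fun u : 'rV[R]_(m + p + m * p) => rsubmx (lsubmx u)) (phi (N := HomB N N') (c, d) j).
  by apply/smooth_rsub/smooth_lsub; exact: smooth_id.
rewrite /tmx -(J_near s E).
have D : der (fun u : 'rV[R]_(m + p + m * p) => rsubmx (lsubmx u)) (phi (N := HomB N N') (c,
  d) j) (fun u => rsubmx (lsubmx u)).
  by apply: (linear_mx_der (@lin_rsub _ _ _ _)); apply: (linear_mx_der (@lin_lsub _ _ _ _)); exact: der_id.
apply/row_matrixP => i; rewrite row_mul (J_mul _ D).
by apply/rowP => l; rewrite !mxE.
Qed.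
End HomFacts.

Section Sec.
Variables (m p : nat) (N : charted R m) (N' : charted R p) (aN : atlas N) (aN' : atlas N').

Definition csection (c : chart N) (C : chart N') (V : 'rV[R]_m -> 'rV[R]_p) (x : N) : N' := inv C (V (phi c x)).

Lemma csection_smap (c : chart N) (C : chart N') V x : dom c x -> cimage C (V (phi c x)) -> smooth V (phi c x) ->
  [/\ smap (csection c C V) x, tmx c C (csection c C V) x = 'J V (phi c x) &
      \forall u \near phi c x, V u = loc c C (csection c C V) u].
Proof.
move=> cx gC sV.
have gn : \forall u \near phi c x, cimage C (V u).
  exact: (cont_near (smooth_cont sV) (cimage_near aN' gC)).
have E : \forall u \near phi c x, V u = loc c C (csection c C V) u.
  by apply: filterS2 gn (atlas_near aN cx cx) => u [gu Eu] [_ _ E]; rewrite /loc /csection E Eu.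
have S : smap_in c C (csection c C V) x.
  split; last exact: smooth_near E sV.
  apply/(mnearP aN _ cx).
  by apply: filterS2 gn (atlas_near aN cx cx) => u [gu Eu] [_ _ E']; rewrite /csection E'.
split; last exact: E.
  exact: (smapI aN aN' S cx gC.1).
by rewrite /tmx (J_near sV E).
Qed.
End Sec.

(** By the Leibniz formula the determinant is a finite sum of products of entries, which even has a
    differential. *)
Lemma det_cont m : continuous (fun A : 'M[R]_m => \det A).
Proof.
move=> A.
have coord i j : exists D, der (fun B : 'M[R]_m => B i j) A D.
  by exists (fun B : 'M[R]_m => B i j); have /der_mxP := der_id A; apply.
have prod (r : seq 'I_m) (s : 'S_m) : exists D, der (fun B : 'M[R]_m => \prod_(i <- r) B i (s i)) A D.
  elim: r => [|i r [D hD]].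
    exists (fun=> 0); apply: (der_near (der_cst (1:R) A)).
    by apply: filterE => B; rewrite big_nil.
  have [E hE] := coord i (s i); have hM := derM hE hD; eexists; apply: (der_near hM).
  by apply: filterE => B; rewrite big_cons.
have {}prod (s : 'S_m) : exists D, der (fun B : 'M[R]_m => (-1) ^+ s * \prod_i B i (s i)) A D.
  have [D hD] := prod (index_enum 'I_m) s.
  have hM := derM (der_cst ((-1) ^+ s : R) A) hD.
  eexists; exact: hM.
have [D hD] : exists D, der (fun B : 'M[R]_m => \det B) A D.
  have [D hD] := choice prod.
  have hM := der_sum (index_enum {perm 'I_m}) hD.
  eexists; exact: hM.
exact: der_cont hD.
Qed.

Lemma unitmx_near m n (F : 'rV[R]_n -> 'M[R]_m) u : {for u, continuous F} -> F u \in unitmx ->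
  \forall z \near u, F z \in unitmx.
Proof.
move=> cF; rewrite unitmxE unitfE => hF.
have h : \forall d \near \det (F u), d != 0 by apply: (near_in (U := [set x : R | x != 0])) => //; exact: open_neq.
have c : {for u, continuous (fun z => \det (F z))}.
  by apply: (@continuous_comp _ _ _ F (fun A : 'M[R]_m => \det A)) => //; exact: det_cont.
by apply: filterS (cont_near c h) => z; rewrite unitmxE unitfE.
Qed.

End Sections.

(** * Bisections and their jets *)
Section Bis.
Context {R : realType} {n : nat} (M : charted R n) (aM : atlas M).

Lemma smooth_affine m p (y0 : 'rV[R]_p) (u0 : 'rV[R]_m) (T : 'M[R]_(m, p)) u :
  smooth (fun u => y0 + (u - u0) *m T) u.
Proof.
apply: smooth_add; first exact: smooth_cst.
apply: smooth_mul; last exact: smooth_cst.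
by apply: smooth_add; [exact: smooth_id|exact: smooth_cst].
Qed.

Lemma J_affine m p (y0 : 'rV[R]_p) (u0 : 'rV[R]_m) (T : 'M[R]_(m, p)) u :
  'J (fun u => y0 + (u - u0) *m T) u = T.
Proof.
have D := derD (der_cst y0 u) (der_mul (derD (der_id u) (der_cst (- u0) u)) (der_cst T u)).
by apply: (J_uniq D) => v /=; rewrite addr0 mulmx0 addr0 add0r.
Qed.

Section Gen.
Variables (m : nat) (N : charted R m) (aN : atlas N) (G : set N) (al be : N -> M).

Lemma rep_spec j : jets G al be j -> represents G al be (rep G al be j) j.
Proof. exact: epsilon_spec. Qed.

Lemma bis_smap (b : lsec M N) x : bisection G al be b -> ldom b x -> smap b x.
Proof. by case=> /(smooth_onP aM aN) [_ h] _ _ _; exact: h. Qed.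

Lemma bis_near (b : lsec M N) x : bisection G al be b -> ldom b x -> mnear x (ldom b).
Proof. by case=> -[oU _] _ _ _; exact: mopen_near. Qed.

Lemma bis_be (b : lsec M N) x : bisection G al be b -> ldom b x -> smap (be \o b) x.
Proof. by case=> _ _ /(smooth_onP aM aM) [_ h] _; exact: h. Qed.

Lemma bis_inv (b : lsec M N) x : bisection G al be b -> ldom b x ->
  exists g, [/\ smap g (be (b x)),
     mnear (be (b x)) (fun y => exists2 x', ldom b x' & be (b x') = y) &
     forall x', ldom b x' -> g (be (b x')) = x'].
Proof.
case=> _ _ _ [g [sg gb]] Ux; exists g.
have [oV h] := (smooth_onP aM aM _ _).1 sg.
have Vx : ((be \o b) @` ldom b) (be (b x)) by exists x.
split => //; first exact: h.
by apply: mnearS (mopen_near aM oV Vx) => y [x' Ux' E]; exists x'.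
Qed.

Lemma represents_hom_mx (b : lsec M N) j (c : chart M) (d : chart N) : represents G al be b j ->
  dom c (src j) -> dom d (tgt j) -> hom_mx c d j = tmx c d b (src j).
Proof.
case=> hb Ux Ej cx dx.
rewrite Ej in dx *; exact: (hom_mx_jet aM aN (bis_smap hb Ux) cx dx).
Qed.

(** The tool for building bisections with a prescribed 1-jet: for a base map that is affine in
    charts with invertible linear part, the smooth inverse demanded by [bisection] is an explicit
    affine map, which also shows that the image is open. *)
Lemma affine_bisection (b : M -> N) (U : set M) (c d : chart M) (y0 u0 : 'rV[R]_n) (eta : 'M[R]_n) :
  mopen U -> eta \in unitmx ->
  (forall x, U x -> [/\ dom c x, smap b x, G (b x), al (b x) = x &
     dom d (be (b x)) /\ phi d (be (b x)) = y0 + (phi c x - u0) *m eta]) ->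
  bisection G al be (Lsec U b).
Proof.
move=> oU ue h.
have smb0 x : U x -> smap (be \o b) x.
  move=> Ux; have [cx sb _ _ [dx _]] := h x Ux.
  have nU := mopen_near aM oU Ux.
  apply: (smapI aM aM (c := c) (d := d)) => //; split.
    by apply: mnearS nU => z /h[_ _ _ _ []].
  apply: smooth_near (smooth_affine y0 u0 eta _).
  by apply: filterS (mnear_chart aM cx nU) => u [_ /h[_ _ _ _ [_ E]] Eu]; rewrite /loc /comp E Eu.
have back (w : 'rV[R]_n) (x : M) : w = y0 + (phi c x - u0) *m eta -> u0 + (w - y0) *m invmx eta = phi c x.
  by move=> ->; rewrite [y0 + _]addrC addrK mulmxK // addrC subrK.
split.
- by apply/(smooth_onP aM aN); split=> // x /h[].
- by move=> x /= /h[].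
- by apply/(smooth_onP aM aM); split.
exists (csection d c (fun w => u0 + (w - y0) *m invmx eta)); split; last first.
  move=> x Ux; have [cx _ _ _ [dx E]] := h x Ux.
  by rewrite /csection (back _ _ E) phiK.
apply/(smooth_onP aM aM); split.
  apply/(mopenP aM) => _ [x Ux <-] /=; have [cx sb _ _ [dx E]] := h x Ux.
  apply/(mnearP aM _ dx).
  have hx : \forall u \near phi c x, [/\ dom c (inv c u), U (inv c u) & phi c (inv c u) = u].
    exact: mnear_chart (mopen_near aM oU Ux).
  have ca : {for phi d (be (b x)), continuous (fun w : 'rV[R]_n => u0 + (w - y0) *m invmx eta)}.
    exact: smooth_cont (smooth_affine _ _ _ _).
  have := cont_near ca; rewrite (back _ _ E) => /(_ _ hx).
  apply: filterS2 (atlas_near aM dx dx) => w [dw _ Ew] [cu Uu Eu].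
  exists (inv c (u0 + (w - y0) *m invmx eta)) => //=.
  have [_ _ _ _ [dx' E']] := h _ Uu.
  rewrite -(phiK aM dx') E' Eu; congr (inv d _).
  by rewrite [u0 + _]addrC addrK mulmxKV // addrC subrK.
move=> _ [x Ux <-] /=; have [cx sb _ _ [dx E]] := h x Ux.
have [|S _ _] := csection_smap aM aM dx _ (smooth_affine u0 y0 (invmx eta) _) (C := c); last exact: S.
by rewrite (back _ _ E); exact: cimage_phi.
Qed.

End Gen.

Section HomInv.
Variables (m p : nat) (N : charted R m) (N' : charted R p) (aN : atlas N) (aN' : atlas N').

Lemma inv_HomB (c : chart N) (d : chart N') u v (A : 'M[R]_(m, p)) :
  inv (N := HomB N N') (c, d) (row_mx (row_mx u v) (mxvec A)) =
  Hom (inv c u) (inv d v) (trans (chart_at (inv c u)) c (inv c u) *m A *m trans d (chart_at (inv d v)) (inv d v)).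
Proof. by rewrite /= !row_mxKl !row_mxKr mxvecK. Qed.

Lemma hom_mx_inv (c : chart N) (d : chart N') u v (A : 'M[R]_(m, p)) : cimage c u -> cimage d v ->
  hom_mx c d (inv (N := HomB N N') (c, d) (row_mx (row_mx u v) (mxvec A))) = A.
Proof.
move=> [cu Eu] [dv Ev]; rewrite inv_HomB /hom_mx /src /tgt /lin.
have pu := domx aN (inv c u); have pv := domx aN' (inv d v).
rewrite (conj_mx _ (trans_comp aN cu pu cu) (trans_comp aN' dv pv dv)).
by rewrite (trans_id aN cu) (trans_id aN' dv) mul1mx mulmx1.
Qed.
End HomInv.

Lemma unitmx_conj m (A B C : 'M[R]_m) : A \in unitmx -> C \in unitmx ->
  (A *m B *m C \in unitmx) = (B \in unitmx).
Proof. by move=> uA uC; rewrite !unitmx_mul uA uC andbT. Qed.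

Lemma trans_unit m (N : charted R m) (aN : atlas N) (c d : chart N) x : dom c x -> dom d x ->
  trans c d x \in unitmx.
Proof. move=> cx dx; exact: (mulmx1_unit (transK aN cx dx)).1. Qed.

Lemma hom_mx_unit (c d : chart M) (j : H1 M) : dom c (src j) -> dom d (tgt j) ->
  (hom_mx c d j \in unitmx) = (lin j \in unitmx).
Proof.
move=> cx dy; have px := domx aM (src j); have py := domx aM (tgt j).
exact: unitmx_conj (trans_unit aM cx px) (trans_unit aM py dy).
Qed.

Notation srcf := (@src _ _ _ _ _).

Lemma atlas_H1 : atlas (H1 M). Proof. exact: atlas_HomB. Qed.
Lemma atlas_H2 : atlas (H2 M). Proof. exact: (atlas_HomB aM atlas_H1). Qed.
Definition H1_coord (u y : 'rV[R]_n) (Xi : 'M[R]_n) : 'rV[R]_(n + n + n * n) :=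
  row_mx (row_mx u y) (mxvec Xi).
(* The jet of b at x has linear part (1, E, B): E is the block of b^0_* and B that
   of the derivative of the matrices b(x). *)
Definition H2_coord (u : 'rV[R]_n) (w : 'rV[R]_(n + n + n * n)) (E : 'M[R]_n) (B : 'M[R]_(n, n * n)) :
   'rV[R]_(n + (n + n + n * n) + n * (n + n + n * n)) :=
  row_mx (row_mx u w) (mxvec (row_mx (row_mx 1%:M E) B)).

Lemma smooth_H1_coord (Y : 'rV[R]_n -> 'rV[R]_n) (Xi : 'rV[R]_n -> 'M[R]_n) u :
  smooth Y u -> smooth Xi u -> smooth (fun u => H1_coord u (Y u) (Xi u)) u.
Proof.
move=> sY sX; apply: smooth_row; last exact: smooth_mxvec.
by apply: smooth_row => //; exact: smooth_id.
Qed.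

Lemma smooth_H2_coord W (E : 'rV[R]_n -> 'M[R]_n) B u :
  smooth W u -> smooth E u -> smooth B u -> smooth (fun u => H2_coord u (W u) (E u) (B u)) u.
Proof.
move=> sW sE sB; apply: smooth_row; last first.
  apply/smooth_mxvec/smooth_row => //; apply: smooth_row => //; exact: smooth_cst.
by apply: smooth_row => //; exact: smooth_id.
Qed.

Lemma mopen_near_chart (c : chart M) (P : 'rV[R]_n -> Prop) :
  (forall u, P u -> \forall z \near u, P z) -> mopen (fun x => dom c x /\ P (phi c x)).
Proof.
move=> h; have oP : open (P : set 'rV[R]_n) by rewrite openE => u Pu; exact: h.
exact: (mopen_pull aM oP).
Qed.

Section H1sec.
Variables (c d : chart M) (y0 u0 : 'rV[R]_n) (eta : 'M[R]_n) (Xi : 'rV[R]_n -> 'M[R]_n).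
Hypothesis sXi : forall u, smooth Xi u.
Hypothesis ueta : eta \in unitmx.
Let Y u := y0 + (u - u0) *m eta.

(** The domain is cut down to where the affine base map lands in the image of d and [Xi] stays
    invertible, so that every value belongs to [B1]. *)
Definition h1sec : lsec M (H1 M) :=
  Lsec (fun x => dom c x /\ (cimage d (Y (phi c x)) /\ Xi (phi c x) \in unitmx))
    (csection (N' := H1 M) c (c, d) (fun u => H1_coord u (Y u) (Xi u))).

Lemma h1sec_good x : ldom h1sec x -> cimage (N := H1 M) (c, d) (H1_coord (phi c x) (Y (phi c x)) (Xi (phi c x))).
Proof. by case=> cx [gy _]; apply: cimage_HomB => //; exact: cimage_phi. Qed.

Lemma h1secE x : ldom h1sec x -> [/\ src (h1sec x) = x, tgt (h1sec x) = inv d (Y (phi c x)) &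
  hom_mx c d (h1sec x) = Xi (phi c x)].
Proof.
case=> cx [gy ux]; rewrite -[lfun h1sec x]/(inv (N := HomB M M) (c,
  d) (H1_coord (phi c x) (Y (phi c x)) (Xi (phi c x)))) /H1_coord.
split; [by rewrite inv_HomB /= phiK|by rewrite inv_HomB|].
by rewrite (hom_mx_inv aM aM) //; exact: cimage_phi.
Qed.

Lemma h1sec_bisection : bisection (B1 M) srcf (@beta1 _ _ M) h1sec.
Proof.
have oU : mopen (ldom h1sec).
  apply: (@mopen_near_chart c (fun u => cimage d (Y u) /\ Xi u \in unitmx)) => u [gy ux].
  have sY : smooth Y u by exact: smooth_affine.
  apply: filterI; first exact: (cont_near (smooth_cont sY) (cimage_near aM gy)).
  exact: unitmx_near (smooth_cont (sXi u)) ux.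
apply: (affine_bisection (y0 := y0) (u0 := u0) (c := c) (d := d) atlas_H1 oU ueta).
move=> x Ux; have [cx [gy ux]] := Ux; have [E1 E2 E3] := h1secE Ux.
have gd : dom d (beta1 (h1sec x)) by rewrite /beta1 E2; exact: gy.1.
split => //.
- have [] := csection_smap aM atlas_H1 cx (h1sec_good Ux) (smooth_H1_coord (smooth_affine y0 u0 eta _) (sXi _)).
  by [].
- have cx' : dom c (src (h1sec x)) by rewrite E1.
  have := hom_mx_unit cx' gd; rewrite E3 ux => U; exact: (esym U).
- by split; [exact: gd|rewrite /beta1 E2 gy.2].
Qed.
End H1sec.

End Bis.

Section Bis2.
Context {R : realType} {n : nat} (M : charted R n) (aM : atlas M).
Notation srcf := (@src _ _ _ _ _).
Let aH1 := atlas_H1 aM.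

Lemma H1_coord_affine (u0 y0 u : 'rV[R]_n) (Xi0 eta : 'M[R]_n) (B : 'M[R]_(n, n * n)) :
  H1_coord u0 y0 Xi0 + (u - u0) *m row_mx (row_mx 1%:M eta) B =
  H1_coord u (y0 + (u - u0) *m eta) (Xi0 + vec_mx ((u - u0) *m B)).
Proof.
by rewrite /H1_coord !mul_mx_row mulmx1 !add_row_mx linearD /= vec_mxK [u0 + _]addrC subrK.
Qed.

Lemma smooth_affine_vec m (Xi0 : 'M[R]_n) (u0 : 'rV[R]_m) (B : 'M[R]_(m, n * n)) u :
  smooth (fun u => Xi0 + vec_mx ((u - u0) *m B)) u.
Proof.
apply: smooth_add; first exact: smooth_cst.
apply: smooth_vec; apply: smooth_mul; last exact: smooth_cst.
by apply: smooth_add; [exact: smooth_id|exact: smooth_cst].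
Qed.

(** Every linear part (1, eta, B) with eta invertible occurs: the section whose coordinates are
    affine with exactly this linear part represents j. *)
Lemma B11nh_intro (c d : chart M) (j : H2 M) (eta : 'M[R]_n) (B : 'M[R]_(n, n * n)) :
  dom c (src j) -> dom d (tgt (tgt j)) -> src (tgt j) = src j -> B1 M (tgt j) -> eta \in unitmx ->
  hom_mx (N' := H1 M) c (c, d) j = row_mx (row_mx 1%:M eta) B -> B11nh j.
Proof.
move=> cx dy Es ux ue EJ.
set x := src j in cx Es *; set y := tgt (tgt j) in dy *; set xi := tgt j in Es ux *.
pose Xi0 := hom_mx c d xi; pose u0 := phi c x; pose y0 := phi d y.
pose b := h1sec c d y0 u0 eta (fun u => Xi0 + vec_mx ((u - u0) *m B)).
have cs : dom c (src xi) by rewrite Es.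
have uXi : Xi0 \in unitmx.
  by have := hom_mx_unit aM cs dy; rewrite -/Xi0 => ->; exact: ux.
have y0E : y0 + (u0 - u0) *m eta = y0 by rewrite subrr mul0mx addr0.
have Xi0E : Xi0 + vec_mx ((u0 - u0) *m B) = Xi0 by rewrite subrr mul0mx linear0 addr0.
have Ux : ldom b x.
  by rewrite /b /= -/u0 Xi0E y0E; split=> //; split=> //; exact: cimage_phi.
have bb : bisection (B1 M) srcf (@beta1 _ _ M) b.
  by apply: h1sec_bisection => // u; exact: smooth_affine_vec.
exists b; split => //.
have [E1 E2 E3] := h1secE aM Ux.
have Etgt : xi = b x.
  apply: (hom_eq aM aM cs dy); first by rewrite Es E1.
    by rewrite E2 -/u0 y0E phiK.
  by rewrite E3 -/u0 Xi0E.
have bx := bis_smap aM aH1 bb Ux.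
have cd' : dom (N := H1 M) (c, d) (b x) by rewrite -Etgt; split.
have cd'' : dom (N := H1 M) (c, d) (tgt j) by split.
refine (hom_eq (N' := H1 M) (d := (c, d)) (k := jet b x) aM aH1 cx cd'' erefl Etgt _).
rewrite (hom_mx_jet aM aH1 bx cx cd') EJ.
have good := h1sec_good aM Ux.
have sV : smooth (fun u => H1_coord u (y0 + (u - u0) *m eta) (Xi0 + vec_mx ((u - u0) *m B))) (phi c x).
  by apply: smooth_H1_coord; [exact: smooth_affine|exact: smooth_affine_vec].
have [_ -> _] := csection_smap aM aH1 cx good sV.
apply/esym; rewrite -[RHS](J_affine (H1_coord u0 y0 Xi0) u0 _ (phi c x)).
congr ('J _ _); apply/funext => u; by rewrite H1_coord_affine.
Qed.

(** Conversely, the leading block is 1 because the source of b(z) is z, and the second block is the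
    derivative of the base map, invertible because the base map has a smooth left inverse. *)
Lemma B11nh_elim (c d : chart M) (j : H2 M) : B11nh j -> dom c (src j) -> dom d (tgt (tgt j)) ->
  [/\ src (tgt j) = src j, B1 M (tgt j) & exists eta B, eta \in unitmx /\
   hom_mx (N' := H1 M) c (c, d) j = row_mx (row_mx 1%:M eta) B].
Proof.
case=> b hb cx dy.
have [bb Ux Ej] := hb.
have Et : tgt j = b (src j) by rewrite Ej.
have [_ /(_ _ Ux) [Gx sx] _ _] := bb.
have cs : dom c (src (tgt j)) by rewrite Et sx.
have cdx : dom (N := H1 M) (c, d) (tgt j) by split.
have EJ := represents_hom_mx aM aH1 (d := (c, d) : chart (H1 M)) hb cx cdx.
have sb := bis_smap aM aH1 bb Ux.
split; [by rewrite Et|by rewrite Et|].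
set J := hom_mx c _ j in EJ *.
have cdx' : dom (N := H1 M) (c, d) (b (src j)) by rewrite -Et.
have cs' : dom c (src (b (src j))) by rewrite -Et.
have dy' : dom d (tgt (b (src j))) by rewrite -Et.
have [ssrc _] := src_smap_in aM aM cs' dy'.
have [stgt _] := tgt_smap_in aM aM cs' dy'.
have T1 : tmx c c (@src _ _ _ M M \o b) (src j) = lsubmx (lsubmx J).
  by rewrite (tmx_comp aM aH1 aM sb ssrc cx cdx' cs') -EJ (tmx_src aM aM).
have T2 : tmx c d (@tgt _ _ _ M M \o b) (src j) = rsubmx (lsubmx J).
  by rewrite (tmx_comp aM aH1 aM sb stgt cx cdx' dy') -EJ (tmx_tgt aM aM).
have T1' : lsubmx (lsubmx J) = 1%:M.
  rewrite -T1; have nU := bis_near aM bb Ux.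
  have h : mnear (src j) (fun z => z = (@src _ _ _ M M \o b) z).
    apply: mnearS nU => z Uz; have [_ /(_ _ Uz) [_ E] _ _] := bb; by rewrite /= E.
  rewrite -(tmx_ext aM aM h (smap_id aM _) cx cx).
  exact: (trans_id aM cx).
exists (rsubmx (lsubmx J)), (rsubmx J); split; last by rewrite -T1' !hsubmxK.
rewrite -T2; have [g [sg gn gb]] := bis_inv aM bb Ux.
have sb0 : smap (@tgt _ _ _ M M \o b) (src j) by exact: bis_be bb Ux.
have gx : g (beta1 (b (src j))) = src j by exact: gb.
have cg : dom c (g ((@tgt _ _ _ M M \o b) (src j))) by rewrite -[_ (src j)]/(beta1 (b (src j))) gx.
have E := tmx_comp aM aM aM sb0 sg cx dy' cg.
have h : mnear (src j) (fun z => z = (g \o (@tgt _ _ _ M M \o b)) z).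
  by apply: mnearS (bis_near aM bb Ux) => z Uz; exact: (esym (gb z Uz)).
have E2 := tmx_ext aM aM h (smap_id aM _) cx cx.
have E3 : tmx c c id (src j) = 1%:M by exact: (trans_id aM cx).
have E4 : tmx c d (@tgt _ _ _ M M \o b) (src j) *m tmx d c g (tgt (b (src j))) = 1%:M.
  exact: (etrans (esym E) (etrans (esym E2) E3)).
exact: (mulmx1_unit E4).1.
Qed.

(** [p2_star] is computed on the chosen representative, but its matrix is the block of the linear
    part of j that differentiates the target, so it depends on j alone. *)
Lemma p2_star_coord (c d : chart M) (j : H2 M) : B11nh j -> dom c (src j) -> dom d (tgt (tgt j)) ->
  [/\ src (p2_star j) = src j, tgt (p2_star j) = tgt (tgt j) &
   hom_mx c d (p2_star j) = rsubmx (lsubmx (hom_mx (N' := H1 M) c (c, d) j))].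
Proof.
move=> hj cx dy; have hb := rep_spec hj; have [bb Ux Ej] := hb.
have [Es _ _] := B11nh_elim hj cx dy.
rewrite /p2_star /rep2; set b := rep _ _ _ _ in hb bb Ux Ej *.
have Et : tgt j = b (src j) by rewrite Ej.
have cs : dom c (src (b (src j))) by rewrite -Et Es.
have dy' : dom d (tgt (b (src j))) by rewrite -Et.
have cdx : dom (N := H1 M) (c, d) (tgt j) by rewrite Et; split.
have cdx' : dom (N := H1 M) (c, d) (b (src j)) by split.
have sb := bis_smap aM aH1 bb Ux.
have [stgt _] := tgt_smap_in aM aM cs dy'.
split; [by []|by rewrite /= Et|].
rewrite (represents_hom_mx aM aH1 (d := (c, d) : chart (H1 M)) hb cx cdx).
have sb0 : smap (@tgt _ _ _ M M \o b) (src j) by exact: bis_be bb Ux.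
rewrite (hom_mx_jet aM aM sb0 cx dy').
by rewrite (tmx_comp aM aH1 aM sb stgt cx cdx' dy') (tmx_tgt aM aM).
Qed.

Lemma B11shP (c d : chart M) (j : H2 M) : B11nh j -> dom c (src j) -> dom d (tgt (tgt j)) ->
  B11sh j <-> hom_mx c d (tgt j) = rsubmx (lsubmx (hom_mx (N' := H1 M) c (c, d) j)).
Proof.
move=> hj cx dy; have [Es _ _] := B11nh_elim hj cx dy.
have [E1 E2 <-] := p2_star_coord hj cx dy.
split=> [[_ <-//]|E]; split; first exact: hj.
have cs : dom c (src (tgt j)) by rewrite Es.
by apply: (hom_eq aM aM cs dy); rewrite ?E1 ?E2.
Qed.

End Bis2.

(** * The connection in coordinates *)
(* 'D_v F u with the types of its arguments fixed, so that products inside it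
   elaborate with the same ring structure as elsewhere *)
Definition ddir {R : realType} m p q (F : 'rV[R]_m -> 'M[R]_(p, q)) (u v : 'rV[R]_m) :
  'M[R]_(p, q) := 'D_v F u.

Section Nabla.
Context {R : realType} {n : nat} (M : charted R n) (aM : atlas M).
Notation srcf := (@src _ _ _ _ _).
Let aH1 := atlas_H1 aM.
Let aH2 := atlas_H2 aM.

Section Push.
Variables (b : lsec M (H1 M)) (x : M).
Hypothesis bb : bisection (B1 M) srcf (@beta1 _ _ M) b.
Hypothesis Ux : ldom b x.
Variables (c d : chart M) (Y : M -> 'rV[R]_n).
Hypothesis cx : dom c x.
Hypothesis dy : dom d (tgt (b x)).

(** The base map of a bisection is injective, so [epsilon] can only return x'. *)
Lemma push_at x' : ldom b x' -> push b Y (tgt (b x')) = Y x' *m lin (b x').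
Proof.
move=> Ux'; rewrite /push.
have [g [_ _ gb]] := bis_inv aM bb Ux'.
have := epsilon_spec (inhabits (tgt (b x'))) (fun x => ldom b x /\ beta1 (b x) = tgt (b x')).
set e := epsilon _ _ => /(_ (ex_intro _ x' (conj Ux' erefl))) [Ue Ee].
suff -> : e = x' by [].
by rewrite -(gb _ Ue) -(gb _ Ux') Ee.
Qed.

Let bh u := hom_mx c d (b (inv c u)).

Lemma cancel_mx m1 m2 m3 m4 m5 (v : 'M[R]_(m1, m2)) (T1 : 'M_(m2, m3)) (T2 : 'M_(m3, m2)) (A : 'M_(m2,
  m4)) (T3 : 'M_(m4, m5)) :
  T1 *m T2 = 1%:M -> v *m T1 *m (T2 *m A *m T3) = v *m A *m T3.
Proof. by move=> E; rewrite !mulmxA -[v *m T1 *m T2]mulmxA E mulmx1. Qed.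

Lemma push_coord x' : ldom b x' -> dom c x' -> dom d (tgt (b x')) ->
  vf_comp d (push b Y) (phi d (tgt (b x'))) = vf_comp c Y (phi c x') *m bh (phi c x').
Proof.
move=> Ux' cx' dy'; rewrite (vf_comp_at aM _ dy') (vf_comp_at aM _ cx') push_at // /bh phiK // /hom_mx.
have [_ /(_ _ Ux') [_ Es] _ _] := bb; rewrite Es.
have px := domx aM x'.
exact: esym (cancel_mx _ _ _ (transK aM px cx')).
Qed.

Let cs : dom c (src (b x)). Proof. by have [_ /(_ _ Ux) [_ ->] _ _] := bb. Qed.
Let cdx : dom (N := H1 M) (c, d) (b x). Proof. by split. Qed.
Let sb : smap b x := bis_smap aM aH1 bb Ux.

Lemma loc_b u : loc (N' := H1 M) c (c, d) b u =
  row_mx (row_mx (phi c (src (b (inv c u)))) (phi d (tgt (b (inv c u))))) (mxvec (bh u)).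
Proof. by []. Qed.

Lemma smooth_bh : smooth bh (phi c x).
Proof.
have [_ s] := smap_in_charts (d := (c, d) : chart (H1 M)) aM aH1 sb cx cdx.
apply: (smooth_near _ (smooth_vec (smooth_rsub s))).
by apply: filterE => u; rewrite loc_b row_mxKr mxvecK.
Qed.

Lemma D_bh (v : 'rV[R]_n) : 'D_v bh (phi c x) = vec_mx (v *m rsubmx (tmx (N' := H1 M) c (c, d) b x)).
Proof.
have [_ s] := smap_in_charts (d := (c, d) : chart (H1 M)) aM aH1 sb cx cdx.
have D := linear_mx_der (@lin_vec _ _ _) (linear_mx_der (@lin_rsub _ _ _ _) (smooth_derJ s)).
have E : \forall u \near phi c x, vec_mx (rsubmx (loc (N' := H1 M) c (c, d) b u)) = bh u.
  by apply: filterE => u; rewrite loc_b row_mxKr mxvecK.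
rewrite (der_D v (der_near D E)); congr vec_mx.
by apply/rowP => k; rewrite !mxE; apply: eq_bigr => i _; rewrite !mxE.
Qed.

Let b0 := @tgt _ _ _ M M \o b.

Let sb0 : smap b0 x. Proof. exact: bis_be bb Ux. Qed.

Lemma push_near : \forall u \near phi c x,
  vf_comp d (push b Y) (loc c d b0 u) = vf_comp c Y u *m bh u.
Proof.
have [dn _] := smap_in_charts aM aM sb0 cx dy.
have h := mnear_chart aM cx (mnearI (bis_near aM bb Ux) dn).
apply: filterS h => u [cu [Uu du] E].
by rewrite -[in RHS]E -push_coord.
Qed.

Hypothesis sY : smooth (vf_comp c Y) (phi c x).

(** The field lives near the target while its formula lives near the source: the two are joined by
    the local inverse g of the base map. *)
Lemma push_smooth : smooth (vf_comp d (push b Y)) (phi d (tgt (b x))).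
Proof.
have [g [sg gn gb]] := bis_inv aM bb Ux.
have gx : g (tgt (b x)) = x by exact: gb.
have cg : dom c (g (tgt (b x))) by rewrite gx.
have [cn sgl] := smap_in_charts aM aM sg dy cg.
have Eg : loc d c g (phi d (tgt (b x))) = phi c x by rewrite /loc phiK // gx.
have sYb : smooth (fun u => vf_comp c Y u *m bh u) (loc d c g (phi d (tgt (b x)))).
  by rewrite Eg; exact: smooth_mul sY smooth_bh.
apply: (smooth_near _ (smooth_comp sgl sYb)).
have h := mnear_chart aM dy (mnearI gn cn).
apply: filterS h => w [dw [[x' Ux' Ex'] cw] Ew].
have E1 : g (inv d w) = x' by rewrite -Ex' gb.
have dyx : dom d (tgt (b x')) by move: dw; rewrite -Ex'.
have cx' : dom c x' by rewrite -E1.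
have E2 := push_coord Ux' cx' dyx.
have E3 : phi d (tgt (b x')) = w by exact: (etrans (congr1 (phi d) Ex') Ew).
have E4 : loc d c g w = phi c x' by rewrite /loc E1.
by rewrite E3 in E2; rewrite E4 E2.
Qed.

(** Differentiates [push_near] along v: chain rule through the base map on the left, product rule on
    the right. *)
Lemma push_D (v : 'rV[R]_n) :
  ddir (vf_comp d (push b Y)) (phi d (tgt (b x))) (v *m tmx c d b0 x) =
  ddir (vf_comp c Y) (phi c x) v *m hom_mx c d (b x) +
  vf_comp c Y (phi c x) *m vec_mx (v *m rsubmx (tmx (N' := H1 M) c (c, d) b x)).
Proof.
have [_ s0] := smap_in_charts aM aM sb0 cx dy.
have Eb : loc c d b0 (phi c x) = phi d (tgt (b x)) by rewrite /loc phiK.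
have sP : smooth (vf_comp d (push b Y)) (loc c d b0 (phi c x)) by rewrite Eb; exact: push_smooth.
have D1 := der_comp (smooth_derJ s0) (smooth_der sP).
have D2 := der_mul (smooth_der sY) (smooth_der smooth_bh).
have := der_uniq (der_near D1 push_near) D2 v.
by rewrite /ddir Eb D_bh {1}/bh phiK.
Qed.

End Push.

(** The vanishing of W at x kills both the term D_W X of the bracket and the second derivatives of
    the coordinate change, so the formula holds in any chart c. *)
Lemma lie_zero (X W : M -> 'rV[R]_n) x (c : chart M) : dom c x ->
  W x = 0 -> smooth (vf_comp c W) (phi c x) ->
  lie X W x *m trans (chart_at x) c x = ddir (vf_comp c W) (phi c x) (vf_comp c X (phi c x)).
Proof.
move=> cx W0 sW; have px := domx aM x; set p := chart_at x in px *.
have sWp : smooth (vf_comp p W) (phi p x).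
  exact: ((smap_vfield aM W px).1 ((smap_vfield aM W cx).2 sW)).
have Z : vf_comp p W (phi p x) = 0 by rewrite (vf_comp_at aM W px) W0 mul0mx.
have L : lie X W x = 'D_(vf_comp p X (phi p x)) (vf_comp p W) (phi p x)
  - 'D_(vf_comp p W (phi p x)) (vf_comp p X) (phi p x) by [].
rewrite L.
rewrite Z.
rewrite [X in _ - X]derive0.
rewrite subr0.
have tau : smooth (fun u => phi p (inv c u)) (phi c x) by exact: smooth_trans.
have sig : smooth (fun u => phi c (inv p u)) (phi p x) by exact: smooth_trans.
have Et : phi p (inv c (phi c x)) = phi p x by rewrite phiK.
have sWp' : smooth (vf_comp p W) (phi p (inv c (phi c x))) by rewrite Et.
have sig' : smooth (fun u => 'J (fun u => phi c (inv p u)) u) (phi p (inv c (phi c x))).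
  by rewrite Et; exact: smooth_J.
have E : \forall u \near phi c x, vf_comp p W (phi p (inv c u)) *m 'J (fun u =>
  phi c (inv p u)) (phi p (inv c u)) = vf_comp c W u.
  apply: filterS (atlas_near aM cx px) => u [cu pu Eu].
  by rewrite -[in RHS]Eu (vf_comp_change aM W pu cu).
have D1 := der_comp (smooth_derJ tau) (smooth_der sWp').
have D2 := der_comp (smooth_derJ tau) (smooth_der sig').
have DD := der_D (vf_comp c X (phi c x)) (der_near (der_mul D1 D2) E).
refine (etrans _ (esym DD)).
cbv beta; rewrite Et Z mul0mx addr0 (vf_comp_change aM X cx px).
exact: erefl.
Qed.

Lemma neg_conj m (T1 T2 : 'M[R]_m) : T1 *m T2 = 1%:M -> T1 *m (- 1%:M) *m T2 = - 1%:M.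
Proof. by move=> E; rewrite mulmxN mulmx1 mulNmx E. Qed.

Lemma half_vec (v y : 'rV[R]_n) (A : 'M[R]_(n, n * n)) :
  2^-1 *: (y *m vec_mx (- v *m A)) = y *m vec_mx (v *m (- 2^-1 *: A)).
Proof.
have -> : v *m (- 2^-1 *: A) = 2^-1 *: (- v *m A).
  by rewrite -scalemxAr scaleNr mulNmx scalerN.
by rewrite scalemxAr -linearZ.
Qed.

Variable s : M -> H2 M.
Hypothesis hs : symmetry_jet s.

(* In the chart c, nabla_v Y = D_v Y + Y * Gamma v; -1/2 is the factor of nabla
   times the linear part -1 of the base map of s_x. *)
Definition Gamma_mx (c : chart M) (u : 'rV[R]_n) : 'M[R]_(n, n * n) :=
  - 2^-1 *: rsubmx (hom_mx (N' := H1 M) c (c, c) (s (inv c u))).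

Definition Gamma c u v : 'M[R]_n := vec_mx (v *m Gamma_mx c u).

Lemma smooth_Gamma_mx c x : dom c x -> smooth (Gamma_mx c) (phi c x).
Proof.
move=> cx; have [hs1 /(_ x) [_ Es Ep]] := hs.
have [_ /(_ x I) sx] := (smooth_onP aM aH2 _ _).1 hs1.
have cd : dom (N := H2 M) (c, (c, c)) (s x).
  by rewrite /= Es -[tgt (s x)]/(p2 (s x)) Ep.
have [_ S] := smap_in_charts (d := (c, (c, c)) : chart (H2 M)) aM aH2 sx cx cd.
by apply: smooth_scale; apply: (smooth_near _ (smooth_rsub (smooth_vec (smooth_rsub S)))); apply: filterE => u;
  rewrite /loc phi_HomB row_mxKr mxvecK.
Qed.

(** The last equation comes from semi-holonomy: the base map of s_x has the same linear part -1 as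
    its value at x. *)
Lemma symmetry_jet_coord x c : dom c x -> let b := rep2 (s x) in
  [/\ represents (B1 M) srcf (@beta1 _ _ M) b (s x),
     b x = Hom x x (- 1%:M) & tmx c c (@tgt _ _ _ M M \o b) x = - 1%:M].
Proof.
move=> cx b; have [_ /(_ x) [[hj Esh] Es Ep]] := hs.
have hb : represents (B1 M) srcf (@beta1 _ _ M) b (s x) := rep_spec hj.
have [bb Ux Ej] := hb.
have Et : tgt (s x) = b x by rewrite Ej /= Es.
have Eb : b x = Hom x x (- 1%:M) by rewrite -Et -Ep.
split => //.
have Ux' : ldom b x by rewrite -Es.
have sb0 : smap (@tgt _ _ _ M M \o b) x by exact: bis_be bb Ux'.
have dy : dom c ((@tgt _ _ _ M M \o b) x) by rewrite /= Eb.
rewrite -(hom_mx_jet aM aM sb0 cx dy).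
have -> : jet (@tgt _ _ _ M M \o b) x = Hom x x (- 1%:M).
  refine (etrans _ (etrans (esym Esh) Ep)).
  have H y : src (s x) = y -> jet (@tgt _ _ _ M M \o b) y = p2_star (s x) by move=> <-.
  exact: H Es.
have px := domx aM x.
exact: (neg_conj (transK aM cx px)).
Qed.

(** Stated in every chart around x rather than the preferred one only: a second covariant derivative
    needs a single chart at all nearby points. *)
Lemma nabla_coord (X Y : M -> 'rV[R]_n) x c : dom c x -> smooth (vf_comp c Y) (phi c x) ->
  nabla s X Y x *m trans (chart_at x) c x =
  ddir (vf_comp c Y) (phi c x) (vf_comp c X (phi c x)) +
  vf_comp c Y (phi c x) *m Gamma c (phi c x) (vf_comp c X (phi c x)).
Proof.
move=> cx sY; have [hb Eb Et] := symmetry_jet_coord cx; set b := rep2 (s x) in hb Eb Et *.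
have [bb Ux0 Ej] := hb; have [_ /(_ x) [_ Es _]] := hs.
have Ux : ldom b x by rewrite -Es.
have dy : dom c (tgt (b x)) by rewrite Eb.
have sP := push_smooth bb Ux cx dy sY.
have Ety : tgt (b x) = x by rewrite Eb.
have PD v := push_D bb Ux cx dy sY v.
have PA : push b Y x = - Y x.
  by have H := push_at bb Y Ux; rewrite Ety in H; rewrite H Eb /= mulmxN mulmx1.
rewrite Ety in sP PD.
set W := fun z => Y z + push b Y z.
have W0 : W x = 0 by rewrite /W PA subrr.
have EW u : vf_comp c W u = vf_comp c Y u + vf_comp c (push b Y) u by rewrite /vf_comp mulmxDl.
have sW : smooth (vf_comp c W) (phi c x).
  by apply: (smooth_near _ (smooth_add sY sP)); apply: filterE => u; rewrite EW.
rewrite /nabla -scalemxAl (lie_zero X cx W0 sW).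
set v := vf_comp c X (phi c x).
have -> : ddir (vf_comp c W) (phi c x) v = ddir (vf_comp c Y) (phi c x) v + ddir (vf_comp c (push b Y)) (phi c x) v.
  rewrite /ddir.
  rewrite (der_D _ (der_near (derD (smooth_der sY) (smooth_der sP)) _)) //.
  by apply: filterE => u; rewrite EW.
(* The base map has derivative -1, so the direction -v at the source corresponds to v at the target.
   The matrix -1 of s_x restores the sign of D_v Y, and the factor 1/2 averages two copies of it. *)
have := PD (- v); rewrite Et mulNmx mulmxN mulmx1 opprK => ->.
have EJ : hom_mx (N' := H1 M) c (c, c) (s x) = tmx (N' := H1 M) c (c, c) b x.
  have cs : dom c (src (s x)) by rewrite Es.
  have ct : dom (N := H1 M) (c, c) (tgt (s x)) by rewrite Ej /= Es Eb.
  by rewrite (represents_hom_mx aM aH1 (d := (c, c) : chart (H1 M)) hb cs ct) Es.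
rewrite -EJ.
have -> : hom_mx c c (b x) = - 1%:M.
  by rewrite Eb; exact: (neg_conj (transK aM cx (domx aM x))).
have dN : ddir (vf_comp c Y) (phi c x) (- v) = - ddir (vf_comp c Y) (phi c x) v.
  by rewrite /ddir -(J_mul (- v) (smooth_der sY)) -(J_mul v (smooth_der sY)) mulNmx.
have half (Z : 'rV[R]_n) : 2^-1 *: (Z + Z) = Z.
  by rewrite scalerDr -scalerDl -[2^-1]mul1r -splitr scale1r.
rewrite dN mulmxN mulmx1 opprK addrA scalerDr half; congr (_ + _).
by rewrite /Gamma /Gamma_mx (phiK aM cx) half_vec.
Qed.

End Nabla.

(** * The affine extension *)
Section SextCoord.
Local Opaque ddir trans vf_comp nabla push lie.
Context {R : realType} {n : nat} (M : charted R n) (aM : atlas M).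
Notation srcf := (@src _ _ _ _ _).
Variable s : M -> H2 M.
Hypothesis hs : symmetry_jet s.

Lemma vfield_near_smooth (X : M -> 'rV[R]_n) x (c : chart M) : vfield_near x X -> dom c x ->
  smooth (vf_comp c X) (phi c x).
Proof. by case=> U [Ux /(vfield_onP aM) [_ h]] cx; exact: h. Qed.

Lemma vfield_exists x (w : 'rV[R]_n) : exists2 X : M -> 'rV[R]_n, vfield_near x X & X x = w.
Proof.
have px := domx aM x; exists (vf_of (chart_at x) (fun=> w)); last first.
  by rewrite /vf_of (trans_id aM px) mulmx1.
exists (dom (chart_at x)); split; first exact: px.
apply/(vfield_onP aM); split; first exact: mopen_dom.
move=> z pz c cz; have H := vf_of_near aM pz (smooth_cst w (phi (chart_at x) z)).
exact: ((smap_vfield aM _ cz).1 ((smap_vfield aM _ pz).2 H)).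
Qed.

Definition Xc (w : 'rV[R]_(n + n + n * n)) : 'rV[R]_n := lsubmx (lsubmx w).
Definition Yc (w : 'rV[R]_(n + n + n * n)) : 'rV[R]_n := rsubmx (lsubmx w).
Definition Xi (w : 'rV[R]_(n + n + n * n)) : 'M[R]_n := vec_mx (rsubmx w).

Lemma H1_coordE w : H1_coord (Xc w) (Yc w) (Xi w) = w.
Proof. by rewrite /H1_coord /Xc /Yc /Xi vec_mxK !hsubmxK. Qed.

Definition affine_block (c d : chart M) w (v : 'rV[R]_n) : 'M[R]_n :=
  Gamma s c (Xc w) v *m Xi w - Xi w *m Gamma s d (Yc w) (v *m Xi w).

Definition affine_mx (c d : chart M) w : 'M[R]_(n, n * n) := lin1_mx (fun v => mxvec (affine_block c d w v)).

(* The rows of Dist_mx w span the fibre of D^s at the jet with coordinates w. *)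
Definition Dist_mx (c d : chart M) w : 'M[R]_(n, n + n + n * n) :=
  row_mx (row_mx 1%:M (Xi w)) (affine_mx c d w).

Lemma Gamma_linear c u : linear (Gamma s c u).
Proof. by move=> a v w; rewrite /Gamma mulmxDl -scalemxAl linearP. Qed.

Lemma affine_block_linear c d w : linear (affine_block c d w).
Proof.
move=> a u v; rewrite /affine_block mulmxDl -scalemxAl !Gamma_linear mulmxDl mulmxDr -scalemxAl -scalemxAr.
by rewrite scalerBr opprD addrACA.
Qed.

Lemma mul_lin1 m p (f : 'rV[R]_m -> 'rV[R]_p) v : linear f -> v *m lin1_mx f = f v.
Proof.
move=> lf; pose fM := GRing.isLinear.Build _ _ _ _ _ lf.
pose F : {linear 'rV[R]_m -> 'rV[R]_p} := HB.pack f fM.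
exact: (mul_rV_lin1 F).
Qed.

Lemma mul_affine_mx c d w v : v *m affine_mx c d w = mxvec (affine_block c d w v).
Proof.
apply: (mul_lin1 v (f := fun v => mxvec (affine_block c d w v))) => a x y.
by rewrite affine_block_linear linearP.
Qed.

Lemma mul_Dist_mx c d w v : v *m Dist_mx c d w = H1_coord v (v *m Xi w) (affine_block c d w v).
Proof. by rewrite /Dist_mx !mul_mx_row mulmx1 mul_affine_mx. Qed.

Lemma Xi_phi c d (xi : H1 M) : Xi (phi (N := H1 M) (c, d) xi) = hom_mx c d xi.
Proof. by rewrite /Xi phi_HomB row_mxKr mxvecK. Qed.
Lemma Xc_phi c d (xi : H1 M) : Xc (phi (N := H1 M) (c, d) xi) = phi c (src xi).
Proof. by rewrite /Xc phi_HomB !row_mxKl. Qed.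
Lemma Yc_phi c d (xi : H1 M) : Yc (phi (N := H1 M) (c, d) xi) = phi d (tgt xi).
Proof. by rewrite /Yc phi_HomB row_mxKl row_mxKr. Qed.

Lemma smooth_Xi w : smooth Xi w. Proof. by apply/smooth_vec/smooth_rsub; exact: smooth_id. Qed.
Lemma smooth_Xc w : smooth Xc w. Proof. by apply/smooth_lsub/smooth_lsub; exact: smooth_id. Qed.
Lemma smooth_Yc w : smooth Yc w. Proof. by apply/smooth_rsub/smooth_lsub; exact: smooth_id. Qed.

Lemma smooth_Dist_mx c d (xi : H1 M) : dom c (src xi) -> dom d (tgt xi) ->
  smooth (Dist_mx c d) (phi (N := H1 M) (c, d) xi).
Proof.
move=> cx dy; set w := phi _ _.
have k1 : smooth (Gamma_mx s c) (Xc w) by rewrite Xc_phi; exact: smooth_Gamma_mx.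
have k2 : smooth (Gamma_mx s d) (Yc w) by rewrite Yc_phi; exact: smooth_Gamma_mx.
have k1' := smooth_comp (smooth_Xc w) k1; have k2' := smooth_comp (smooth_Yc w) k2.
apply: smooth_row; first by apply: smooth_row; [exact: smooth_cst|exact: smooth_Xi].
apply: smooth_rows => v.
have S : smooth (fun w => mxvec (affine_block c d w v)) w.
  apply: smooth_mxvec; apply: smooth_add.
    apply: smooth_mul; last exact: smooth_Xi.
    by apply: smooth_vec; apply: smooth_mul; [exact: smooth_cst|exact: k1'].
  apply: smooth_opp; apply: smooth_mul; first exact: smooth_Xi.
  apply: smooth_vec; apply: smooth_mul; last exact: k2'.
  by apply: smooth_mul; [exact: smooth_cst|exact: smooth_Xi].
by apply: (smooth_near _ S); apply: filterE => z; rewrite mul_affine_mx.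
Qed.

Section Affine.
Variables (a : lsec M (H1 M)) (x : M) (c d : chart M).
Hypothesis bb : bisection (B1 M) srcf (@beta1 _ _ M) a.
Hypothesis Ux : ldom a x.
Hypothesis cx : dom c x.
Hypothesis dy : dom d (tgt (a x)).
Hypothesis sh : tmx c d (@tgt _ _ _ M M \o a) x = hom_mx c d (a x).

(** The base map has derivative a(x) by [sh], so D_v Y occurs on both sides and cancels. What
    remains depends only on the values of X and Y at x; these being arbitrary, it is an equation
    between matrices. *)
Lemma affine_coord : affine s a x <->
  forall v, vec_mx (v *m rsubmx (tmx (N' := H1 M) c (c, d) a x)) = affine_block c d (phi (N := H1 M) (c, d) (a x)) v.
Proof.
have [_ /(_ _ Ux) [_ Es] _ _] := bb.
have px := domx aM x; have py := domx aM (tgt (a x)).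
pose T := trans (chart_at (tgt (a x))) d (tgt (a x)).
pose J := hom_mx c d (a x).
have JE (v : 'rV[R]_n) : v *m trans (chart_at x) c x *m J = v *m lin (a x) *m T.
  by rewrite /J /hom_mx Es; exact: (cancel_mx _ _ _ (transK aM px cx)).
have JQ : hom_mx c d (a x) = J by [].
clearbody J; have sh' := sh; rewrite JQ in sh'.
have TI (v w : 'rV[R]_n) : v *m T = w *m T -> v = w.
  by move=> /(congr1 (mulmx^~ (trans d (chart_at (tgt (a x))) (tgt (a x)))));
    rewrite -!mulmxA (transK aM py dy) !mulmx1.
have key X X' Y : extends (a x) X X' -> vfield_near x Y ->
   nabla s X Y x *m lin (a x) = nabla s X' (push a Y) (tgt (a x)) <->
   vf_comp c Y (phi c x) *m vec_mx (vf_comp c X (phi c x) *m rsubmx (tmx (N' := H1 M) c (c, d) a x)) =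
   vf_comp c Y (phi c x) *m affine_block c d (phi (N := H1 M) (c, d) (a x)) (vf_comp c X (phi c x)).
  move=> [hX hX' EX] hY; rewrite Es in hX EX.
  have sY := vfield_near_smooth hY cx.
  have sP := push_smooth aM bb Ux cx dy sY.
  have N1 := nabla_coord aM hs X cx sY.
  have N2 := nabla_coord aM hs X' dy sP.
  have EX' : vf_comp d X' (phi d (tgt (a x))) = vf_comp c X (phi c x) *m J.
    by rewrite (vf_comp_at aM X' dy) (vf_comp_at aM X cx) JE EX.
  have PD := push_D aM bb Ux cx dy sY (vf_comp c X (phi c x)).
  rewrite sh' JQ in PD.
  have PA : vf_comp d (push a Y) (phi d (tgt (a x))) = vf_comp c Y (phi c x) *m J.
    have := push_coord aM bb Y Ux cx dy; by rewrite (phiK aM cx) JQ.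
  have E1 : nabla s X Y x *m lin (a x) *m T =
     (ddir (vf_comp c Y) (phi c x) (vf_comp c X (phi c x))
       + vf_comp c Y (phi c x) *m Gamma s c (phi c x) (vf_comp c X (phi c x))) *m J.
    by rewrite -JE N1.
  have E2 : nabla s X' (push a Y) (tgt (a x)) *m T =
     ddir (vf_comp c Y) (phi c x) (vf_comp c X (phi c x)) *m J
       + vf_comp c Y (phi c x) *m vec_mx (vf_comp c X (phi c x) *m rsubmx (tmx (N' := H1 M) c (c, d) a x))
      + vf_comp c Y (phi c x) *m J *m Gamma s d (phi d (tgt (a x))) (vf_comp c X (phi c x) *m J).
    rewrite N2 EX' PA; exact: (congr1 (fun z => z + _) PD).
  have EA : vf_comp c Y (phi c x) *m affine_block c d (phi (N := H1 M) (c, d) (a x)) (vf_comp c X (phi c x)) =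
     vf_comp c Y (phi c x) *m Gamma s c (phi c x) (vf_comp c X (phi c x)) *m J
       - vf_comp c Y (phi c x) *m J *m Gamma s d (phi d (tgt (a x))) (vf_comp c X (phi c x) *m J).
    by rewrite /affine_block Xi_phi Xc_phi Yc_phi Es JQ mulmxBr !mulmxA.
  rewrite EA; set P1 := vf_comp c Y (phi c x) *m vec_mx _ in E2 *.
  rewrite mulmxDl in E1; split=> [E|E].
    have := congr1 (mulmx^~ T) E; rewrite /= E1 E2 -addrA => /addrI ->.
    by rewrite addrK.
  by apply: TI; rewrite E1 E2 E -addrA subrK.
split=> [ha v|ha X X' Y hX hY]; last first.
  by apply/key => //; rewrite ha.
apply: eq_mul_rV => w.
have [X hX EX] := vfield_exists x (v *m trans c (chart_at x) x).
have [Y hY EY] := vfield_exists x (w *m trans c (chart_at x) x).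
have [X' hX' EX'] := vfield_exists (tgt (a x)) (X x *m lin (a x)).
have ext : extends (a x) X X' by split; rewrite ?Es.
have := (key X X' Y ext hY).1 (ha X X' Y ext hY).
have vE (Z : M -> 'rV[R]_n) z : Z x = z *m trans c (chart_at x) x -> vf_comp c Z (phi c x) = z.
  by move=> EZ; rewrite (vf_comp_at aM Z cx) EZ -mulmxA (transK aM cx px) mulmx1.
by rewrite (vE _ _ EX) (vE _ _ EY).
Qed.
End Affine.

End SextCoord.

Section SextSm.
Context {R : realType} {n : nat} (M : charted R n) (aM : atlas M).
Notation srcf := (@src _ _ _ _ _).
Let aH1 := atlas_H1 aM.
Let aH2 := atlas_H2 aM.
Variable s : M -> H2 M.
Hypothesis hs : symmetry_jet s.

Definition Sspec (xi : H1 M) (j : H2 M) :=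
  [/\ B11sh j, p2 j = xi & exists a : lsec M (H1 M),
        represents (B1 M) (@src _ _ _ _ _) (@beta1 _ _ M) a j /\ affine s a (src j)].

(** Uniqueness of S(xi): semi-holonomy forces the second block of the linear part, and affinity,
    through [affine_coord], forces the third. *)
Lemma Sspec_coord xi j c d : Sspec xi j -> dom c (src xi) -> dom d (tgt xi) ->
  [/\ B11nh j, src j = src xi, tgt j = xi &
      hom_mx (N' := H1 M) c (c, d) j = Dist_mx s c d (phi (N := H1 M) (c, d) xi)].
Proof.
move=> [hsh Ep [a [ha aff]]] cx dy.
have Et : tgt j = xi by exact: Ep.
have hj : B11nh j by case: hsh.
have cj : dom c (src j).
  have [ba Ua Ej] := ha; have [_ /(_ _ Ua) [_ E] _ _] := ba.
  have Et' : tgt j = a (src j) by rewrite Ej.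
  by rewrite -E -Et' Et.
have dj : dom d (tgt (tgt j)) by rewrite Et.
have [Es uxi [eta [B [ueta EJ]]]] := B11nh_elim aM hj cj dj.
have Esj : src j = src xi by rewrite -Es Et.
split => //.
have [ba Ua Ej] := ha.
have Eta : a (src j) = xi by rewrite -Et {2}Ej.
have dyx : dom d (tgt (a (src j))) by rewrite Eta.
have cxa : dom c (src (a (src j))) by rewrite Eta.
have cda : dom (N := H1 M) (c, d) (a (src j)) by split.
have cdt : dom (N := H1 M) (c, d) (tgt j) by rewrite Et; split.
have EJ2 := represents_hom_mx aM aH1 (d := (c, d) : chart (H1 M)) ha cj cdt.
have sa := bis_smap aM aH1 ba Ua.
have [stgt _] := tgt_smap_in aM aM cxa dyx.
have T2 : tmx c d (@tgt _ _ _ M M \o a) (src j) = rsubmx (lsubmx (hom_mx (N' := H1 M) c (c, d) j)).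
  by rewrite (tmx_comp aM aH1 aM sa stgt cj cda dyx) EJ2 (tmx_tgt aM aM).
have E2 := (B11shP aM hj cj dj).1 hsh.
have sh : tmx c d (@tgt _ _ _ M M \o a) (src j) = hom_mx c d (a (src j)).
  by rewrite T2 -E2 Et Eta.
have := (affine_coord aM hs ba Ua cj dyx sh).1 aff.
rewrite Eta -EJ2 EJ row_mxKr => hv.
have -> : B = affine_mx s c d (phi (N := H1 M) (c, d) xi).
  by apply: eq_mul_rV => v; rewrite mul_affine_mx -hv vec_mxK.
by move: E2; rewrite EJ row_mxKl row_mxKr /Dist_mx Xi_phi Et => ->.
Qed.

(** Existence: the forced matrix has the shape required by [B11nh_intro], and [affine_coord], being
    an equivalence, shows that the jet so defined is affine. *)
Lemma Sspec_exists xi : B1 M xi -> exists j, Sspec xi j.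
Proof.
move=> uxi; pose c := chart_at (src xi); pose d := chart_at (tgt xi).
have cx : dom c (src xi) by exact: domx.
have dy : dom d (tgt xi) by exact: domx.
pose w := phi (N := H1 M) (c, d) xi.
(* In preferred charts [lin] is the coordinate matrix itself, so [Dist_mx] can be inserted as it
   stands. *)
pose j : H2 M := Hom (src xi) xi (Dist_mx s c d w).
have EJ : hom_mx (N' := H1 M) c (c, d) j = row_mx (row_mx 1%:M (hom_mx c d xi)) (affine_mx s c d w).
  rewrite -(Xi_phi c d xi) -/w -[RHS]/(Dist_mx s c d w).
  exact: (hom_mx_chart_at aM aH1 j).
have uj : hom_mx c d xi \in unitmx by rewrite (hom_mx_unit aM cx dy).
have hj : B11nh j by apply: (B11nh_intro aM _ _ _ _ _ EJ) => //.
have hsh : B11sh j.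
  by apply/(B11shP aM hj (c := c) (d := d)) => //; rewrite EJ row_mxKl row_mxKr.
exists j; split => //.
have ha := rep_spec hj; exists (rep (B1 M) srcf (@beta1 _ _ M) j); split => //.
set a := rep _ _ _ _ in ha *.
have [ba Ua Ej] := ha.
have Eta : a (src xi) = xi.
  have E : tgt j = tgt (jet a (src j)) by exact: (congr1 (@tgt _ _ _ _ _) Ej).
  by rewrite [RHS](E : xi = a (src xi)).
have dyx : dom d (tgt (a (src xi))) by rewrite Eta.
have cxa : dom c (src (a (src xi))) by rewrite Eta.
have cda : dom (N := H1 M) (c, d) (a (src xi)) by split.
have cdt : dom (N := H1 M) (c, d) (tgt j) by split.
have EJ2 := represents_hom_mx aM aH1 (d := (c, d) : chart (H1 M)) ha cx cdt.
have sa := bis_smap aM aH1 ba Ua.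
have [stgt _] := tgt_smap_in aM aM cxa dyx.
have sh : tmx c d (@tgt _ _ _ M M \o a) (src xi) = hom_mx c d (a (src xi)).
  by rewrite (tmx_comp aM aH1 aM sa stgt cx cda dyx) (tmx_tgt aM aM) // -EJ2 EJ row_mxKl row_mxKr Eta.
apply/(affine_coord aM hs ba Ua cx dyx sh) => v.
by rewrite Eta -EJ2 EJ row_mxKr mul_affine_mx mxvecK.
Qed.

Lemma Sext_spec xi : B1 M xi -> Sspec xi (Sext s xi).
Proof. by move=> /Sspec_exists; exact: epsilon_spec. Qed.

Lemma Sext_coord xi c d : B1 M xi -> dom c (src xi) -> dom d (tgt xi) ->
  [/\ B11nh (Sext s xi), src (Sext s xi) = src xi, tgt (Sext s xi) = xi &
      hom_mx (N' := H1 M) c (c, d) (Sext s xi) = Dist_mx s c d (phi (N := H1 M) (c, d) xi)].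
Proof. by move=> /Sext_spec h; exact: Sspec_coord. Qed.

Lemma B1_near xi : B1 M xi -> mnear (N := H1 M) xi (B1 M).
Proof.
move=> uxi; pose c := chart_at (src xi); pose d := chart_at (tgt xi).
have cx : dom c (src xi) by exact: domx.
have dy : dom d (tgt xi) by exact: domx.
have cd : dom (N := H1 M) (c, d) xi by split.
apply/(mnearP aH1 _ cd).
have u0 : Xi (phi (N := H1 M) (c, d) xi) \in unitmx by rewrite Xi_phi (hom_mx_unit aM cx dy).
apply: filterS2 (unitmx_near (smooth_cont (smooth_Xi _)) u0) (atlas_near aH1 cd cd) => w uw [[cw dw] _ Ew].
have := hom_mx_unit aM cw dw; rewrite -(Xi_phi c d) Ew uw => U; exact: (esym U).
Qed.

Lemma B1_mopen : mopen (B1 M).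
Proof. by apply/(mopenP aH1) => xi; exact: B1_near. Qed.

Definition Sext_vec c d w := row_mx (row_mx (Xc w) w) (mxvec (Dist_mx s c d w)).

(** [Sext] chooses a jet at each point separately; it is smooth because the coordinates of the
    choice are forced to be [Sext_vec]. *)
Lemma Sext_smap xi c d : B1 M xi -> dom c (src xi) -> dom d (tgt xi) ->
  smap (N := H1 M) (N' := H2 M) (Sext s) xi /\
  \forall w \near phi (N := H1 M) (c, d) xi,
    Sext_vec c d w = loc (N := H1 M) (N' := H2 M) (c, d) (c, (c, d)) (Sext s) w.
Proof.
move=> uxi cx dy.
have cd : dom (N := H1 M) (c, d) xi by split.
have nB := mnear_chart aH1 cd (B1_near uxi).
have E : \forall w \near phi (N := H1 M) (c, d) xi,
    Sext_vec c d w = loc (N := H1 M) (N' := H2 M) (c, d) (c, (c, d)) (Sext s) w.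
  apply: filterS nB => w [[cw dw] uw Ew].
  have [_ E1 E2 E3] := Sext_coord uw cw dw.
  by rewrite /loc phi_HomB E1 E2 E3 Ew -(Xc_phi c d) Ew.
split; last exact: E.
have [_ E1 E2 _] := Sext_coord uxi cx dy.
have cd2 : dom (N := H2 M) (c, (c, d)) (Sext s xi) by rewrite /= E1 E2; split.
refine (smapI (N := H1 M) (N' := H2 M) aH1 aH2 (c := (c, d)) (d := (c, (c, d))) _ cd cd2).
split.
  apply: mnearS (mnearI (B1_near uxi) (dom_near aH1 cd)) => z [uz [cz dz]].
  by have [_ act1_along act2_along _] := Sext_coord uz cz dz; rewrite /= act1_along act2_along; split.
apply: (smooth_near E); apply: smooth_row; last exact/smooth_mxvec/smooth_Dist_mx.
by apply: smooth_row; [exact: smooth_Xc|exact: smooth_id].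
Qed.

Section SS.
Variables (xi : H1 M) (c d : chart M).
Hypothesis uxi : B1 M xi.
Hypothesis cx : dom c (src xi).
Hypothesis dy : dom d (tgt xi).
Let a := rep2 (Sext s xi).
Let w := phi (N := H1 M) (c, d) xi.

(** S after a is a bisection with the same base map as a. The derivative of a along v is v L, and
    the matrix part of S is L, so the chain rule gives D_(v L) L. *)
Lemma SS_coord :
  [/\ B111nh (SSext s xi), src (SSext s xi) = src xi, tgt (SSext s xi) = Sext s xi &
   forall v : 'rV[R]_n, v *m hom_mx (N' := H2 M) c (c, (c, d)) (SSext s xi) =
     row_mx (row_mx v (v *m Dist_mx s c d w)) (mxvec (ddir (Dist_mx s c d) w (v *m Dist_mx s c d w)))].
Proof.
have [hj E1 E2 E3] := Sext_coord uxi cx dy.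
have ha : represents (B1 M) srcf (@beta1 _ _ M) a (Sext s xi) := rep_spec hj.
have [ba Ua Ej] := ha; rewrite E1 in Ua.
have Ea : a (src xi) = xi.
  have F : tgt (Sext s xi) = a (src (Sext s xi)) by exact: (congr1 (@tgt _ _ _ _ _) Ej).
  by rewrite -E1 -F.
have sa := bis_smap aM aH1 ba Ua.
have [sS ES] := Sext_smap uxi cx dy.
have sS' : smap (N := H1 M) (N' := H2 M) (Sext s) (a (src xi)) by rewrite Ea.
have sSa : smap (N := M) (N' := H2 M) (Sext s \o a) (src xi) by exact: (smap_comp aM aH1 aH2 sa sS').
have inB x : ldom a x -> B1 M (a x) /\ src (a x) = x by have [_ h _ _] := ba; exact: h.
have tS x : ldom a x -> [/\ B11nh (Sext s (a x)), src (Sext s (a x)) = x & tgt (Sext s (a x)) = a x].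
  move=> Ux; have [ux sx] := inB x Ux.
  by have [] := Sext_coord ux (domx aM _) (domx aM _); rewrite sx.
have bis : bisection (B11nh (M := M)) srcf (@beta2 _ _ M) (Lsec (ldom a) (Sext s \o a)).
  have [sm1 h2 [oU sm2] [g [sg gb]]] := ba.
  have Eb : forall x, ldom a x -> (@beta2 _ _ M \o (Sext s \o a)) x = (@beta1 _ _ M \o a) x.
    by move=> x /tS[_ _ E]; rewrite /= /beta2 E.
  have sb0 := ((smooth_onP aM aM _ _).1 (conj oU sm2 : smooth_on (ldom a) (@beta1 _ _ M \o a))).2.
  split.
  - refine ((smooth_onP aM aH2 _ _).2 (conj oU _)) => x Ux.
    have [ux sx] := inB x Ux; have sax := bis_smap aM aH1 ba Ux.
    exact: (smap_comp aM aH1 aH2 sax (Sext_smap ux (domx aM _) (domx aM _)).1).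
  - by move=> x /tS[].
  - refine ((smooth_onP aM aM _ _).2 (conj oU _)) => x Ux.
    refine (smap_ext (f := @beta1 _ _ M \o a) (g := @beta2 _ _ M \o (Sext s \o a)) aM _ (sb0 x Ux)).
    by apply: mnearS (mopen_near aM oU Ux) => z Uz; exact: (esym (Eb z Uz)).
  exists g; split; last by move=> x Ux; rewrite Eb //; exact: gb.
  have -> : (@beta2 _ _ M \o Lsec (ldom a) (Sext s \o a)) @` ldom a = (@beta1 _ _ M \o a) @` ldom a.
    by rewrite eqEsubset; split=> _ [x Ux <-]; exists x => //; [exact: (esym (Eb x Ux))|exact: Eb].
  exact: sg.
split => //.
- by exists (Lsec (ldom a) (Sext s \o a)); split.
- by rewrite /SSext /= -/a Ea.
move=> v.
have cd : dom (N := H1 M) (c, d) (a (src xi)) by rewrite Ea; split.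
have cd2 : dom (N := H2 M) (c, (c, d)) ((Sext s \o a) (src xi)) by rewrite /= Ea E1 E2; split.
rewrite (hom_mx_jet aM aH2 sSa cx cd2) (tmx_comp aM aH1 aH2 sa sS' cx cd cd2).
have cds : dom (N := H1 M) (c, d) (tgt (Sext s xi)) by rewrite E2; split.
have cxs : dom c (src (Sext s xi)) by rewrite E1.
have EJ := represents_hom_mx aM aH1 (d := (c, d) : chart (H1 M)) ha cxs cds.
rewrite E1 in EJ; rewrite -EJ E3 Ea mulmxA.
set v' := v *m _.
have sL := smooth_Dist_mx aM hs cx dy.
have D := der_row (der_row (linear_mx_der (@lin_lsub _ _ _ _) (linear_mx_der (@lin_lsub _ _ _ _) (der_id w)))
  (der_id w))
  (linear_mx_der (@lin_mxvec _ _ _) (smooth_der sL)).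
rewrite /tmx (J_mul v' (der_near D ES)).
by rewrite /v' mul_Dist_mx /H1_coord !row_mxKl.
Qed.
End SS.

End SextSm.

(** * Actions on iterated tangent bundles *)
Section Act.
Context {R : realType} {n : nat} (M : charted R n) (aM : atlas M).
Notation srcf := (@src _ _ _ _ _).
Let aH1 := atlas_H1 aM.
Let aH2 := atlas_H2 aM.
Let aT : atlas (Tan M) := atlas_Tan aM.
Let aTT : atlas (Tan (Tan M)) := atlas_Tan aT.

Section ActAlong1.
Variables (b : lsec M (H1 M)) (x : M) (c d : chart M).
Hypothesis bb : bisection (B1 M) srcf (@beta1 _ _ M) b.
Hypothesis Ux : ldom b x.
Hypothesis cx : dom c x.
Hypothesis dy : dom d (tgt (b x)).

Definition act1_along (X : Tan M) : Tan M := act1 (b (tbase X)) X.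

Lemma phi_act1_along (X : Tan M) : ldom b X.1 -> dom c X.1 ->
  phi (N := Tan M) d (act1_along X) = row_mx (phi d (tgt (b X.1))) (rsubmx (phi (N := Tan M) c X) *m hom_mx c d (b
    X.1)).
Proof.
case: X => x' Q /= Ux' cx'; congr row_mx; rewrite row_mxKr /hom_mx.
have [_ /(_ _ Ux') [_ Es] _ _] := bb; rewrite /tbase /= Es.
exact: (esym (cancel_mx _ _ _ (transK aM (domx aM x') cx'))).
Qed.

Let bh u := hom_mx c d (b (inv c u)).
Let b0 := @tgt _ _ _ M M \o b.
Let sb0 : smap b0 x. Proof. exact: bis_be bb Ux. Qed.

Definition act1_fun (z : 'rV[R]_(n + n)) : 'rV[R]_(n + n) :=
  row_mx (loc c d b0 (lsubmx z)) (rsubmx z *m bh (lsubmx z)).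

Lemma act1_along_smap (Q : 'rV[R]_n) (X := (x, Q) : Tan M) :
  smap (N := Tan M) (N' := Tan M) act1_along X /\
  \forall z \near phi (N := Tan M) c X, act1_fun z = loc (N := Tan M) (N' := Tan M) c d act1_along z.
Proof.
have [dn s0] := smap_in_charts aM aM sb0 cx dy.
have cX : dom (N := Tan M) c X by [].
have dX : dom (N := Tan M) d (act1_along X) by [].
have hn := mnear_chart aM cx (mnearI (bis_near aM bb Ux) dn).
have hz : \forall z \near phi (N := Tan M) c X, [/\ dom c (inv c (lsubmx z)),
    ldom b (inv c (lsubmx z)) /\ dom d (b0 (inv c (lsubmx z))) & phi c (inv c (lsubmx z)) = lsubmx z].
  apply: (near_lsub (P := fun u => [/\ dom c (inv c u),
    ldom b (inv c u) /\ dom d (b0 (inv c u)) & phi c (inv c u) = u])).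
  by rewrite row_mxKl.
have E : \forall z \near phi (N := Tan M) c X, act1_fun z = loc (N := Tan M) (N' := Tan M) c d act1_along z.
  apply: filterS2 hz (atlas_near aT cX cX) => z [cz [Uz dz] Ez] [_ _ EZ].
  by rewrite /loc phi_act1_along // EZ.
split; last exact: E.
refine (smapI (N := Tan M) (N' := Tan M) aT aT (c := c) (d := d) _ cX dX); split.
  by apply/(mnearP aT _ cX); apply: filterS hz => z [_ [_ dz] _].
apply: (smooth_near E).
have sl : smooth lsubmx (phi (N := Tan M) c X) by apply: smooth_lsub; exact: smooth_id.
have sr : smooth rsubmx (phi (N := Tan M) c X) by apply: smooth_rsub; exact: smooth_id.
have s0' : smooth (loc c d b0) (lsubmx (phi (N := Tan M) c X)) by rewrite row_mxKl.
have sh' : smooth bh (lsubmx (phi (N := Tan M) c X)) by rewrite row_mxKl; exact: smooth_bh.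
by apply: smooth_row; [exact: (smooth_comp sl s0')|exact: (smooth_mul sr (smooth_comp sl sh'))].
Qed.

(** The tangent map of (x, Q) |-> Q b(x): a motion of the base point also moves the matrix b(x),
    hence the second summand of the fibre part. *)
Lemma act1_along_tmx (Q : 'rV[R]_n) (X := (x, Q) : Tan M) (z' : 'rV[R]_(n + n)) :
  z' *m tmx (N := Tan M) (N' := Tan M) c d act1_along X =
  row_mx (lsubmx z' *m tmx c d b0 x)
   (rsubmx z' *m hom_mx c d (b x) + rsubmx (phi (N := Tan M) c X) *m vec_mx (lsubmx z' *m rsubmx (tmx (N' := H1 M)
     c (c, d) b x))).
Proof.
have [_ E] := act1_along_smap Q; rewrite -/X in E.
have [_ s0] := smap_in_charts aM aM sb0 cx dy.
have El : lsubmx (phi (N := Tan M) c X) = phi c x by rewrite row_mxKl.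
have dl : der (fun z : 'rV[R]_(n + n) => lsubmx z) (phi (N := Tan M) c X) (fun z => lsubmx z).
  by apply: (linear_mx_der (@lin_lsub _ _ _ _)); exact: der_id.
have dr : der (fun z : 'rV[R]_(n + n) => rsubmx z) (phi (N := Tan M) c X) (fun z => rsubmx z).
  by apply: (linear_mx_der (@lin_rsub _ _ _ _)); exact: der_id.
have s0' : smooth (loc c d b0) (lsubmx (phi (N := Tan M) c X)) by rewrite El.
have sh' : smooth bh (lsubmx (phi (N := Tan M) c X)) by rewrite El; exact: smooth_bh.
have D := der_row (der_comp dl (smooth_derJ s0')) (der_mul dr (der_comp dl (smooth_der sh'))).
refine (etrans (J_mul z' (der_near D E)) _).
rewrite El (D_bh aM bb Ux cx dy).
have -> : bh (phi c x) = hom_mx c d (b x) by rewrite /bh phiK.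
exact: erefl.
Qed.
End ActAlong1.

Section Coordinates.
Let k1 := (n + n + n * n)%N.
Definition Wp (p : 'rV[R]_(n + k1 + n * k1)) : 'rV[R]_k1 := rsubmx (lsubmx p).
Definition Jp (p : 'rV[R]_(n + k1 + n * k1)) : 'M[R]_(n, k1) := vec_mx (rsubmx p).
Definition Ep p : 'M[R]_n := rsubmx (lsubmx (Jp p)).
Definition Bp p : 'M[R]_(n, n * n) := rsubmx (Jp p).

(* A vector of T^2 M has coordinates (u, q, r, w): it is (r, w) at the point (u, q)
   of TM. *)
Definition zq (z : 'rV[R]_((n + n) + (n + n))) : 'rV[R]_n := rsubmx (lsubmx z).
Definition zr (z : 'rV[R]_((n + n) + (n + n))) : 'rV[R]_n := lsubmx (rsubmx z).
Definition zw (z : 'rV[R]_((n + n) + (n + n))) : 'rV[R]_n := rsubmx (rsubmx z).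
Definition zu (z : 'rV[R]_((n + n) + (n + n))) : 'rV[R]_n := lsubmx (lsubmx z).

Definition act2_fun p z : 'rV[R]_((n + n) + (n + n)) :=
  row_mx (row_mx (Yc (Wp p)) (zq z *m Xi (Wp p)))
    (row_mx (zr z *m Ep p) (zw z *m Xi (Wp p) + zq z *m vec_mx (zr z *m Bp p))).

(** The differential of [act2_fun] at (p, z) in the direction (p', z'). *)
Definition act2_velocity p p' z z' : 'rV[R]_((n + n) + (n + n)) :=
  row_mx (row_mx (Yc (Wp p')) (zq z' *m Xi (Wp p) + zq z *m Xi (Wp p')))
    (row_mx (zr z' *m Ep p + zr z *m Ep p')
      ((zw z' *m Xi (Wp p) + zw z *m Xi (Wp p')) +
       (zq z' *m vec_mx (zr z *m Bp p) + zq z *m vec_mx (zr z' *m Bp p + zr z *m Bp p')))).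

Lemma lin_comp a1 a2 a3 a4 a5 a6 (f : 'M[R]_(a1, a2) -> 'M[R]_(a3, a4)) (g : 'M[R]_(a3, a4) -> 'M[R]_(a5, a6)) :
  linear f -> linear g -> linear (fun x => g (f x)).
Proof. by move=> lf lg a x y; rewrite lf lg. Qed.

Lemma lin_Wp : linear Wp. Proof. exact: lin_comp (@lin_lsub _ _ _ _) (@lin_rsub _ _ _ _). Qed.
Lemma lin_Jp : linear Jp. Proof. exact: lin_comp (@lin_rsub _ _ _ _) (@lin_vec _ _ _). Qed.
Lemma lin_Ep : linear Ep.
Proof. exact: lin_comp (lin_comp lin_Jp (@lin_lsub _ _ _ _)) (@lin_rsub _ _ _ _). Qed.
Lemma lin_Bp : linear Bp. Proof. exact: lin_comp lin_Jp (@lin_rsub _ _ _ _). Qed.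
Lemma lin_Yc : linear (@Yc R n). Proof. exact: lin_comp (@lin_lsub _ _ _ _) (@lin_rsub _ _ _ _). Qed.
Lemma lin_Xi : linear (@Xi R n). Proof. exact: lin_comp (@lin_rsub _ _ _ _) (@lin_vec _ _ _). Qed.
Lemma lin_zq : linear zq. Proof. exact: lin_comp (@lin_lsub _ _ _ _) (@lin_rsub _ _ _ _). Qed.
Lemma lin_zu : linear zu. Proof. exact: lin_comp (@lin_lsub _ _ _ _) (@lin_lsub _ _ _ _). Qed.
Lemma lin_zr : linear zr. Proof. exact: lin_comp (@lin_rsub _ _ _ _) (@lin_lsub _ _ _ _). Qed.
Lemma lin_zw : linear zw. Proof. exact: lin_comp (@lin_rsub _ _ _ _) (@lin_rsub _ _ _ _). Qed.

Lemma act2_fun_smooth (be : 'rV[R]_n -> 'rV[R]_(n + k1 + n * k1)) z : smooth be (zu z) ->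
  smooth (fun z => act2_fun (be (zu z)) z) z.
Proof.
move=> sb.
have sbz := smooth_comp (smooth_lin lin_zu (smooth_id z)) sb.
have sq := smooth_lin lin_zq (smooth_id z); have sr := smooth_lin lin_zr (smooth_id z);
  have sw := smooth_lin lin_zw (smooth_id z).
have sX := smooth_lin lin_Xi (smooth_lin lin_Wp sbz).
apply: smooth_row; apply: smooth_row.
- exact: smooth_lin lin_Yc (smooth_lin lin_Wp sbz).
- exact: smooth_mul sq sX.
- exact: smooth_mul sr (smooth_lin lin_Ep sbz).
- exact: smooth_add (smooth_mul sw sX) (smooth_mul sq (smooth_vec (smooth_mul sr (smooth_lin lin_Bp sbz)))).
Qed.

Lemma act2_fun_der (be : 'rV[R]_n -> 'rV[R]_(n + k1 + n * k1)) z D : der be (zu z) D ->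
  der (fun z => act2_fun (be (zu z)) z) z (fun z' => act2_velocity (be (zu z)) (D (zu z')) z z').
Proof.
move=> sb.
have sbz := der_comp (linear_mx_der lin_zu (der_id z)) sb.
have sq := linear_mx_der lin_zq (der_id z); have sr := linear_mx_der lin_zr (der_id z);
  have sw := linear_mx_der lin_zw (der_id z).
have sX := linear_mx_der lin_Xi (linear_mx_der lin_Wp sbz).
apply: der_row; apply: der_row.
- exact: linear_mx_der lin_Yc (linear_mx_der lin_Wp sbz).
- exact: der_mul sq sX.
- exact: der_mul sr (linear_mx_der lin_Ep sbz).
- exact: derD (der_mul sw sX) (der_mul sq (linear_mx_der (@lin_vec _ _ _) (der_mul sr (linear_mx_der lin_Bp sbz)))).
Qed.

End Coordinates.

(** Only the value and the first derivative of the representative enter, that is, the coordinates of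
    j. This makes the action smooth along a bisection of jets, although the representatives at
    different points are unrelated. *)
Lemma act2_coord (j : H2 M) (Z : Tan (Tan M)) c d : B11nh j -> Z.1.1 = src j ->
  dom c (src j) -> dom d (tgt (tgt j)) ->
  phi (N := Tan (Tan M)) d (act2 j Z) =
   act2_fun (phi (N := H2 M) (c, (c, d)) j) (phi (N := Tan (Tan M)) c Z).
Proof.
move=> hj EZ cx dy; have hb : represents (B1 M) srcf (@beta1 _ _ M) (rep2 j) j := rep_spec hj.
have cxj := cx; set b := rep2 j in hb; have [bb Ux Ej] := hb.
case: Z EZ => [[x Q] V] EZ; have {}EZ : x = src j := EZ; rewrite -EZ in Ux cx.
have -> : act2 j ((x, Q), V) = tmap (act1_along b) ((x, Q), V) by [].
have Et : tgt j = b x by rewrite EZ; exact: (congr1 (@tgt _ _ _ _ _) Ej).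
have [Es _ [eta [B [_ EJ]]]] := B11nh_elim aM hj cxj dy.
have dy' : dom d (tgt (b x)) by rewrite -Et.
have [sF _] := act1_along_smap bb Ux cx dy' Q.
have cX : dom (N := Tan M) c ((x, Q) : Tan M) by [].
have dX : dom (N := Tan M) d (act1_along b (x, Q)) by [].
have cds : dom (N := H1 M) (c, d) (tgt j) by split => //; rewrite Es -EZ.
have EJ2 := represents_hom_mx aM aH1 (d := (c, d) : chart (H1 M)) hb cxj cds.
have sb := bis_smap aM aH1 bb Ux.
have cxa : dom c (src (b x)) by rewrite -Et Es -EZ.
have cda : dom (N := H1 M) (c, d) (b x) by split.
have [stgt _] := tgt_smap_in aM aM cxa dy'.
have T2 := tmx_comp aM aH1 aM sb stgt cx cda dy'.
rewrite (tmx_tgt aM aM _ cxa dy') in T2.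
refine (etrans (phi_tmap (N := Tan M) (N' := Tan M) (f := act1_along b) (X := ((x, Q),
  V)) (c := c) (d := d) aT aT sF cX dX) _).
rewrite (act1_along_tmx bb Ux cx dy').
have P1 : phi (N := Tan M) d (act1_along b (x, Q)) =
    row_mx (phi d (tgt (b x))) (rsubmx (phi (N := Tan M) c (x, Q)) *m hom_mx c d (b x)) by exact: phi_act1_along.
rewrite P1 -EZ in EJ2 *.
pose p := phi (N := H2 M) (c, (c, d)) j.
have pW : Wp p = phi (N := H1 M) (c, d) (b x) by rewrite /p phi_HomB /Wp row_mxKl row_mxKr Et.
have Sext_velocity : Jp p = tmx (N' := H1 M) c (c, d) b x by rewrite /p phi_HomB /Jp row_mxKr mxvecK.
rewrite /act2_fun -/p pW /Ep /Bp Sext_velocity T2 Xi_phi Yc_phi.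
pose z := phi (N := Tan (Tan M)) c ((x, Q), V).
have zE : lsubmx z = phi (N := Tan M) c (x, Q) by rewrite /z row_mxKl.
by rewrite /zq /zr /zw -/z zE.
Qed.

Lemma act2_base (j : H2 M) (Z : Tan (Tan M)) : B11nh j -> Z.1.1 = src j ->
  (act2 j Z).1.1 = tgt (tgt j).
Proof.
move=> hj EZ; have hb : represents (B1 M) srcf (@beta1 _ _ M) (rep2 j) j := rep_spec hj.
have [_ _ Ej] := hb.
have -> : tgt j = rep2 j (src j) by exact: (congr1 (@tgt _ _ _ _ _) Ej).
by rewrite -EZ.
Qed.

Section ActAlong2.
Variables (b : lsec M (H2 M)) (x : M) (c d : chart M).
Hypothesis bb : bisection (B11nh (M := M)) srcf (@beta2 _ _ M) b.
Hypothesis Ux : ldom b x.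
Hypothesis cx : dom c x.
Hypothesis dy : dom d (tgt (tgt (b x))).

Definition act2_along (Z : Tan (Tan M)) : Tan (Tan M) := act2 (b (tbase (tbase Z))) Z.

Let be := loc (N := M) (N' := H2 M) c (c, (c, d)) b.

Lemma phi_act2_along (Z : Tan (Tan M)) : ldom b Z.1.1 -> dom c Z.1.1 -> dom d (tgt (tgt (b Z.1.1))) ->
  phi (N := Tan (Tan M)) d (act2_along Z) = act2_fun (phi (N := H2 M) (c, (c,
    d)) (b Z.1.1)) (phi (N := Tan (Tan M)) c Z).
Proof.
move=> UZ cZ dZ; have [_ /(_ _ UZ) [hB Es] _ _] := bb.
by apply: act2_coord => //; rewrite Es.
Qed.

Let cdx : dom (N := H2 M) (c, (c, d)) (b x).
Proof.
have [_ /(_ _ Ux) [hB Es] _ _] := bb.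
have cs : dom c (src (b x)) by rewrite Es.
have [Es' _ _] := B11nh_elim aM hB cs dy.
by split; [exact: cs|split; [rewrite /= Es'; exact: cs|exact: dy]].
Qed.

Lemma smooth_be : smooth be (phi c x).
Proof.
by have [_] := smap_in_charts (d := (c, (c, d)) : chart (H2 M)) aM aH2 (bis_smap aM aH2 bb Ux) cx cdx.
Qed.

Lemma act2_along_smap (QV : 'rV[R]_n * 'rV[R]_(n + n)) (Z := ((x, QV.1), QV.2) : Tan (Tan M)) :
  smap (N := Tan (Tan M)) (N' := Tan (Tan M)) act2_along Z /\
  \forall z \near phi (N := Tan (Tan M)) c Z,
    act2_fun (be (zu z)) z = loc (N := Tan (Tan M)) (N' := Tan (Tan M)) c d act2_along z.
Proof.
have sb0 : smap (@beta2 _ _ M \o b) x by exact: bis_be bb Ux.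
have [dn s0] := smap_in_charts aM aM sb0 cx dy.
have cZ : dom (N := Tan (Tan M)) c Z by [].
have FB z : ldom b z.1.1 -> (act2_along z).1.1 = tgt (tgt (b z.1.1)).
  by move=> Uz; have [_ /(_ _ Uz) [hB Es] _ _] := bb; apply: act2_base => //; rewrite Es.
have dZ : dom (N := Tan (Tan M)) d (act2_along Z).
  by rewrite -[dom _ _]/(dom d (act2_along Z).1.1) FB.
have hn := mnear_chart aM cx (mnearI (bis_near aM bb Ux) dn).
have Eu : zu (phi (N := Tan (Tan M)) c Z) = phi c x by rewrite /zu !row_mxKl.
have hz : \forall z \near phi (N := Tan (Tan M)) c Z, [/\ dom c (inv c (zu z)),
    ldom b (inv c (zu z)) /\ dom d (beta2 (b (inv c (zu z)))) & phi c (inv c (zu z)) = zu z].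
  apply: (cont_near (f := zu) (P := fun u => [/\ dom c (inv c u),
    ldom b (inv c u) /\ dom d (beta2 (b (inv c u))) & phi c (inv c u) = u])).
    exact: (smooth_cont (smooth_lin lin_zu (smooth_id _))).
  by rewrite Eu.
have E : \forall z \near phi (N := Tan (Tan M)) c Z,
    act2_fun (be (zu z)) z = loc (N := Tan (Tan M)) (N' := Tan (Tan M)) c d act2_along z.
  apply: filterS2 hz (atlas_near aTT cZ cZ) => z [cz [Uz dz] Ez] [_ _ EZ].
  by rewrite /loc phi_act2_along // EZ.
split; last exact: E.
refine (smapI (N := Tan (Tan M)) (N' := Tan (Tan M)) aTT aTT (c := c) (d := d) _ cZ dZ); split.
  apply/(mnearP aTT _ cZ); apply: filterS hz => z [_ [Uz dz] _].
  by rewrite -[dom _ _]/(dom d (act2_along (inv (N := Tan (Tan M)) c z)).1.1) FB.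
by apply: (smooth_near E); apply: act2_fun_smooth; rewrite Eu; exact: smooth_be.
Qed.

Lemma act2_along_tmx (QV : 'rV[R]_n * 'rV[R]_(n + n)) (Z := ((x, QV.1), QV.2) : Tan (Tan M)) z' :
  z' *m tmx (N := Tan (Tan M)) (N' := Tan (Tan M)) c d act2_along Z =
  act2_velocity (phi (N := H2 M) (c, (c, d)) (b x)) (zu z' *m tmx (N' := H2 M) c (c, (c, d)) b x)
    (phi (N := Tan (Tan M)) c Z) z'.
Proof.
have [_ E] := act2_along_smap QV; rewrite -/Z in E.
have Eu : zu (phi (N := Tan (Tan M)) c Z) = phi c x by rewrite /zu !row_mxKl.
have sbz : smooth be (zu (phi (N := Tan (Tan M)) c Z)) by rewrite Eu; exact: smooth_be.
refine (etrans (J_mul z' (der_near (act2_fun_der (smooth_derJ sbz)) E)) _).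
rewrite Eu.
have -> : be (phi c x) = phi (N := H2 M) (c, (c, d)) (b x) by rewrite /be /loc phiK.
exact: erefl.
Qed.
End ActAlong2.

(** The velocity z' moves the vector z and, through its base component, the jet b(x) as well; the
    derivative of b is the linear part of eta. *)
Lemma act3_coord (eta : H3 M) (X : Tan (Tan (Tan M))) c d : B111nh eta -> X.1.1.1 = src eta ->
  dom c (src eta) -> dom d (tgt (tgt (tgt eta))) ->
  phi (N := Tan (Tan (Tan M))) d (act3 eta X) =
  let z := lsubmx (phi (N := Tan (Tan (Tan M))) c X) in
  let z' := rsubmx (phi (N := Tan (Tan (Tan M))) c X) in
  let p := phi (N := H2 M) (c, (c, d)) (tgt eta) in
  row_mx (act2_fun p z) (act2_velocity p (zu z' *m hom_mx (N' := H2 M) c (c, (c, d)) eta) z z').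
Proof.
move=> he EX cx dy.
have hb : represents (B11nh (M := M)) srcf (@beta2 _ _ M) (rep3 eta) eta := rep_spec he.
have cxe := cx; set b := rep3 eta in hb; have [bb Ux Ej] := hb.
case: X EX => [[[x Q] V] W] EX; have {}EX : x = src eta := EX; rewrite -EX in Ux cx.
have -> : act3 eta (((x, Q), V), W) = tmap (act2_along b) (((x, Q), V), W) by [].
have Et : tgt eta = b x by rewrite EX; exact: (congr1 (@tgt _ _ _ _ _) Ej).
have dy' : dom d (tgt (tgt (b x))) by rewrite -Et.
have [sF _] := act2_along_smap bb Ux cx dy' (Q, V).
have cZ : dom (N := Tan (Tan M)) c ((x, Q), V) by [].
have [hB Es] : B11nh (b x) /\ src (b x) = x by have [_ h _ _] := bb; exact: h.
have dZ : dom (N := Tan (Tan M)) d (act2_along b ((x, Q), V)).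
  by rewrite -[dom _ _]/(dom d (act2_along b ((x, Q), V)).1.1) (act2_base hB).
have cs : dom c (src (b x)) by rewrite Es.
have [Es' _ _] := B11nh_elim aM hB cs dy'.
have cds : dom (N := H2 M) (c, (c, d)) (tgt eta).
  by rewrite Et; split; [exact: cs|split; [rewrite /= Es'; exact: cs|exact: dy']].
have EJ := represents_hom_mx aM aH2 (d := (c, (c, d)) : chart (H2 M)) hb cxe cds.
refine (etrans (phi_tmap (N := Tan (Tan M)) (N' := Tan (Tan M)) (f := act2_along b) (X := (((x, Q), V),
  W)) (c := c) (d := d) aTT aTT sF cZ dZ) _).
have -> := act2_along_tmx bb Ux cx dy' (Q, V).
have P1 : phi (N := Tan (Tan M)) d (act2_along b ((x, Q), V)) =
    act2_fun (phi (N := H2 M) (c, (c, d)) (b x)) (phi (N := Tan (Tan M)) c ((x, Q), V)) by exact: phi_act2_along.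
rewrite P1 -EX in EJ *.
rewrite EJ Et.
have E : phi (N := Tan (Tan M)) c ((x, Q), V) = lsubmx (phi (N := Tan (Tan (Tan M))) c (((x, Q), V),
  W)) by rewrite row_mxKl.
by cbv zeta; rewrite -E.
Qed.

End Act.

(** * The involution *)
Section Kappa.
Context {R : realType} {n : nat} (M : charted R n) (aM : atlas M).
Notation srcf := (@src _ _ _ _ _).
Let aH2 := atlas_H2 aM.
Let aT : atlas (Tan M) := atlas_Tan aM.
Let aTT : atlas (Tan (Tan M)) := atlas_Tan aT.
Let aTTT : atlas (Tan (Tan (Tan M))) := atlas_Tan aTT.
Let k1 := (n + n + n * n)%N.
Let k2 := (n + k1 + n * k1)%N.

Definition TTvec (u q r w : 'rV[R]_n) : 'rV[R]_((n + n) + (n + n)) :=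
  row_mx (row_mx u q) (row_mx r w).

Lemma TTvec_inj u q r w u' q' r' w' : TTvec u q r w = TTvec u' q' r' w' -> [/\ u = u', q = q', r = r' & w = w'].
Proof. by move=> /eq_row_mx [/eq_row_mx [-> ->] /eq_row_mx [-> ->]]. Qed.

Lemma TTvec_surj z : exists u q r w, z = TTvec u q r w.
Proof.
exists (lsubmx (lsubmx z)), (rsubmx (lsubmx z)), (lsubmx (rsubmx z)), (rsubmx (rsubmx z)).
by rewrite /TTvec !hsubmxK.
Qed.

Lemma zmk u q r w : [/\ zu (TTvec u q r w) = u, zq (TTvec u q r w) = q,
  zr (TTvec u q r w) = r & zw (TTvec u q r w) = w].
Proof. by rewrite /zu /zq /zr /zw /TTvec !(row_mxKl, row_mxKr). Qed.

Lemma act2_fun_TTvec (p : 'rV[R]_k2) u q r w : act2_fun p (TTvec u q r w) =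
  TTvec (Yc (Wp p)) (q *m Xi (Wp p)) (r *m Ep p) (w *m Xi (Wp p) + q *m vec_mx (r *m Bp p)).
Proof. by have [_ Eq Er Ew] := zmk u q r w; rewrite /act2_fun Eq Er Ew. Qed.

Lemma act2_velocity_TTvec (p p' : 'rV[R]_k2) u q r w a q' r' w' : act2_velocity p p' (TTvec u q r w) (TTvec a q' r'
  w') =
  TTvec (Yc (Wp p')) (q' *m Xi (Wp p) + q *m Xi (Wp p')) (r' *m Ep p + r *m Ep p')
     ((w' *m Xi (Wp p) + w *m Xi (Wp p')) +
       (q' *m vec_mx (r *m Bp p) + q *m vec_mx (r' *m Bp p + r *m Bp p'))).
Proof.
have [_ Eq Er Ew] := zmk u q r w; have [_ Eq' Er' Ew'] := zmk a q' r' w'.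
by rewrite /act2_velocity Eq Er Ew Eq' Er' Ew'.
Qed.

Definition kappaC (zz : 'rV[R]_(((n + n) + (n + n)) + ((n + n) + (n + n)))) :
  'rV[R]_(((n + n) + (n + n)) + ((n + n) + (n + n))) :=
  row_mx (row_mx (lsubmx (lsubmx zz)) (lsubmx (rsubmx zz))) (row_mx (rsubmx (lsubmx zz)) (rsubmx (rsubmx zz))).

Lemma kappaC_TTvec u q r w a q' r' w' :
  kappaC (row_mx (TTvec u q r w) (TTvec a q' r' w')) = row_mx (TTvec u q a q') (TTvec r w r' w').
Proof. by rewrite /kappaC /TTvec !(row_mxKl, row_mxKr). Qed.

(** [flip] uses components in preferred charts, so the formula is given in the preferred chart at
    the base point. For this reason c and d are preferred charts in what follows. *)
Lemma kappa_coord (X : Tan (Tan (Tan M))) (c := chart_at X.1.1.1) :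
  phi (N := Tan (Tan (Tan M))) c (kappa X) = kappaC (phi (N := Tan (Tan (Tan M))) c X).
Proof.
rewrite /c {c}; case: X => [[[x Q] V] W].
have E3 (Z : Tan (Tan M)) v : phi (N := Tan (Tan (Tan M))) (chart_at Z.1.1) (Z,
  v) = row_mx (phi (N := Tan (Tan M)) (chart_at Z.1.1) Z) v.
  exact: (phi_Tan_chart_at aTT Z v).
have E2 (Z : Tan M) v : phi (N := Tan (Tan M)) (chart_at Z.1) (Z, v) = row_mx (phi (N := Tan M) (chart_at Z.1) Z) v.
  exact: (phi_Tan_chart_at aT Z v).
rewrite -[kappa _]/(((x, Q), lsubmx W), row_mx V (rsubmx W)).
rewrite (E3 ((x, Q), lsubmx W)) (E3 ((x, Q), V)) (E2 (x, Q) (lsubmx W)) (E2 (x, Q) V).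
by rewrite /kappaC !(row_mxKl, row_mxKr).
Qed.

Lemma TTT_inj (c : chart M) (X Y : Tan (Tan (Tan M))) : dom c X.1.1.1 -> dom c Y.1.1.1 ->
  phi (N := Tan (Tan (Tan M))) c X = phi (N := Tan (Tan (Tan M))) c Y -> X = Y.
Proof.
move=> cX cY E.
have KX := phiK (N := Tan (Tan (Tan M))) aTTT (c := c) (x := X) cX.
have KY := phiK (N := Tan (Tan (Tan M))) aTTT (c := c) (x := Y) cY.
by rewrite -KX -KY E.
Qed.

Lemma TTT_exists (x : M) zz (c := chart_at x) : zu (lsubmx zz) = phi c x ->
  exists X : Tan (Tan (Tan M)), X.1.1.1 = x /\ phi (N := Tan (Tan (Tan M))) c X = zz.
Proof.
move=> Eu; have cx : dom c x := domx aM x.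
have g0 : cimage c (phi c x) := cimage_phi aM cx.
pose X := inv (N := Tan (Tan (Tan M))) c zz.
have EX : X.1.1.1 = x by rewrite /X /= -[lsubmx (lsubmx (lsubmx zz))]/(zu (lsubmx zz)) Eu phiK.
exists X; split; first exact: EX.
have tE m (N : charted R m) (aN : atlas N) (e : chart N) y (v : 'rV[R]_m) : dom e y ->
   v *m trans e (chart_at y) y *m trans (chart_at y) e y = v.
  by move=> ey; rewrite -mulmxA (trans_comp aN ey (domx aN y) ey) (trans_id aN ey) mulmx1.
have gT m (N : charted R m) (aN : atlas N) (e : chart N) z : cimage e (lsubmx z) -> cimage (N := Tan N) e z.
  move=> [dz Ez]; split; first exact: dz.
  by rewrite /= Ez (tE _ _ aN) // hsubmxK.
have : cimage (N := Tan (Tan (Tan M))) c zz.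
  apply: (gT _ _ aTT); apply: (gT _ _ aT); apply: (gT _ _ aM).
  by rewrite -[lsubmx (lsubmx (lsubmx zz))]/(zu (lsubmx zz)) Eu.
by case.
Qed.

Lemma act3_base (eta : H3 M) (X : Tan (Tan (Tan M))) : B111nh eta -> X.1.1.1 = src eta ->
  (act3 eta X).1.1.1 = tgt (tgt (tgt eta)).
Proof.
move=> he EX; have hb : represents (B11nh (M := M)) srcf (@beta2 _ _ M) (rep3 eta) eta := rep_spec he.
have [bb Ux Ej] := hb.
have [_ /(_ _ Ux) [hB Es] _ _] := bb.
have -> : tgt eta = rep3 eta (src eta) by exact: (congr1 (@tgt _ _ _ _ _) Ej).
rewrite -EX in hB Es *.
exact: (act2_base (Z := X.1) hB (esym Es)).
Qed.

(** Differentiates three identities that hold all along the representing section: the jet and its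
    target both have the base point as source, and the leading block of the linear part is 1. *)
Lemma B111nh_elim (eta : H3 M) c d : B111nh eta -> dom c (src eta) -> dom d (tgt (tgt (tgt eta))) ->
  [/\ B11nh (tgt eta), src (tgt eta) = src eta &
   forall v : 'rV[R]_n, let p' := v *m hom_mx (N' := H2 M) c (c, (c, d)) eta in
     [/\ lsubmx (lsubmx p') = v, Xc (Wp p') = v & lsubmx (lsubmx (Jp p')) = 0]].
Proof.
move=> he cx dy; have hb : represents (B11nh (M := M)) srcf (@beta2 _ _ M) (rep3 eta) eta := rep_spec he.
set b := rep3 eta in hb; have [bb Ux Ej] := hb.
have Et : tgt eta = b (src eta) by exact: (congr1 (@tgt _ _ _ _ _) Ej).
have [hB Es] : B11nh (b (src eta)) /\ src (b (src eta)) = src eta by have [_ h _ _] := bb; exact: h.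
split; [by rewrite Et|by rewrite Et|move=> v].
have dy' : dom d (tgt (tgt (b (src eta)))) by rewrite -Et.
have cs : dom c (src (b (src eta))) by rewrite Es.
have [Es' _ _] := B11nh_elim aM hB cs dy'.
have cds : dom (N := H2 M) (c, (c, d)) (tgt eta).
  by rewrite Et; split; [exact: cs|split; [rewrite /= Es'; exact: cs|exact: dy']].
rewrite (represents_hom_mx aM aH2 (d := (c, (c, d)) : chart (H2 M)) hb cx cds) /=.
have smooth_be := smooth_be aM bb Ux cx dy'.
have D := smooth_derJ smooth_be.
have sb0 : smap (@beta2 _ _ M \o b) (src eta) by exact: bis_be bb Ux.
have [dn _] := smap_in_charts aM aM sb0 cx dy'.
have hn := mnear_chart aM cx (mnearI (bis_near aM bb Ux) dn).
pose be := loc (N := M) (N' := H2 M) c (c, (c, d)) b.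
have near3 : \forall u \near phi c (src eta), [/\ lsubmx (lsubmx (be u)) = u,
  Xc (Wp (be u)) = u & lsubmx (lsubmx (Jp (be u))) = 1%:M].
  apply: filterS hn => u [cu [Uu du] Eu].
  have [hBu Esu] : B11nh (b (inv c u)) /\ src (b (inv c u)) = inv c u by have [_ h _ _] := bb; exact: h.
  have csu : dom c (src (b (inv c u))) by rewrite Esu.
  have [Esu' _ [e [B [_ EJ]]]] := B11nh_elim aM hBu csu du.
  rewrite /be /loc; set j := b (inv c u) in Esu Esu' EJ *.
  have -> : lsubmx (lsubmx (phi (N := H2 M) (c, (c, d)) j)) = phi c (src j) by rewrite phi_HomB !row_mxKl.
  have -> : Wp (phi (N := H2 M) (c, (c, d)) j) = phi (N := H1 M) (c,
    d) (tgt j) by rewrite /Wp phi_HomB row_mxKl row_mxKr.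
  have -> : Jp (phi (N := H2 M) (c, (c, d)) j) = hom_mx (N' := H1 M) c (c, d) j by rewrite /Jp phi_HomB row_mxKr mxvecK.
  by rewrite Xc_phi Esu' Esu EJ !row_mxKl; split.
split.
- have D1 := linear_mx_der (lin_comp (@lin_lsub R 1 (n + k1) (n * k1)) (@lin_lsub R 1 n k1)) D.
  have E : \forall u \near phi c (src eta), lsubmx (lsubmx (be u)) = u by apply: filterS near3 => u [].
  exact: (der_uniq (der_near D1 E) (der_id _) v).
- have lX : linear (@Xc R n) by exact: lin_comp (@lin_lsub _ _ _ _) (@lin_lsub _ _ _ _).
  have D1 := linear_mx_der (lin_comp (@lin_Wp R n) lX) D.
  have E : \forall u \near phi c (src eta), Xc (Wp (be u)) = u by apply: filterS near3 => u [].
  exact: (der_uniq (der_near D1 E) (der_id _) v).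
have D1 := linear_mx_der (lin_comp (lin_comp (@lin_Jp R n) (@lin_lsub _ _ _ _)) (@lin_lsub _ _ _ _)) D.
have E : \forall u \near phi c (src eta), lsubmx (lsubmx (Jp (be u))) = 1%:M by apply: filterS near3 => u [].
exact: (der_uniq (der_near D1 E) (der_cst _ _) v).
Qed.

End Kappa.

(** * The action of S(xi) conjugated by kappa *)

Section KappaSS.
Context {R : realType} {n : nat} (M : charted R n) (aM : atlas M).
Let k1 := (n + n + n * n)%N.
Let k2 := (n + k1 + n * k1)%N.
Variable s : M -> H2 M.
Hypothesis hs : symmetry_jet s.
Variables (xi : H1 M).
Hypothesis uxi : B1 M xi.
Let c := chart_at (src xi).
Let d := chart_at (tgt xi).
Let cx : dom c (src xi) := domx aM _.
Let dy : dom d (tgt xi) := domx aM _.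
Let w := phi (N := H1 M) (c, d) xi.
Let A := affine_block s c d w.

Definition Dist_deriv v : 'M[R]_(n, k1) := ddir (Dist_mx s c d) w (v *m Dist_mx s c d w).

(** The first two blocks of L are 1 and Xi. Along v L they move by 0 and by the last block A_v of v
    L. *)
Lemma Dist_deriv_blocks v : lsubmx (lsubmx (Dist_deriv v)) = 0 /\ rsubmx (lsubmx (Dist_deriv v)) = A v.
Proof.
have D := smooth_der (smooth_Dist_mx aM hs cx dy).
have D1 := linear_mx_der (lin_comp (@lin_lsub R n (n + n) (n * n)) (@lin_lsub _ _ _ _)) D.
have D2 := linear_mx_der (lin_comp (@lin_lsub R n (n + n) (n * n)) (@lin_rsub _ _ _ _)) D.
have E1 : \forall u \near w, lsubmx (lsubmx (Dist_mx s c d u)) = 1%:M.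
  by apply: filterE => u; rewrite /Dist_mx !row_mxKl.
have E2 : \forall u \near w, rsubmx (lsubmx (Dist_mx s c d u)) = Xi u.
  by apply: filterE => u; rewrite /Dist_mx row_mxKl row_mxKr.
split; first exact: (der_uniq (der_near D1 E1) (der_cst _ _)).
have h := der_uniq (der_near D2 E2) (linear_mx_der (@lin_Xi R n) (der_id w)) (v *m Dist_mx s c d w).
refine (etrans h _); rewrite mul_Dist_mx.
by rewrite /Xi /H1_coord row_mxKr mxvecK.
Qed.

Lemma Dist_deriv_linear : linear Dist_deriv.
Proof.
move=> a x y; have := der_linear (smooth_der (smooth_Dist_mx aM hs cx dy)).
by rewrite /Dist_deriv /ddir mulmxDl -scalemxAl => ->.
Qed.

(** The pivot of the proof: integrability at xi, the equation kappa(S(xi)) = S(xi) and the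
    invariance of torsion and curvature are each shown equivalent to it. *)
Definition Dist_sym := forall v v' : 'rV[R]_n, v' *m Dist_deriv v = v *m Dist_deriv v'.

Definition act3_fun (p : 'rV[R]_k2) (J : 'M[R]_(n, k2)) zz : 'rV[R]_(((n + n) + (n + n)) + ((n + n) + (n + n))) :=
  row_mx (act2_fun p (lsubmx zz)) (act2_velocity p (zu (rsubmx zz) *m J) (lsubmx zz) (rsubmx zz)).

Definition Sext_point : 'rV[R]_k2 := row_mx (row_mx (phi c (src xi)) w) (mxvec (Dist_mx s c d w)).

Lemma Sext_point_blocks : [/\ Wp Sext_point = w, Jp Sext_point = Dist_mx s c d w,
  Ep Sext_point = Xi w & Bp Sext_point = affine_mx s c d w].
Proof.
have EJ : Jp Sext_point = Dist_mx s c d w by rewrite /Jp /Sext_point row_mxKr mxvecK.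
by split; rewrite /Ep /Bp ?EJ // /Wp /Sext_point /Dist_mx !(row_mxKl, row_mxKr).
Qed.

(* the velocity in direction v of a section of H2 with value S(xi) at src xi, whose
   matrix part moves with velocity D v *)
Definition Sext_velocity (D : 'rV[R]_n -> 'M[R]_(n, k1)) (v : 'rV[R]_n) : 'rV[R]_k2 :=
  row_mx (row_mx v (v *m Dist_mx s c d w)) (mxvec (D v)).

Lemma Sext_velocity_blocks D v : [/\ Wp (Sext_velocity D v) = H1_coord v (v *m Xi w) (A v),
  Jp (Sext_velocity D v) = D v,
  Ep (Sext_velocity D v) = rsubmx (lsubmx (D v)) & Bp (Sext_velocity D v) = rsubmx (D v)].
Proof.
have EJ : Jp (Sext_velocity D v) = D v by rewrite /Jp /Sext_velocity row_mxKr mxvecK.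
by split; rewrite /Ep /Bp ?EJ // /Wp /Sext_velocity row_mxKl row_mxKr mul_Dist_mx.
Qed.

Lemma mul_affine_mx_vec v : vec_mx (v *m affine_mx s c d w) = A v.
Proof. by rewrite mul_affine_mx mxvecK. Qed.

Lemma act3_fun_TTvec D J u q r z a q' r' z' : (forall v, v *m J = Sext_velocity D v) ->
  act3_fun Sext_point J (row_mx (TTvec u q r z) (TTvec a q' r' z')) =
  row_mx (TTvec (Yc w) (q *m Xi w) (r *m Xi w) (z *m Xi w + q *m A r))
   (TTvec (a *m Xi w) (q' *m Xi w + q *m A a) (r' *m Xi w + r *m rsubmx (lsubmx (D a)))
    ((z' *m Xi w + z *m A a) + (q' *m A r + q *m vec_mx (r' *m affine_mx s c d w + r *m rsubmx (D a))))).
Proof.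
move=> hJ; rewrite /act3_fun row_mxKl row_mxKr act2_fun_TTvec; have [-> _ _ _] := zmk a q' r' z'.
rewrite hJ act2_velocity_TTvec; have [-> _ -> ->] := Sext_point_blocks; have [-> _ -> ->] := Sext_velocity_blocks D a.
rewrite mul_affine_mx_vec.
have -> : Yc (H1_coord a (a *m Xi w) (A a)) = a *m Xi w by rewrite /Yc /H1_coord row_mxKl row_mxKr.
by have -> : Xi (H1_coord a (a *m Xi w) (A a)) = A a by rewrite /Xi /H1_coord row_mxKr mxvecK.
Qed.

Lemma mul_blocks (r : 'rV[R]_n) (X : 'M[R]_(n, k1)) : r *m X =
  row_mx (row_mx (r *m lsubmx (lsubmx X)) (r *m rsubmx (lsubmx X))) (r *m rsubmx X).
Proof. by rewrite -[in LHS](hsubmxK X) -[in LHS](hsubmxK (lsubmx X)) !mul_mx_row. Qed.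

(** [kappaC] exchanges (r, z) with (a, q'). By [act3_fun_TTvec] every term respects this exchange
    except those carrying [D] or [Dist_deriv], and comparing these gives the transposition. *)
Lemma kappa_act3_fun D J J' : (forall v, v *m J = Sext_velocity Dist_deriv v) ->
  (forall v, v *m J' = Sext_velocity D v) ->
  (forall v, lsubmx (lsubmx (D v)) = 0) ->
  (forall zz, act3_fun Sext_point J' zz = kappaC (act3_fun Sext_point J (kappaC zz))) <->
  (forall a r, r *m D a = a *m Dist_deriv r).
Proof.
move=> hJ hJ' D0.
have DLr r : rsubmx (lsubmx (Dist_deriv r)) = A r by have [] := Dist_deriv_blocks r.
split=> [h a r|h zz].
  (* With only q, r and a nonzero, the last two components of the velocity consist of the derivative
     terms alone. *)
  have Z (q : 'rV[R]_n) := h (row_mx (TTvec 0 q r 0) (TTvec a 0 0 0)).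
  have Z' (q : 'rV[R]_n) : [/\ r *m rsubmx (lsubmx (D a)) = a *m A r &
     q *m vec_mx (r *m rsubmx (D a)) = q *m vec_mx (a *m rsubmx (Dist_deriv r))].
    have := Z q; rewrite kappaC_TTvec (act3_fun_TTvec _ _ _ _ _ _ _ _ hJ) (act3_fun_TTvec _ _ _ _ _ _ _ _ hJ')
      kappaC_TTvec.
    move=> /eq_row_mx [_ /TTvec_inj [_ _ E1 E2]].
    move: E1 E2; rewrite !mul0mx !add0r DLr => -> E2; split; [by []|exact: E2].
  rewrite (mul_blocks r (D a)) (mul_blocks a (Dist_deriv r)) D0 (Dist_deriv_blocks r).1 DLr !mulmx0.
  have [-> _] := Z' 0; congr row_mx.
  apply: (can_inj (@vec_mxK _ _ _)); apply: eq_mul_rV => q.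
  by have [_] := Z' q.
have hD a r : r *m rsubmx (lsubmx (D a)) = a *m A r /\ r *m rsubmx (D a) = a *m rsubmx (Dist_deriv r).
  have := h a r; rewrite (mul_blocks r (D a)) (mul_blocks a (Dist_deriv r)) DLr.
  by move=> /eq_row_mx [/eq_row_mx [_ ->] ->].
have -> : zz = row_mx (lsubmx zz) (rsubmx zz) by rewrite hsubmxK.
have [u [q [r [z ->]]]] := TTvec_surj (lsubmx zz); have [a [q' [r' [z' ->]]]] := TTvec_surj (rsubmx zz).
rewrite kappaC_TTvec (act3_fun_TTvec _ _ _ _ _ _ _ _ hJ) (act3_fun_TTvec _ _ _ _ _ _ _ _ hJ') kappaC_TTvec.
have [-> ->] := hD a r; rewrite DLr.
(* z A_a and q' A_r trade places under the exchange. *)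
by rewrite [X in row_mx _ (TTvec _ _ _ X)]addrACA.
Qed.

Lemma hom_mx_SSext (v : 'rV[R]_n) : v *m hom_mx (N' := H2 M) c (c, (c, d)) (SSext s xi) = Sext_velocity Dist_deriv v.
Proof. by have [_ _ _ ->] := SS_coord aM hs uxi cx dy. Qed.

Lemma phi_Sext_point : phi (N := H2 M) (c, (c, d)) (Sext s xi) = Sext_point.
Proof.
have [_ E1 E2 E3] := Sext_coord aM hs uxi cx dy.
by rewrite phi_HomB E1 E2 E3.
Qed.

Definition kappa_spec (eta' : H3 M) :=
  [/\ B111nh eta', src eta' = src (SSext s xi) &
      forall X : Tan (Tan (Tan M)), tbase (tbase (tbase X)) = src (SSext s xi) ->
        act3 eta' X = kappa (act3 (SSext s xi) (kappa X))].

Lemma act3_in_chart (eta' : H3 M) (X : Tan (Tan (Tan M))) : B111nh eta' -> src eta' = src xi ->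
  tgt eta' = Sext s xi -> X.1.1.1 = src xi ->
  phi (N := Tan (Tan (Tan M))) d (act3 eta' X) =
  act3_fun Sext_point (hom_mx (N' := H2 M) c (c, (c, d)) eta') (phi (N := Tan (Tan (Tan M))) c X).
Proof.
move=> he Es Et EX; have [_ E1 E2 _] := Sext_coord aM hs uxi cx dy.
have cx' : dom c (src eta') by rewrite Es.
have dy' : dom d (tgt (tgt (tgt eta'))) by rewrite Et E2.
have EX' : X.1.1.1 = src eta' by rewrite Es.
by rewrite (act3_coord aM he EX' cx' dy') /act3_fun -phi_Sext_point -Et.
Qed.

Lemma act3_tgt (eta' : H3 M) (X : Tan (Tan (Tan M))) : B111nh eta' -> src eta' = src xi ->
  tgt eta' = Sext s xi -> X.1.1.1 = src xi -> (act3 eta' X).1.1.1 = tgt xi.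
Proof.
move=> he Es Et EX; have [_ E1 E2 _] := Sext_coord aM hs uxi cx dy.
by rewrite (act3_base he) ?Et ?E2 // Es.
Qed.

Lemma kappaE_act3_fun (X : Tan (Tan (Tan M))) : X.1.1.1 = src xi ->
  phi (N := Tan (Tan (Tan M))) d (kappa (act3 (SSext s xi) (kappa X))) =
  kappaC (act3_fun Sext_point (hom_mx (N' := H2 M) c (c, (c,
    d)) (SSext s xi)) (kappaC (phi (N := Tan (Tan (Tan M))) c X))).
Proof.
have [hSS S1 S2 _] := SS_coord aM hs uxi cx dy.
move=> EX.
have EK : (kappa X).1.1.1 = src xi by [].
have B := act3_tgt hSS S1 S2 EK.
have := kappa_coord aM (act3 (SSext s xi) (kappa X)); rewrite B -/d => ->.
rewrite (act3_in_chart hSS S1 S2 EK).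
by have := kappa_coord aM X; rewrite EX -/c => ->.
Qed.

(** The specification tests vectors over src xi only, whereas the coordinate identity is about all
    zz; the gap is the base coordinate. *)
Lemma kappa_spec_act3_fun (eta' : H3 M) : B111nh eta' -> src eta' = src xi -> tgt eta' = Sext s xi ->
  kappa_spec eta' <->
  (forall zz, act3_fun Sext_point (hom_mx (N' := H2 M) c (c, (c, d)) eta') zz =
     kappaC (act3_fun Sext_point (hom_mx (N' := H2 M) c (c, (c, d)) (SSext s xi)) (kappaC zz))).
Proof.
move=> he Es Et; have [hSS S1 S2 _] := SS_coord aM hs uxi cx dy.
have CZ J z z' u : act2_fun Sext_point z = act2_fun Sext_point (row_mx (row_mx u (rsubmx (lsubmx z))) (rsubmx z)) /\
   act2_velocity Sext_point J z z' = act2_velocity Sext_point J (row_mx (row_mx u (rsubmx (lsubmx z))) (rsubmx z)) z'.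
  by rewrite /act2_fun /act2_velocity /zq /zr /zw !(row_mxKl, row_mxKr).
split=> [[_ _ h] zz|h]; last first.
  split; [exact: he|by rewrite S1|move=> X EX].
  have EX' : X.1.1.1 = src xi by rewrite -S1 -EX.
  apply: (TTT_inj aM (c := d)).
  - by rewrite (act3_tgt he Es Et EX').
  - by rewrite -[(kappa _).1.1.1]/((act3 (SSext s xi) (kappa X)).1.1.1) (act3_tgt hSS S1 S2).
  by rewrite (act3_in_chart he Es Et EX') h kappaE_act3_fun.
(* Neither side depends on the base coordinate of zz, which is therefore replaced by that of src xi,
   where an actual vector X exists. *)
pose zz' := row_mx (row_mx (row_mx (phi c (src xi)) (rsubmx (lsubmx (lsubmx zz)))) (rsubmx (lsubmx zz))) (rsubmx zz).
have Eu : zu (lsubmx zz') = phi c (src xi) by rewrite /zz' /zu !row_mxKl.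
have [X [EX EP]] := TTT_exists aM Eu.
have EX' : tbase (tbase (tbase X)) = src (SSext s xi) by rewrite S1 -EX.
have E := congr1 (phi (N := Tan (Tan (Tan M))) d) (h X EX').
rewrite (act3_in_chart he Es Et EX) (kappaE_act3_fun EX) EP in E.
have CE J : act3_fun Sext_point J zz' = act3_fun Sext_point J zz.
  rewrite /act3_fun {2 3}/zz' row_mxKl.
  have -> : rsubmx zz' = rsubmx zz by rewrite /zz' row_mxKr.
  by have [<- <-] := CZ (zu (rsubmx zz) *m J) (lsubmx zz) (rsubmx zz) (phi c (src xi)).
have CK J : act3_fun Sext_point J (kappaC zz') = act3_fun Sext_point J (kappaC zz).
  have [u [q [r [z' E1]]]] := TTvec_surj (lsubmx zz); have [a [q' [r' [z'' E2]]]] := TTvec_surj (rsubmx zz).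
  have Ezz : zz = row_mx (TTvec u q r z') (TTvec a q' r' z'') by rewrite -E1 -E2 hsubmxK.
  have Ezz' : zz' = row_mx (TTvec (phi c (src xi)) q r z') (TTvec a q' r' z'').
    by rewrite /zz' E1 E2 /TTvec !(row_mxKl, row_mxKr).
  rewrite Ezz Ezz' !kappaC_TTvec /act3_fun !(row_mxKl, row_mxKr).
  have [-> ->] := CZ (zu (TTvec r z' r' z'') *m J) (TTvec (phi c (src xi)) q a q') (TTvec r z' r' z'') u.
  by rewrite /TTvec !(row_mxKl, row_mxKr).
exact: (etrans (esym (CE _)) (etrans E (congr1 kappaC (CK _)))).
Qed.

Lemma kappa_spec_SS : kappa_spec (SSext s xi) <-> Dist_sym.
Proof.
have [hSS S1 S2 _] := SS_coord aM hs uxi cx dy.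
rewrite (kappa_spec_act3_fun hSS S1 S2).
rewrite (kappa_act3_fun hom_mx_SSext hom_mx_SSext (fun v => (Dist_deriv_blocks v).1)).
by split=> h a r; rewrite h.
Qed.

End KappaSS.

(** * Existence and uniqueness of kappa(S(xi)) *)

Section KappaJet.
Context {R : realType} {n : nat} (M : charted R n) (aM : atlas M).
Notation srcf := (@src _ _ _ _ _).
Let aH1 := atlas_H1 aM.
Let aH2 := atlas_H2 aM.
Let k1 := (n + n + n * n)%N.
Let k2 := (n + k1 + n * k1)%N.
Variable s : M -> H2 M.
Hypothesis hs : symmetry_jet s.
Variables (xi : H1 M).
Hypothesis uxi : B1 M xi.
Let c := chart_at (src xi).
Let d := chart_at (tgt xi).
Let cx : dom c (src xi) := domx aM _.
Let dy : dom d (tgt xi) := domx aM _.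
Let w := phi (N := H1 M) (c, d) xi.
Let DLx := Dist_deriv s xi.

(** Effectiveness of the action, by testing on coordinate vectors: the position half of the result
    determines the target of eta block by block, and the velocity half determines its linear
    part. *)
Lemma act3_inj (eta : H3 M) : B111nh eta -> src eta = src xi ->
  (forall X : Tan (Tan (Tan M)), X.1.1.1 = src xi -> act3 eta X = act3 (SSext s xi) X) ->
  eta = SSext s xi.
Proof.
move=> he Es h; have [hSS S1 S2 _] := SS_coord aM hs uxi cx dy.
have [hS E1 E2 E3] := Sext_coord aM hs uxi cx dy.
have cx' : dom c (src eta) by rewrite Es.
have Ettt : tgt (tgt (tgt eta)) = tgt xi.
  pose X0 : Tan (Tan (Tan M)) := (((src xi, 0), 0), 0).
  by rewrite -(act3_base he (X := X0)) // h // (act3_tgt aM hs uxi hSS S1 S2).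
have dy' : dom d (tgt (tgt (tgt eta))) by rewrite Ettt.
have [h2 Es2 h1] := B111nh_elim aM he cx' dy'.
set p := phi (N := H2 M) (c, (c, d)) (tgt eta).
set J := hom_mx (N' := H2 M) c (c, (c, d)) eta in h1.
have key (q r z a q' r' z' : 'rV[R]_n) :
   row_mx (act2_fun p (TTvec (phi c (src xi)) q r z)) (act2_velocity p (a *m J) (TTvec (phi c (src xi)) q r z)
     (TTvec a q' r' z')) =
   row_mx (TTvec (Yc w) (q *m Xi w) (r *m Xi w) (z *m Xi w + q *m affine_block s c d w r))
   (TTvec (a *m Xi w) (q' *m Xi w + q *m affine_block s c d w a) (r' *m Xi w + r *m rsubmx (lsubmx (DLx a)))
    ((z' *m Xi w + z *m affine_block s c d w a) + (q' *m affine_block s c d w r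
      + q *m vec_mx (r' *m affine_mx s c d w + r *m rsubmx (DLx a))))).
  have Eu : zu (lsubmx (row_mx (TTvec (phi c (src xi)) q r z) (TTvec a q' r' z'))) = phi c (src xi).
    by rewrite row_mxKl; have [] := zmk (phi c (src xi)) q r z.
  have [X [EX EP]] := TTT_exists aM Eu.
  have EX' : X.1.1.1 = src eta by rewrite Es.
  have A1 := act3_coord aM he EX' cx' dy'; have A2 := act3_in_chart aM hs uxi hSS S1 S2 EX.
  have A3 := congr1 (phi (N := Tan (Tan (Tan M))) d) (h X EX).
  have A4 := etrans (esym A1) (etrans A3 A2); cbv zeta in A4; rewrite EP in A4.
  rewrite (act3_fun_TTvec _ _ _ _ _ _ _ _ (hom_mx_SSext aM hs uxi)) row_mxKl row_mxKr in A4.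
  by move: A4; have [-> _ _ _] := zmk a q' r' z'.
have K q r z a q' r' z' := key q r z a q' r' z'.
have P1 : Xi (Wp p) = Xi w.
  apply: eq_mul_rV => q; have := K q 0 0 0 0 0 0; rewrite act2_fun_TTvec.
  by move=> /eq_row_mx [/TTvec_inj [_ -> _ _] _].
have P2 : Ep p = Xi w.
  apply: eq_mul_rV => r; have := K 0 r 0 0 0 0 0; rewrite act2_fun_TTvec.
  by move=> /eq_row_mx [/TTvec_inj [_ _ -> _] _].
have P3 : Bp p = affine_mx s c d w.
  apply: eq_mul_rV => r; apply: (can_inj (@vec_mxK _ _ _)); rewrite mul_affine_mx_vec; apply: eq_mul_rV => q.
  have := K q r 0 0 0 0 0; rewrite act2_fun_TTvec.
  by move=> /eq_row_mx [/TTvec_inj [_ _ _ +] _]; rewrite !mul0mx !add0r.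
have cs : dom c (src (tgt eta)) by rewrite Es2.
have [Es1 _ [e [B [_ EJ]]]] := B11nh_elim aM h2 cs dy'.
have cs1 : dom c (src (tgt (tgt eta))) by rewrite Es1.
have Wpp : Wp p = phi (N := H1 M) (c, d) (tgt (tgt eta)) by rewrite /p phi_HomB /Wp row_mxKl row_mxKr.
have Jpp : Jp p = hom_mx (N' := H1 M) c (c, d) (tgt eta) by rewrite /p phi_HomB /Jp row_mxKr mxvecK.
have T1 : tgt (tgt eta) = xi.
  apply: (hom_eq aM aM cs1 dy'); first by rewrite Es1 Es2 Es.
    exact: Ettt.
  by rewrite -(Xi_phi c d) -Wpp P1 Xi_phi.
have T2 : tgt eta = Sext s xi.
  have cd : dom (N := H1 M) (c, d) (tgt (tgt eta)) by split.
  apply: (hom_eq (N' := H1 M) (d := (c, d)) aM aH1 cs cd); first by rewrite Es2 Es E1.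
    by rewrite T1 E2.
  rewrite E3 /Dist_mx EJ; move: P2 P3; rewrite /Ep /Bp Jpp EJ !(row_mxKl, row_mxKr) => -> ->.
  by [].
have cd2 : dom (N := H2 M) (c, (c, d)) (tgt eta) by split; [|split].
apply: (hom_eq (N' := H2 M) (d := (c, (c, d))) aM aH2 cx' cd2); first by rewrite Es S1.
  by rewrite T2 S2.
apply: eq_mul_rV => a; refine (etrans (_ : a *m J =
  Sext_velocity s xi (Dist_deriv s xi) a) (esym (hom_mx_SSext aM hs uxi a))).
(* The action does not see the blocks tied to the source; for every element of [B111nh] they are a,
   a and 0. *)
have [act1_along act2_along F3] := h1 a.
have Q1 : Yc (Wp (a *m J)) = a *m Xi w.
  by have := K 0 0 0 a 0 0 0; rewrite act2_velocity_TTvec => /eq_row_mx [_ /TTvec_inj [-> _ _ _]].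
have Q2 : Xi (Wp (a *m J)) = affine_block s c d w a.
  apply: eq_mul_rV => q; have := K q 0 0 a 0 0 0; rewrite act2_velocity_TTvec => /eq_row_mx [_ /TTvec_inj [_ + _ _]].
  by rewrite !mul0mx !add0r.
have Q3 : Ep (a *m J) = rsubmx (lsubmx (DLx a)).
  apply: eq_mul_rV => r; have := K 0 r 0 a 0 0 0; rewrite act2_velocity_TTvec => /eq_row_mx [_ /TTvec_inj [_ _ + _]].
  by rewrite !mul0mx !add0r.
have Q4 : Bp (a *m J) = rsubmx (DLx a).
  apply: eq_mul_rV => r; apply: (can_inj (@vec_mxK _ _ _)); apply: eq_mul_rV => q.
  have := K q r 0 a 0 0 0; rewrite act2_velocity_TTvec => /eq_row_mx [_ /TTvec_inj [_ _ _ +]].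
  by rewrite !mul0mx !add0r.
have -> : a *m J = row_mx (row_mx a (Wp (a *m J))) (mxvec (Jp (a *m J))).
  by rewrite -{2}act1_along /Wp /Jp vec_mxK !hsubmxK.
rewrite /Sext_velocity mul_Dist_mx -Q1 -Q2 -[X in H1_coord X]act2_along H1_coordE; congr (row_mx _ (mxvec _)).
rewrite -[LHS]hsubmxK -[RHS]hsubmxK -[X in row_mx X _ = _]hsubmxK -[X in _ = row_mx X _]hsubmxK.
by rewrite -/DLx -Q3 -Q4 F3 (Dist_deriv_blocks aM hs xi a).1.
Qed.

(** The transpose of v |-> D_(v L) L in its two vector arguments: by [kappa_act3_fun] the matrix
    part of kappa(S(xi)) must have this derivative. *)
Definition Dt (a : 'rV[R]_n) : 'M[R]_(n, k1) := lin1_mx (fun r => a *m DLx r).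

Lemma mul_Dt a r : r *m Dt a = a *m DLx r.
Proof.
apply: (mul_lin1 r (f := fun r => a *m DLx r)) => k x y.
by rewrite /DLx (Dist_deriv_linear aM hs) mulmxDr -scalemxAr.
Qed.

Lemma Dt_linear : linear Dt.
Proof.
move=> k a b; apply: eq_mul_rV => r.
by rewrite mulmxDr -scalemxAr !mul_Dt mulmxDl -scalemxAl.
Qed.

Lemma Dt0 a : lsubmx (lsubmx (Dt a)) = 0.
Proof.
apply: eq_mul_rV => r; rewrite mulmx0.
have := mul_Dt a r; rewrite (mul_blocks r (Dt a)) (mul_blocks a (DLx r)).
by move=> /eq_row_mx [/eq_row_mx [-> _] _]; rewrite (Dist_deriv_blocks aM hs xi r).1 mulmx0.
Qed.

Let u0 := phi c (src xi).
Definition EB (u : 'rV[R]_n) : 'M[R]_(n, k1) := Dist_mx s c d w + Dt (u - u0).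

(** [Dt] has zero leading block, so the leading block of [EB] stays 1, as [B11nh_intro] demands of
    the linear part of a jet. *)
Lemma EB_row u : EB u = row_mx (row_mx 1%:M (rsubmx (lsubmx (EB u)))) (rsubmx (EB u)).
Proof.
rewrite -[LHS]hsubmxK -[X in row_mx X _ = _]hsubmxK; congr (row_mx (row_mx _ _) _).
by rewrite /EB !linearD /= Dt0 addr0 /Dist_mx !row_mxKl.
Qed.

Lemma EB_smooth u : smooth EB u.
Proof.
apply: smooth_add; first exact: smooth_cst.
by apply: (smooth_lin Dt_linear); apply: smooth_add; [exact: smooth_id|exact: smooth_cst].
Qed.

Definition Vt (u : 'rV[R]_n) : 'rV[R]_k2 :=
  H2_coord u (w + (u - u0) *m Dist_mx s c d w) (rsubmx (lsubmx (EB u))) (rsubmx (EB u)).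

Lemma Vt_smooth u : smooth Vt u.
Proof.
apply: smooth_H2_coord; first exact: smooth_affine.
  by apply: smooth_rsub; apply: smooth_lsub; exact: EB_smooth.
by apply: smooth_rsub; exact: EB_smooth.
Qed.

Lemma Vt_J (v : 'rV[R]_n) : v *m 'J Vt u0 = Sext_velocity s xi Dt v.
Proof.
have dE : der EB u0 Dt.
  have h := derD (der_cst (Dist_mx s c d w) u0) (linear_mx_der Dt_linear (derD (der_id u0) (der_cst (- u0) u0))).
  by apply: (der_eq h) => z /=; rewrite add0r addr0.
have dW : der (fun u : 'rV[R]_n => w + (u - u0) *m Dist_mx s c d w) u0 (fun v => v *m Dist_mx s c d w).
  have h := derD (der_cst w u0) (der_mul (derD (der_id u0) (der_cst (- u0) u0)) (der_cst (Dist_mx s c d w) u0)).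
  by apply: (der_eq h) => z /=; rewrite add0r addr0 mulmx0 addr0.
have D := der_row (der_row (der_id u0) dW) (linear_mx_der (@lin_mxvec _ _ _) dE).
have E : \forall u \near u0, row_mx (row_mx u (w + (u - u0) *m Dist_mx s c d w)) (mxvec (EB u)) = Vt u.
  by apply: filterE => u; rewrite /Vt /H2_coord -EB_row.
exact: (J_mul v (der_near D E)).
Qed.

Let Et u := rsubmx (lsubmx (EB u)).

Let W1 : 'rV[R]_n -> 'rV[R]_k1 := fun u => w + (u - u0) *m Dist_mx s c d w.
Let Yt u : 'rV[R]_n := Yc w + (u - u0) *m Xi w.
Let Xt u : 'M[R]_n := Xi w + vec_mx ((u - u0) *m affine_mx s c d w).

(** The targets of the section under construction form an [h1sec] with affine base map, which is
    already known to be a bisection. *)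
Lemma W1E u : W1 u = H1_coord u (Yt u) (Xt u).
Proof.
rewrite /W1 /Dist_mx /Yt /Xt -H1_coord_affine /u0 -(Xc_phi c d) -/w H1_coordE; exact: erefl.
Qed.

Let h1 : lsec M (H1 M) := h1sec c d (Yc w) u0 (Xi w) Xt.

(* The jet of this section is kappa(S(xi)): the matrix part is affine in the chart,
   with prescribed derivative Dt. *)
Definition kappa_section : lsec M (H2 M) :=
  Lsec (fun x => ldom h1 x /\ Et (phi c x) \in unitmx) (csection (N' := H2 M) c (c, (c, d)) Vt).

Let uXi : Xi w \in unitmx. Proof. by rewrite Xi_phi (hom_mx_unit aM cx dy). Qed.

Lemma Xt_smooth u : smooth Xt u. Proof. exact: smooth_affine_vec. Qed.

Lemma kappa_sectionE x : ldom kappa_section x -> [/\ cimage (N := H2 M) (c, (c, d)) (Vt (phi c x)),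
   src (kappa_section x) = x, tgt (kappa_section x) = h1 x & hom_mx (N' := H1 M) c (c,
     d) (kappa_section x) = EB (phi c x)].
Proof.
move=> [Ux _]; have cx1 := Ux.1; have g1 := h1sec_good aM Ux.
rewrite -/(Yt _) -W1E in g1.
have g0 := cimage_phi aM cx1.
have -> : lfun kappa_section x = inv (N := H2 M) (c, (c, d)) (Vt (phi c x)) by [].
rewrite /Vt /H2_coord -EB_row; split.
- exact: (cimage_HomB aM aH1 _ g0 g1).
- by rewrite inv_HomB /= phiK.
- rewrite inv_HomB /tgt -/(W1 _) W1E; exact: erefl.
- exact: (hom_mx_inv aM aH1 _ g0 g1).
Qed.

Lemma h1_bis : bisection (B1 M) srcf (@beta1 _ _ M) h1.
Proof. by apply: h1sec_bisection; [exact: aM|exact: Xt_smooth|exact: uXi]. Qed.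

(** For a nonholonomic jet the second block need not equal the matrix of the target; it has to be
    invertible, which the domain of [kappa_section] ensures. *)
Lemma kappa_section_B11nh x : ldom kappa_section x -> B11nh (kappa_section x).
Proof.
move=> Ux; have [_ E1 E2 E3] := kappa_sectionE Ux; have [Ux1 uE] := Ux.
have [_ /(_ _ Ux1) [Bx sx] _ _] := h1_bis.
have [G1 act2_fun _] := h1secE aM Ux1.
have cx1 : dom c (src (kappa_section x)) by rewrite E1; exact: Ux1.1.
have dy1 : dom d (tgt (tgt (kappa_section x))) by rewrite E2 act2_fun; exact: Ux1.2.1.1.
have EJ := etrans E3 (EB_row (phi c x)).
apply: (B11nh_intro aM cx1 dy1 _ _ uE EJ); last by rewrite E2.
by rewrite E2 E1.
Qed.

Lemma kappa_section_bisection : bisection (B11nh (M := M)) srcf (@beta2 _ _ M) kappa_section.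
Proof.
have sE u : smooth Et u by apply: smooth_rsub; apply: smooth_lsub; exact: EB_smooth.
have oU : mopen (ldom kappa_section).
  apply/(mopenP aM) => x [Ux uE]; have cx1 := Ux.1.
  apply: (mnearI (bis_near aM h1_bis Ux)).
  apply/(mnearP aM _ cx1).
  apply: filterS2 (unitmx_near (smooth_cont (sE _)) uE) (atlas_near aM cx1 cx1) => u uu [_ _ Eu].
  by rewrite Eu.
apply: (affine_bisection (y0 := Yc w) (u0 := u0) (c := c) (d := d) aM aH2 oU uXi) => x Ux.
have [gV E1 E2 E3] := kappa_sectionE Ux; have [Ux1 uE] := Ux.
have [G1 act2_fun _] := h1secE aM Ux1.
have [S _ _] := csection_smap aM aH2 Ux1.1 gV (Vt_smooth _).
split; [exact: Ux1.1|exact: S|exact: (kappa_section_B11nh Ux)|exact: E1|].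
rewrite /beta2 /beta1 E2 act2_fun; split; first exact: Ux1.2.1.1.
exact: Ux1.2.1.2.
Qed.

(** Guards against an unspecified [kappa_jet]: [kappa_section] was built so that its derivative is
    the transposed one of [kappa_act3_fun]. *)
Lemma kappa_SS_exists : exists eta, kappa_spec s xi eta.
Proof.
have [hSS S1 S2 _] := SS_coord aM hs uxi cx dy.
have [hS T1 T2 T3] := Sext_coord aM hs uxi cx dy.
have Y0 : Yt u0 = Yc w by rewrite /Yt subrr mul0mx addr0.
have X0 : Xt u0 = Xi w by rewrite /Xt subrr mul0mx linear0 addr0.
have D0 : Dt 0 = 0 by apply: eq_mul_rV => r; rewrite mul_Dt mul0mx mulmx0.
have B0 : EB u0 = Dist_mx s c d w by rewrite /EB subrr D0 addr0.
have Ux : ldom kappa_section (src xi).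
  split; last by rewrite /Et -/u0 B0 /Dist_mx row_mxKl row_mxKr; exact: uXi.
  split; first exact: cx.
  rewrite -/u0 -/(Yt u0) Y0 X0; split; last exact: uXi.
  by rewrite /w Yc_phi; exact: cimage_phi.
have [gV E1 E2 E3] := kappa_sectionE Ux; have [Ux1 uE] := Ux.
have [G1 act2_fun act2_velocity] := h1secE aM Ux1.
have Th : h1 (src xi) = xi.
  have cs1 : dom c (src (h1 (src xi))) by rewrite G1.
  have ds1 : dom d (tgt (h1 (src xi))) by rewrite act2_fun -/u0 -/(Yt u0) Y0 Yc_phi phiK.
  refine (hom_eq aM aM cs1 ds1 _ _ _); first exact: G1.
    by rewrite act2_fun -/u0 -/(Yt u0) Y0 Yc_phi phiK.
  by rewrite act2_velocity -/u0 X0 Xi_phi.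
have Tt : kappa_section (src xi) = Sext s xi.
  have cs1 : dom c (src (kappa_section (src xi))) by rewrite E1.
  have ds1 : dom (N := H1 M) (c, d) (tgt (kappa_section (src xi))) by rewrite E2 Th; split.
  apply: (hom_eq (N' := H1 M) (d := (c, d)) aM aH1 cs1 ds1); first by rewrite E1 T1.
    by rewrite E2 Th T2.
  by rewrite E3 T3 -/u0 B0.
have [S SJ _] := csection_smap aM aH2 cx gV (Vt_smooth _).
have cdS : dom (N := H2 M) (c, (c, d)) (Sext s xi).
  by split; [rewrite /= T1; exact: cx|rewrite /= T2; split; [exact: cx|exact: dy]].
have cd2 : dom (N := H2 M) (c, (c, d)) (kappa_section (src xi)).
  exact: (eq_ind_r (fun z => dom (N := H2 M) (c, (c, d)) z) cdS Tt).
exists (jet kappa_section (src xi)).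
have he : B111nh (jet kappa_section (src xi)) by exists kappa_section; split;
  [exact: kappa_section_bisection|exact: Ux|].
apply: (kappa_spec_act3_fun aM hs uxi he erefl Tt).2.
have hJ v : v *m hom_mx (N' := H2 M) c (c, (c, d)) (jet kappa_section (src xi)) = Sext_velocity s xi Dt v.
  by rewrite (hom_mx_jet aM aH2 S cx cd2) SJ; exact: Vt_J.
by apply: (kappa_act3_fun aM hs (hom_mx_SSext aM hs uxi) hJ Dt0).2 => a r; exact: mul_Dt.
Qed.

(** Under the symmetry S(xi) itself meets the specification of [kappa_jet]; the two jets then act
    alike and [act3_inj] identifies them. *)
Lemma kappa_jetP : kappa_jet (SSext s xi) = SSext s xi <-> Dist_sym s xi.
Proof.
have [hSS S1 S2 _] := SS_coord aM hs uxi cx dy.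
have hk : kappa_spec s xi (kappa_jet (SSext s xi)).
  exact: (epsilon_spec _ (kappa_spec s xi) kappa_SS_exists).
split=> [E|K].
  by apply: (kappa_spec_SS aM hs uxi).1; rewrite E in hk.
have [he Es h] := hk; apply: (act3_inj he); first by rewrite Es.
move=> X EX; have [_ _ h'] := (kappa_spec_SS aM hs uxi).2 K.
have EX' : tbase (tbase (tbase X)) = src (SSext s xi) by rewrite S1 -EX.
by rewrite (h X EX') -(h' X EX').
Qed.

End KappaJet.

(** * The integrability locus *)
Section IntLocus.
Context {R : realType} {n : nat} (M : charted R n) (aM : atlas M).
Let aH1 := atlas_H1 aM.
Variable s : M -> H2 M.
Hypothesis hs : symmetry_jet s.

Lemma row_span_conj k m (v : 'rV[R]_m) (T Ti : 'M[R]_k) (l : 'M[R]_(k, m)) (T' T'i : 'M[R]_m) :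
  T *m Ti = 1%:M -> Ti *m T = 1%:M -> T' *m T'i = 1%:M ->
  (exists a : 'rV[R]_k, v = a *m l) <-> exists a : 'rV[R]_k, v *m T' = a *m (T *m l *m T').
Proof.
move=> TTi TiT TT'; split=> [[a ->]|[a E]].
  by exists (a *m Ti); rewrite !mulmxA -[a *m Ti *m T]mulmxA TiT mulmx1.
exists (a *m T); have := congr1 (mulmx^~ T'i) E.
by rewrite -mulmxA TT' mulmx1 !mulmxA -[X in _ = X]mulmxA TT' mulmx1.
Qed.

(** Tangency at all jets near xi becomes a condition in one fixed pair of charts, which can be
    differentiated. *)
Lemma Dist_coord (xi : H1 M) (c d : chart M) v : B1 M xi -> dom c (src xi) -> dom d (tgt xi) ->
  Dist s xi v <-> exists a : 'rV[R]_n, v *m trans (N := H1 M) (chart_at xi) (c,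
    d) xi = a *m Dist_mx s c d (phi (N := H1 M) (c, d) xi).
Proof.
move=> uxi cx dy; have [_ E1 E2 E3] := Sext_coord aM hs uxi cx dy.
have px := domx aM (src xi); have pX := domx aH1 xi.
have cd : dom (N := H1 M) (c, d) xi by split.
have EJ : hom_mx (N' := H1 M) c (c, d) (Sext s xi) =
   trans c (chart_at (src xi)) (src xi) *m lin (Sext s xi) *m trans (N := H1 M) (chart_at xi) (c, d) xi.
  by rewrite /hom_mx E1 E2.
rewrite -E3 EJ.
exact: (row_span_conj v _ (transK aM cx px) (transK aM px cx) (transK aH1 pX cd)).
Qed.

Variable xi : H1 M.
Hypothesis uxi : B1 M xi.
Let c := chart_at (src xi).
Let d := chart_at (tgt xi).
Let cx : dom c (src xi) := domx aM _.
Let dy : dom d (tgt xi) := domx aM _.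
Let C : chart (H1 M) := (c, d).
Let w := phi (N := H1 M) C xi.
Let cd : dom (N := H1 M) C xi. Proof. by split. Qed.

Let k1 := (n + n + n * n)%N.

Lemma lie_H1 (A B : H1 M -> 'rV[R]_k1) : lie A B xi =
  ddir (vf_comp (N := H1 M) C B) w (vf_comp (N := H1 M) C A w)
    - ddir (vf_comp (N := H1 M) C A) w (vf_comp (N := H1 M) C B w).
Proof. by []. Qed.

Lemma Xc_Dist_mx (a : 'rV[R]_n) u : Xc (a *m Dist_mx s c d u) = a.
Proof. by rewrite mul_Dist_mx /Xc /H1_coord !row_mxKl. Qed.

Lemma lin_Xc : linear (@Xc R n).
Proof. exact: lin_comp (@lin_lsub _ _ _ _) (@lin_lsub _ _ _ _). Qed.

Lemma Dist_at v : Dist s xi v <-> exists a : 'rV[R]_n, v = a *m Dist_mx s c d w.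
Proof.
have T : trans (N := H1 M) (chart_at xi) (c, d) xi = 1%:M by exact: (trans_id aH1 (domx aH1 xi)).
by have := Dist_coord v uxi cx dy; rewrite T mulmx1.
Qed.

(** As L has leading block 1, the coefficient of a tangent field is the leading block of the field
    itself, hence smooth, and the product rule applies. *)
Lemma ddir_tangent (A : H1 M -> 'rV[R]_k1) v : smooth (vf_comp (N := H1 M) C A) w ->
  mnear (N := H1 M) xi (fun z => Dist s z (A z)) ->
  exists a b : 'rV[R]_n, vf_comp (N := H1 M) C A w = a *m Dist_mx s c d w /\
   ddir (vf_comp (N := H1 M) C A) w v = b *m Dist_mx s c d w + a *m ddir (Dist_mx s c d) w v.
Proof.
move=> sA hA.
have E : \forall u \near w, Xc (vf_comp (N := H1 M) C A u) *m Dist_mx s c d u = vf_comp (N := H1 M) C A u.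
  apply: filterS (mnear_chart aH1 cd (mnearI hA (B1_near aM uxi))) => u [cu [Du uu] Eu].
  have [a Ea] := (Dist_coord _ uu cu.1 cu.2).1 Du.
  have E1 : vf_comp (N := H1 M) C A u = a *m Dist_mx s c d (phi (N := H1 M) C (inv (N := H1 M) C u)) by exact: Ea.
  have E2 := etrans E1 (congr1 (fun z => a *m Dist_mx s c d z) Eu).
  exact: (etrans (congr1 (fun z => Xc z *m Dist_mx s c d u) E2) (etrans (congr1 (fun z =>
    z *m Dist_mx s c d u) (Xc_Dist_mx a u)) (esym E2))).
have D := der_mul (linear_mx_der lin_Xc (smooth_der sA)) (smooth_der (smooth_Dist_mx aM hs cx dy)).
exists (Xc (vf_comp (N := H1 M) C A w)), (Xc (ddir (vf_comp (N := H1 M) C A) w v)).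
split; first by rewrite (nbhs_singleton E).
exact: (der_D v (der_near D E)).
Qed.

(** In the bracket of tangent fields f L and g L the derivatives of the coefficients contribute
    multiples of L; tangency is decided by g D_(f L) L - f D_(g L) L. *)
Lemma Int_Dist_sym : Int (B1 M) (Dist s) xi <-> Dist_sym s xi.
Proof.
split=> [[_ h]|K]; last first.
  split; first exact: uxi.
  move=> U A B Ux UW hA hB hAB; apply/Dist_at.
  have [oU sA] := (vfield_onP aH1 _ _).1 hA; have [_ sB] := (vfield_onP aH1 _ _).1 hB.
  have sA' := sA xi Ux C cd; have sB' := sB xi Ux C cd.
  have nU := mopen_near aH1 oU Ux.
  have nA : mnear (N := H1 M) xi (fun z => Dist s z (A z)) by apply: mnearS nU => z /hAB[].
  have nB : mnear (N := H1 M) xi (fun z => Dist s z (B z)) by apply: mnearS nU => z /hAB[].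
  have [a1 [b1 [EA DA]]] := ddir_tangent (vf_comp (N := H1 M) C B w) sA' nA.
  have [a2 [b2 [EB DB]]] := ddir_tangent (vf_comp (N := H1 M) C A w) sB' nB.
  have a12 : vf_comp (N := H1 M) C A w = a1 *m Dist_mx s c d w by exact: EA.
  have a22 : vf_comp (N := H1 M) C B w = a2 *m Dist_mx s c d w by exact: EB.
  exists (b2 - b1); rewrite lie_H1 DA DB EA EB.
  have := K a1 a2; rewrite /Dist_deriv -/c -/d -/C -/w => ->.
  by rewrite mulmxBl opprD addrACA subrr addr0.
suff key (v v' : 'rV[R]_n) : v' *m Dist_deriv s xi v = v *m Dist_deriv s xi v' by exact: key.
(* Coefficients constant in the chart: the bracket of two such fields is exactly the antisymmetrised
   derivative of L. *)
pose VF (v : 'rV[R]_n) : H1 M -> 'rV[R]_k1 := vf_of (N := H1 M) C (fun u => v *m Dist_mx s c d u).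
pose U : set (H1 M) := B1 M `&` dom (N := H1 M) C.
have oU : mopen U by apply: (mopenI aH1); [exact: B1_mopen|exact: mopen_dom].
have sV (a : 'rV[R]_n) z : U z -> smooth (fun u => a *m Dist_mx s c d u) (phi (N := H1 M) C z).
  by move=> [uz [cz dz]]; apply: smooth_mul; [exact: smooth_cst|exact: (smooth_Dist_mx aM hs cz dz)].
have vV a : vfield_on U (VF a).
  apply: (vfield_onP aH1 _ _).2; split; first exact: oU.
  move=> z Uz C' C'z.
  have S := vf_of_near aH1 Uz.2 (sV a z Uz).
  exact: ((smap_vfield aH1 (VF a) C'z).1 ((smap_vfield aH1 (VF a) Uz.2).2 S)).
have tV a z : U z -> Dist s z (VF a z).
  move=> [uz cz]; apply: (Dist_coord _ uz cz.1 cz.2).2; exists a.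
  rewrite /VF /vf_of -mulmxA.
  by rewrite (trans_comp aH1 cz (domx aH1 z) cz) (trans_id aH1 cz) mulmx1.
have Ux : U xi by split; [exact: uxi|exact: cd].
have [a Ea] : exists a : 'rV[R]_n, lie (VF v) (VF v') xi = a *m Dist_mx s c d w.
  apply/Dist_at; apply: (h U) => //; first by move=> z [].
  by move=> u Uu; split; exact: tV.
have EV (b : 'rV[R]_n) : vf_comp (N := H1 M) C (VF b) w = b *m Dist_mx s c d w.
  exact: (esym (nbhs_singleton (vf_ofE aH1 _ cd))).
have DV (b : 'rV[R]_n) z : ddir (vf_comp (N := H1 M) C (VF b)) w z = b *m ddir (Dist_mx s c d) w z.
  have D := der_mul (der_cst b w) (smooth_der (smooth_Dist_mx aM hs cx dy)).
  have := der_D z (der_near D (vf_ofE aH1 _ cd)).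
  by rewrite /ddir mul0mx add0r.
move: Ea; rewrite lie_H1 !DV !EV => Ea.
(* The leading block of the bracket is 0 and that of a L is a, so a = 0. *)
have XD (b b' : 'rV[R]_n) : Xc (b *m Dist_deriv s xi b') = 0.
  rewrite (mul_blocks b (Dist_deriv s xi b')) /Xc !row_mxKl (Dist_deriv_blocks aM hs xi b').1 mulmx0; exact: erefl.
have F : v' *m Dist_deriv s xi v - v *m Dist_deriv s xi v' = a *m Dist_mx s c d w by exact: Ea.
have lB (x y : 'rV[R]_k1) : Xc (x - y) = Xc x - Xc y by rewrite /Xc !linearB.
have G := etrans (esym (lB _ _)) (etrans (congr1 (@Xc R n) F) (Xc_Dist_mx a w)).
have a0 : a = 0 by refine (etrans (esym G) (etrans (congr2 (fun x y => x - y) (XD v' v) (XD v v')) (subrr 0))).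
rewrite a0 mul0mx in F; exact: (subr0_eq F).
Qed.

End IntLocus.

Lemma sub_swap (V : zmodType) (a b e f : V) : e - f = a - b <-> a - e = b - f.
Proof.
have H (a' b' e' f' : V) : e' - f' = a' - b' -> a' - e' = b' - f'.
  by move=> E; apply/eqP; rewrite subr_eq addrAC -addrA E addrC subrK.
by split=> [/H|E] //; apply: H; rewrite -opprB -[RHS]opprB E.
Qed.

(** * Torsion and curvature *)
Section Tensors.
Context {R : realType} {n : nat} (M : charted R n) (aM : atlas M).
Variable s : M -> H2 M.
Hypothesis hs : symmetry_jet s.

Section AtPoint.
Variable x : M.
Let c := chart_at x.
Let cx : dom c x := domx aM x.
Let u := phi c x.

Lemma nabla_at (X Y : M -> 'rV[R]_n) : smooth (vf_comp c Y) u ->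
  nabla s X Y x = ddir (vf_comp c Y) u (X x) + Y x *m Gamma s c u (X x).
Proof.
move=> sY; have := nabla_coord aM hs X cx sY.
by rewrite (trans_id aM cx) mulmx1 !(vf_comp_chart_at aM).
Qed.

Lemma lie_at (X Y : M -> 'rV[R]_n) :
  lie X Y x = ddir (vf_comp c Y) u (X x) - ddir (vf_comp c X) u (Y x).
Proof. by rewrite /lie /ddir -/c -/u !(vf_comp_chart_at aM). Qed.

(** The derivatives of the two fields cancel against the Lie bracket. *)
Lemma torsion_at (X Y : M -> 'rV[R]_n) : vfield_near x X -> vfield_near x Y ->
  torsion s X Y x = Y x *m Gamma s c u (X x) - X x *m Gamma s c u (Y x).
Proof.
move=> hX hY; have sX := vfield_near_smooth aM hX cx; have sY := vfield_near_smooth aM hY cx.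
rewrite /torsion (nabla_at X sY) (nabla_at Y sX) lie_at.
set a := ddir _ _ _; set b := ddir _ _ _; set e := _ *m _; set f := _ *m _.
by clearbody a b e f; rewrite opprD addrACA [X in X - _]addrC addrK.
Qed.

(** D_Y Z is written as Y times the Jacobian of Z, a product of smooth maps, ready to be
    differentiated once more. *)
Lemma smooth_nabla (Y Z : M -> 'rV[R]_n) : vfield_near x Y -> vfield_near x Z ->
  \forall z \near u, vf_comp c Z z \in predT /\
    vf_comp c Y z *m 'J (vf_comp c Z) z + vf_comp c Z z *m vec_mx (vf_comp c Y z *m Gamma_mx s c z) =
    vf_comp c (nabla s Y Z) z.
Proof.
move=> hY hZ; have sZ := vfield_near_smooth aM hZ cx.
apply: filterS2 (atlas_near aM cx cx) (smooth_nbhs sZ) => z [cz _ Ez] sz; split; first by [].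
have sz' : smooth (vf_comp c Z) (phi c (inv c z)) by rewrite Ez.
have H := nabla_coord aM hs Y cz sz'; rewrite Ez in H.
refine (etrans _ (esym H)).
by rewrite /ddir -(J_mul _ (smooth_der sz)).
Qed.

(** D_v Gamma(y) - D_y Gamma(v) plus a commutator, whose order Gamma(y) Gamma(v) reflects that
    matrices act on the right of row vectors. *)
Definition curvature_mx (c : chart M) (u v y : 'rV[R]_n) : 'M[R]_n :=
  vec_mx (y *m ddir (Gamma_mx s c) u v) - vec_mx (v *m ddir (Gamma_mx s c) u y)
   + Gamma s c u y *m Gamma s c u v - Gamma s c u v *m Gamma s c u y.

Lemma D_nabla (Y Z : M -> 'rV[R]_n) (v : 'rV[R]_n) : vfield_near x Y -> vfield_near x Z ->
  smooth (vf_comp c (nabla s Y Z)) u /\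
  ddir (vf_comp c (nabla s Y Z)) u v =
   (ddir (vf_comp c Y) u v *m 'J (vf_comp c Z) u + ddir (fun z => ddir (vf_comp c Z) z (Y x)) u v) +
   (ddir (vf_comp c Z) u v *m Gamma s c u (Y x) +
    Z x *m vec_mx (ddir (vf_comp c Y) u v *m Gamma_mx s c u + Y x *m ddir (Gamma_mx s c) u v)).
Proof.
move=> hY hZ; have sY := vfield_near_smooth aM hY cx; have sZ := vfield_near_smooth aM hZ cx.
have sJ := smooth_J sZ; have smooth_Gamma_mx := smooth_Gamma_mx aM hs cx.
have E : \forall z \near u, vf_comp c Y z *m 'J (vf_comp c Z) z
  + vf_comp c Z z *m vec_mx (vf_comp c Y z *m Gamma_mx s c z) =
    vf_comp c (nabla s Y Z) z by apply: filterS (smooth_nabla hY hZ) => z [].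
have S1 := smooth_mul sY sJ; have S2 := smooth_mul sZ (smooth_vec (smooth_mul sY smooth_Gamma_mx)).
split; first exact: (smooth_near E (smooth_add S1 S2)).
have D := derD (der_mul (smooth_der sY) (smooth_der sJ))
   (der_mul (smooth_der sZ) (linear_mx_der (@lin_vec _ _ _) (der_mul (smooth_der sY) (smooth_der smooth_Gamma_mx)))).
refine (etrans (der_D v (der_near D E)) _).
have Yx : vf_comp c Y u = Y x by exact: vf_comp_chart_at.
have Zx : vf_comp c Z u = Z x by exact: vf_comp_chart_at.
have EJ : ddir (fun z => ddir (vf_comp c Z) z (Y x)) u v = Y x *m ddir (fun z => 'J (vf_comp c Z) z) u v.
  have D1 := der_mul (der_cst (Y x) u) (smooth_der sJ).
  have E1 : \forall z \near u, Y x *m 'J (vf_comp c Z) z = ddir (vf_comp c Z) z (Y x).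
    by apply: filterS (smooth_nbhs sZ) => z sz; rewrite /ddir (J_mul _ (smooth_der sz)).
  refine (etrans (der_D v (der_near D1 E1)) _).
  by rewrite mul0mx add0r.
rewrite EJ /Gamma -Yx -Zx; exact: erefl.
Qed.

(** S is the second derivative of Z, the same in both orders by Schwarz. E1 and E2 are the terms D Z
    Gamma; P, Q, G1 and its companion carry the derivatives of X and Y and are removed by the
    bracket. *)
Lemma curv_alg (P Q S E1 E2 G1 act2_fun A1 A2 M1 M2 : 'rV[R]_n) :
  ((P + S) + (E1 + (G1 + A1)) + (E2 + M1)) - ((Q + S) + (E2 + (act2_fun + A2)) + (E1 + M2)) - ((P - Q)
    + (G1 - act2_fun))
  = A1 - A2 + M1 - M2.
Proof. by apply/rowP => k; rewrite !mxE; ring. Qed.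

Lemma curvature_at (X Y Z : M -> 'rV[R]_n) :
  vfield_near x X -> vfield_near x Y -> vfield_near x Z ->
  curvature s X Y Z x = Z x *m curvature_mx c u (X x) (Y x).
Proof.
move=> hX hY hZ; have sX := vfield_near_smooth aM hX cx; have sY := vfield_near_smooth aM hY cx.
have sZ := vfield_near_smooth aM hZ cx.
have [sYZ DYZ] := D_nabla (X x) hY hZ; have [sXZ DXZ] := D_nabla (Y x) hX hZ.
have Sym : ddir (fun z => ddir (vf_comp c Z) z (X x)) u (Y x) = ddir (fun z => ddir (vf_comp c Z) z (Y x)) u (X x).
  exact: (D_swap (X x) (Y x) sZ).
have NJ (v : 'rV[R]_n) : ddir (vf_comp c Z) u v = v *m 'J (vf_comp c Z) u by rewrite /ddir (J_mul v (smooth_der sZ)).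
have E1 := nabla_at X sYZ; have E2 := nabla_at Y sXZ; have E3 := nabla_at (lie X Y) sZ.
rewrite (nabla_at Y sZ) in E1; rewrite (nabla_at X sZ) in E2.
rewrite NJ lie_at mulmxBl in E3.
have G1 (v : 'rV[R]_n) (w : 'rV[R]_n) : Z x *m Gamma s c u (v - w) =
  Z x *m vec_mx (v *m Gamma_mx s c u) - Z x *m vec_mx (w *m Gamma_mx s c u).
  by rewrite /Gamma mulmxBl linearB mulmxBr.
rewrite G1 in E3; rewrite DYZ linearD mulmxDr mulmxDl in E1; rewrite DXZ Sym linearD mulmxDr mulmxDl in E2.
rewrite /curvature E1 E2 E3 /curvature_mx.
refine (etrans (curv_alg _ _ _ _ _ _ _ _ _ _ _) _).
by rewrite mulmxBr mulmxDr mulmxBr !mulmxA.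
Qed.

End AtPoint.

Section AtXi.
Variable xi : H1 M.
Hypothesis uxi : B1 M xi.
Let c := chart_at (src xi).
Let d := chart_at (tgt xi).
Let w := phi (N := H1 M) (c, d) xi.
Let l := lin xi.

Lemma Xi_lin : Xi w = l. Proof. by rewrite Xi_phi; exact: hom_mx_chart_at. Qed.

Lemma AmxE v : affine_block s c d w v = Gamma s c (phi c (src xi)) v *m l - l *m Gamma s d (phi d (tgt xi)) (v *m l).
Proof. by rewrite /affine_block Xc_phi Yc_phi Xi_lin. Qed.

(** r A_v - v A_r is the torsion of (v, r) carried by l, minus the torsion of the images (v l, r
    l). *)
Lemma preserves2P : preserves2 xi (torsion s) <-> forall v r : 'rV[R]_n,
  r *m affine_block s c d w v = v *m affine_block s c d w r.
Proof.
have key (v r : 'rV[R]_n) : (r *m l) *m Gamma s d (phi d (tgt xi)) (v *m l)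
  - (v *m l) *m Gamma s d (phi d (tgt xi)) (r *m l) =
   (r *m Gamma s c (phi c (src xi)) v - v *m Gamma s c (phi c (src xi)) r) *m l <->
   r *m affine_block s c d w v = v *m affine_block s c d w r.
  rewrite !AmxE !mulmxBr mulmxBl !mulmxA.
  exact: sub_swap.
split=> [h v r|h X X' Y Y' [hX hX' EX] [hY hY' EY]]; last first.
  by rewrite (torsion_at hX hY) (torsion_at hX' hY') EX EY; apply/key.
have [X hX EX] := vfield_exists aM (src xi) v; have [Y hY EY] := vfield_exists aM (src xi) r.
have [X' hX' EX'] := vfield_exists aM (tgt xi) (v *m l); have [Y' hY' EY'] := vfield_exists aM (tgt xi) (r *m l).
have eX : extends xi X X' by split; rewrite ?EX'  ?EX.
have eY : extends xi Y Y' by split; rewrite ?EY'  ?EY.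
have := h _ _ _ _ eX eY.
by rewrite (torsion_at hX hY) (torsion_at hX' hY') EX EY EX' EY' => /key.
Qed.

Lemma preserves3P : preserves3 xi (curvature s) <-> forall v r : 'rV[R]_n,
  curvature_mx c (phi c (src xi)) v r *m l = l *m curvature_mx d (phi d (tgt xi)) (v *m l) (r *m l).
Proof.
split=> [h v r|h X X' Y Y' Z Z' [hX hX' EX] [hY hY' EY] [hZ hZ' EZ]]; last first.
  by rewrite (curvature_at hX hY hZ) (curvature_at hX' hY' hZ') EX EY EZ -!mulmxA h.
apply: eq_mul_rV => z.
have [X hX EX] := vfield_exists aM (src xi) v; have [Y hY EY] := vfield_exists aM (src xi) r.
have [Z hZ EZ] := vfield_exists aM (src xi) z; have [Z' hZ' EZ'] := vfield_exists aM (tgt xi) (z *m l).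
have [X' hX' EX'] := vfield_exists aM (tgt xi) (v *m l); have [Y' hY' EY'] := vfield_exists aM (tgt xi) (r *m l).
have eX : extends xi X X' by split; rewrite ?EX'  ?EX.
have eY : extends xi Y Y' by split; rewrite ?EY'  ?EY.
have eZ : extends xi Z Z' by split; rewrite ?EZ'  ?EZ.
have := h _ _ _ _ _ _ eX eY eZ.
by rewrite (curvature_at hX hY hZ) (curvature_at hX' hY' hZ') EX EY EZ EX' EY' EZ' !mulmxA => ->.
Qed.

End AtXi.
End Tensors.

(** gr, gv, hr, hv stand for Gamma at source and target on r, v and their images, and p, q, p', q'
    for derivatives of Gamma; gv l - l hv is thus A_v. k is Gamma_y(v A_r), which occurs in both
    lines thanks to torsion invariance. *)
Lemma curv_bracket (R : realType) n (p q gr gv hr hv k p' q' l : 'M[R]_n) :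
  (p *m l + gr *m (gv *m l - l *m hv) - ((gv *m l - l *m hv) *m hr + l *m (k + p'))) -
  (q *m l + gv *m (gr *m l - l *m hr) - ((gr *m l - l *m hr) *m hv + l *m (k + q'))) =
  (p - q + gr *m gv - gv *m gr) *m l - l *m (p' - q' + hr *m hv - hv *m hr).
Proof.
rewrite !(mulmxBl, mulmxDl, mulmxBr, mulmxDr, mulNmx, mulmxN) !mulmxA.
(* Products become atoms, so that [ring] faces an additive identity between entries. *)
repeat match goal with |- context [@mulmx ?S ?a ?b ?c ?A ?B] => let h := fresh in set h := (@mulmx S a b c A B);
  clearbody h end.
by apply/matrixP => i j; rewrite !mxE; ring.
Qed.

Lemma curv_bracketP (R : realType) n (p q gr gv hr hv k p' q' l : 'M[R]_n) :
  mxvec (p *m l + gr *m (gv *m l - l *m hv) - ((gv *m l - l *m hv) *m hr + l *m (k + p'))) =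
  mxvec (q *m l + gv *m (gr *m l - l *m hr) - ((gr *m l - l *m hr) *m hv + l *m (k + q'))) <->
  (p - q + gr *m gv - gv *m gr) *m l = l *m (p' - q' + hr *m hv - hv *m hr).
Proof.
split=> [/(can_inj mxvecK) H|H]; last first.
  by congr mxvec; apply/eqP; rewrite -subr_eq0 curv_bracket H subrr.
by apply/eqP; rewrite -subr_eq0 -(curv_bracket _ _ _ _ _ _ k) H subrr.
Qed.

Lemma block_symP (R : realType) n (D : 'rV[R]_n -> 'M[R]_(n, n + n + n * n)) (A : 'rV[R]_n -> 'M[R]_n) :
  (forall v, lsubmx (lsubmx (D v)) = 0) -> (forall v, rsubmx (lsubmx (D v)) = A v) ->
  (forall v r, r *m D v = v *m D r) <->
  (forall v r, r *m A v = v *m A r) /\ (forall v r, r *m rsubmx (D v) = v *m rsubmx (D r)).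
Proof.
move=> D0 DA; split=> [h|[h1 h2] v r].
  split=> v r; have := h v r; rewrite !mul_blocks => /eq_row_mx [/eq_row_mx [_ e1] e2]; last exact: e2.
  by rewrite !DA in e1.
by rewrite !mul_blocks !D0 !DA !mulmx0 h1 h2.
Qed.

Section Preserve.
Context {R : realType} {n : nat} (M : charted R n) (aM : atlas M).
Variable s : M -> H2 M.
Hypothesis hs : symmetry_jet s.
Variable xi : H1 M.
Hypothesis uxi : B1 M xi.
Let c := chart_at (src xi).
Let d := chart_at (tgt xi).
Let cx : dom c (src xi) := domx aM _.
Let dy : dom d (tgt xi) := domx aM _.
Let w := phi (N := H1 M) (c, d) xi.
Let l := lin xi.
Let uc := phi c (src xi).
Let ud := phi d (tgt xi).

Lemma D_affine_block (r : 'rV[R]_n) (v : 'rV[R]_(n + n + n * n)) :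
  ddir (fun u => mxvec (affine_block s c d u r)) w v =
  mxvec (vec_mx (r *m ddir (Gamma_mx s c) uc (Xc v)) *m l + Gamma s c uc r *m Xi v
    - (Xi v *m Gamma s d ud (r *m l) +
       l *m (Gamma s d ud (r *m Xi v) + vec_mx (r *m l *m ddir (Gamma_mx s d) ud (Yc v))))).
Proof.
have DX := linear_mx_der (@lin_Xi R n) (der_id w).
have DXc := linear_mx_der (@lin_Xc R n) (der_id w).
have DYc := linear_mx_der (@lin_Yc R n) (der_id w).
have E1 : Xc w = uc := Xc_phi c d xi.
have E2 : Yc w = ud := Yc_phi c d xi.
have k1 : smooth (Gamma_mx s c) (Xc w) by rewrite E1; exact: smooth_Gamma_mx.
have k2 : smooth (Gamma_mx s d) (Yc w) by rewrite E2; exact: smooth_Gamma_mx.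
have Dc := der_comp DXc (smooth_der k1).
have Dd := der_comp DYc (smooth_der k2).
have D1 := der_mul (linear_mx_der (@lin_vec _ _ _) (der_mul (der_cst r w) Dc)) DX.
have D2 := der_mul DX (linear_mx_der (@lin_vec _ _ _) (der_mul (der_mul (der_cst r w) DX) Dd)).
have D := linear_mx_der (@lin_mxvec _ _ _) (derD D1 (derN D2)).
refine (etrans (der_D v D) _).
rewrite /Gamma E1 E2 (Xi_lin aM xi) -/l.
by rewrite !mul0mx !add0r -[in RHS](linearD (@vec_mx R n n)).
Qed.

(** With r constant, contraction commutes with differentiation: the third block becomes the
    derivative of A_r, which [D_affine_block] computes. *)
Lemma rsub_Dist_deriv (v r : 'rV[R]_n) :
  r *m rsubmx (Dist_deriv s xi v) = ddir (fun u => mxvec (affine_block s c d u r)) w (v *m Dist_mx s c d w).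
Proof.
have D := smooth_der (smooth_Dist_mx aM hs cx dy).
have D1 := der_mul (der_cst r w) (linear_mx_der (@lin_rsub R n (n + n) (n * n)) D).
have E : \forall u \near w, r *m rsubmx (Dist_mx s c d u) = mxvec (affine_block s c d u r).
  by apply: filterE => u; rewrite /Dist_mx row_mxKr mul_affine_mx.
refine (etrans _ (esym (der_D _ (der_near D1 E)))).
by rewrite mul0mx add0r.
Qed.

Lemma Dist_sym_preserves : Dist_sym s xi <-> preserves2 xi (torsion s) /\ preserves3 xi (curvature s).
Proof.
rewrite (preserves2P aM hs xi) (preserves3P aM hs xi) /Dist_sym.
have step1 := block_symP (fun v => (Dist_deriv_blocks aM hs xi v).1) (fun v => (Dist_deriv_blocks aM hs xi v).2).
apply: (iff_trans step1).
have step2 : (forall v r : 'rV[R]_n, r *m affine_block s c d w v = v *m affine_block s c d w r) ->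
   forall v r : 'rV[R]_n, r *m rsubmx (Dist_deriv s xi v) = v *m rsubmx (Dist_deriv s xi r) <->
   curvature_mx s c uc v r *m l = l *m curvature_mx s d ud (v *m l) (r *m l).
  move=> h v r; rewrite !rsub_Dist_deriv !D_affine_block. rewrite !(mul_Dist_mx s c d w) (Xi_lin aM xi : Xi w = l).
  have EX a b A : Xc (H1_coord a b A) = a :> 'rV[R]_n by rewrite /Xc /H1_coord !row_mxKl.
  have EY a b A : Yc (H1_coord a b A) = b :> 'rV[R]_n by rewrite /Yc /H1_coord row_mxKl row_mxKr.
  have EA a b A : Xi (H1_coord a b A) = A :> 'M[R]_n by rewrite /Xi /H1_coord row_mxKr mxvecK.
  (* Torsion invariance turns Gamma_y(r A_v) into Gamma_y(v A_r), the common term k of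
     [curv_bracketP]. *)
  rewrite !EX !EY !EA h.
  rewrite !(AmxE aM) -/c -/d -/uc -/ud -/l.
  exact: curv_bracketP.
split=> -[h1 h2]; refine (conj h1 _) => v r; first exact: (step2 h1 v r).1 (h2 v r).
exact: (step2 h1 v r).2 (h2 v r).
Qed.
End Preserve.

Theorem lemma7p8 (R : realType) (n : nat) (M : charted R n)
    (hM : is_manifold M) (s : M -> H2 M) (hs : symmetry_jet s) :
  (forall xi : H1 M, B1 M xi ->
     (Int (B1 M) (Dist s) xi <-> kappa_jet (SSext s xi) = SSext s xi)) /\
  Int (B1 M) (Dist s) =
    [set xi | B1 M xi /\ preserves2 xi (torsion s) /\
                         preserves3 xi (curvature s)].
Proof.
have aM := manifold_atlas hM.
split=> [xi uxi|]; first by rewrite (Int_Dist_sym aM hs uxi) (kappa_jetP aM hs uxi).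
apply/seteqP; split=> xi.
  move=> h; have uxi : B1 M xi := h.1.
  by split=> //; apply/(Dist_sym_preserves aM hs xi)/(Int_Dist_sym aM hs uxi).
by move=> [uxi h]; apply/(Int_Dist_sym aM hs uxi)/(Dist_sym_preserves aM hs xi).
Qed.
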